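(* Let $0\le\delta<R\le\infty$ and let $u$ be a solution of $\mathcal{L}u=0$ in the cylinder $A(\delta,R)=(\delta,R)\times\mathbb{S}^1$. Then $u$ has a Laurent series expansion \[ u(r,t)=\sum_{j\in\mathbb{Z}}\big(a_j^+w_j^+(r,t)+a_j^-w_j^-(r,t)\big),\qquad a_j^\pm\in\mathbb{R}, \] converging in $A(\delta,R)$, and there is a constant $C>0$ (depending only on the family $\{w_j^\pm\}$) such that for every $R_0\in(\delta,R)$ \[ |a_j^\pm|\le \frac{C}{R_0^{\mathrm{Re}(\sigma_j^\pm)}}\max_{\theta}|u(R_0,\theta)|\qquad\forall j\in\mathbb{Z}. \]
   Context: Fix $a>0$, $b\in\mathbb{R}\setminus\{0\}$, $\lambda=a+ib$, $\nu\in[0,1)$, an integer $k\ge2$ and $c\in C^k(\mathbb{S}^1,\mathbb{C})$. On $(0,\infty)\times\mathbb{S}^1$ (coordinates $(r,t)$) let $\mathcal{L}u=\lambda u_t-iru_r+i\lambda\nu u-c(t)\bar u$. A basic solution of $\mathcal{L}$ is a nontrivial solution of $\mathcal{L}w=0$ on $(0,\infty)\times\mathbb{S}^1$ of the form $w=r^\sigma\phi(t)+\overline{r^\sigma\psi(t)}$, $\sigma\in\mathbb{C}$, $\phi,\psi$ $2\pi$-periodic, written with $|\phi|>|\psi|$ when $\sigma\notin\mathbb{R}$ and as $r^\sigma f$ ($f$ nowhere zero) when $\sigma\in\mathbb{R}$; $\sigma$ is its exponent and the winding number of $\phi$ (resp. $f$) its winding number. For each $j\in\mathbb{Z}$, $\mathcal{L}$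 has exactly two $\mathbb{R}$-independent basic solutions $w_j^\pm$ with winding number $j$, with exponents $\sigma_j^\pm$, where $\sigma_j^-=\sigma_j^+=:\sigma_j$ if $\sigma_j^+\notin\mathbb{R}$, and $\{\sigma_j^\pm\}$ is the set of all exponents. The family $\{w_j^\pm\}$ is fixed as follows: for $|j|$ large, $w_j^+=r^{\sigma_j}\phi_j+\overline{r^{\sigma_j}\psi_j}$ and $w_j^-=i\big(r^{\sigma_j}\phi_j-\overline{r^{\sigma_j}\psi_j}\big)$ where $\sigma_j=\lambda(j+\nu)+\gamma/j+O(j^{-2})$, $\phi_j=e^{ijt}(1+O(1/j))$, $\psi_j=O(1/j)$ uniformly in $t$ (here $\gamma=\frac1{4a\pi}\int_0^{2\pi}|c|^2$); for the finitely many remaining $j$ they are any fixed choice. *)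

(* Defs.v *)
From Stdlib Require Import Reals ZArith.
Open Scope R_scope.

Record Cx := mkC { Cre : R; Cim : R }.

Definition C0 : Cx := mkC 0 0.
Definition C1 : Cx := mkC 1 0.
Definition Ci : Cx := mkC 0 1.
Definition CofR (x : R) : Cx := mkC x 0.
Definition Cadd (z w : Cx) : Cx := mkC (Cre z + Cre w) (Cim z + Cim w).
Definition Copp (z : Cx) : Cx := mkC (- Cre z) (- Cim z).
Definition Csub (z w : Cx) : Cx := Cadd z (Copp w).
Definition Cmul (z w : Cx) : Cx :=
  mkC (Cre z * Cre w - Cim z * Cim w) (Cre z * Cim w + Cim z * Cre w).
Definition Cconj (z : Cx) : Cx := mkC (Cre z) (- Cim z).
Definition Cnorm (z : Cx) : R := sqrt (Cre z ^ 2 + Cim z ^ 2).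
Definition Cexp (z : Cx) : Cx := mkC (exp (Cre z) * cos (Cim z)) (exp (Cre z) * sin (Cim z)).
Definition Cpow (r : R) (s : Cx) : Cx := Cexp (mkC (Cre s * ln r) (Cim s * ln r)).

Definition is_deriv_C (f : R -> Cx) (x : R) (l : Cx) : Prop :=
  derivable_pt_lim (fun y => Cre (f y)) x (Cre l) /\
  derivable_pt_lim (fun y => Cim (f y)) x (Cim l).

Definition Ccont (f : R -> Cx) : Prop :=
  continuity (fun t => Cre (f t)) /\ continuity (fun t => Cim (f t)).

Definition periodic2pi (f : R -> Cx) : Prop := forall t, f (t + 2 * PI) = f t.

Definition C_k (k : nat) (f : R -> Cx) : Prop :=
  exists D : nat -> R -> Cx,
    (forall t, D 0%nat t = f t) /\
    (forall n t, (n < k)%nat -> is_deriv_C (D n) t (D (S n) t)) /\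
    Ccont (D k).

Definition cont2_on (dom : R -> Prop) (f : R -> R -> Cx) : Prop :=
  forall r t, dom r -> forall eps, 0 < eps -> exists d, 0 < d /\
    forall r' t', dom r' -> Rabs (r' - r) < d -> Rabs (t' - t) < d ->
      Cnorm (Csub (f r' t') (f r t)) < eps.

Definition L_expr (lam : Cx) (nu : R) (c : R -> Cx) (r t : R) (u ur ut : Cx) : Cx :=
  Csub (Cadd (Csub (Cmul lam ut) (Cmul Ci (Cmul (CofR r) ur)))
             (Cmul Ci (Cmul lam (Cmul (CofR nu) u))))
       (Cmul (c t) (Cconj u)).

Definition L_solution (lam : Cx) (nu : R) (c : R -> Cx) (dom : R -> Prop)
    (u : R -> R -> Cx) : Prop :=
  (forall r t, dom r -> u r (t + 2 * PI) = u r t) /\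
  exists ur ut : R -> R -> Cx,
    (forall r t, dom r ->
       is_deriv_C (fun s => u s t) r (ur r t) /\
       is_deriv_C (fun s => u r s) t (ut r t)) /\
    cont2_on dom u /\ cont2_on dom ur /\ cont2_on dom ut /\
    (forall r t, dom r -> L_expr lam nu c r t (u r t) (ur r t) (ut r t) = C0).

Definition winding (g : R -> Cx) (j : Z) : Prop :=
  exists th : R -> R, continuity th /\
    (forall t, g t = Cmul (CofR (Cnorm (g t))) (Cexp (mkC 0 (th t)))) /\
    (forall t, th (t + 2 * PI) = th t + 2 * PI * IZR j).

Definition basic_solution (lam : Cx) (nu : R) (c : R -> Cx)
    (w : R -> R -> Cx) (sigma : Cx) (j : Z) : Prop :=
  L_solution lam nu c (fun r => 0 < r) w /\
  (exists r t, 0 < r /\ w r t <> C0) /\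
  (Cim sigma <> 0 ->
     exists phi psi : R -> Cx,
       Ccont phi /\ Ccont psi /\ periodic2pi phi /\ periodic2pi psi /\
       (forall t, Cnorm (psi t) < Cnorm (phi t)) /\
       (forall r t, 0 < r ->
          w r t = Cadd (Cmul (Cpow r sigma) (phi t)) (Cconj (Cmul (Cpow r sigma) (psi t)))) /\
       winding phi j) /\
  (Cim sigma = 0 ->
     exists f : R -> Cx,
       Ccont f /\ periodic2pi f /\ (forall t, f t <> C0) /\
       (forall r t, 0 < r -> w r t = Cmul (Cpow r sigma) (f t)) /\
       winding f j).

Definition R_independent (w1 w2 : R -> R -> Cx) : Prop :=
  forall al be : R,
    (forall r t, 0 < r ->
       Cadd (Cmul (CofR al) (w1 r t)) (Cmul (CofR be) (w2 r t)) = C0) ->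
    al = 0 /\ be = 0.

(* the fixed family {w_j^+, w_j^-} (true = +, false = -) with exponents sig *)
Definition fixed_family (lam : Cx) (nu : R) (c : R -> Cx) (gamma : R)
    (w : Z -> bool -> R -> R -> Cx) (sig : Z -> bool -> Cx) : Prop :=
  (forall j,
     basic_solution lam nu c (w j true) (sig j true) j /\
     basic_solution lam nu c (w j false) (sig j false) j /\
     R_independent (w j true) (w j false)) /\
  exists (J : Z) (K : R), (1 <= J)%Z /\ 0 < K /\
    forall j, (J <= Z.abs j)%Z ->
      exists (s : Cx) (phi psi : R -> Cx),
        sig j true = s /\ sig j false = s /\
        periodic2pi phi /\ periodic2pi psi /\
        Cnorm (Csub s (Cadd (Cmul lam (CofR (IZR j + nu))) (CofR (gamma / IZR j))))
          <= K / (IZR j ^ 2) /\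
        (forall t, Cnorm (Csub (Cmul (phi t) (Cexp (mkC 0 (- (IZR j * t))))) C1)
                     <= K / Rabs (IZR j)) /\
        (forall t, Cnorm (psi t) <= K / Rabs (IZR j)) /\
        (forall r t, 0 < r ->
           w j true r t = Cadd (Cmul (Cpow r s) (phi t)) (Cconj (Cmul (Cpow r s) (psi t)))) /\
        (forall r t, 0 < r ->
           w j false r t = Cmul Ci (Csub (Cmul (Cpow r s) (phi t))
                                         (Cconj (Cmul (Cpow r s) (psi t))))).

Fixpoint symsum (f : Z -> Cx) (N : nat) : Cx :=
  match N with
  | O => f 0%Z
  | S n => Cadd (Cadd (symsum f n) (f (Z.of_nat (S n)))) (f (- Z.of_nat (S n))%Z)
  end.

Definition Cseq_cv (s : nat -> Cx) (l : Cx) : Prop :=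
  Un_cv (fun n => Cre (s n)) (Cre l) /\ Un_cv (fun n => Cim (s n)) (Cim l).

(* the annulus radius range (delta, Rmax), Rmax = None meaning +infinity *)
Definition in_range (delta : R) (Rmax : option R) (r : R) : Prop :=
  delta < r /\ match Rmax with Some R0 => r < R0 | None => True end.

Definition below_max (delta : R) (Rmax : option R) : Prop :=
  match Rmax with Some R0 => delta < R0 | None => True end.

(* Main.v *)
(** In the variable [ln r] the equation [L u = 0] reads [r u_r = Q u], where
    [Q u = - i lam u_t + lam nu u + i c conj u] acts on functions of [t], and a basic solution
    [r^s phi + conj (r^s psi)] is the orbit of an eigenfunction of [Q]. At [r = 1] the family
    [w_j^+-] is quadratically close to [e^(ijt), i e^(ijt)], so by a Neumann series its tail, completed
    by finitely many exponentials, is a basis; a dimension count then shows that the family itself is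
    a basis as soon as it satisfies no relation.

    For a real number [tau] far from the lines [R lam] and [R (conj lam)], [tau - Q] is injective (here
    [b <> 0] is used). Relations are therefore stable under [(tau - Q)^-1], hence under rational
    functions of the exponents, and they split into relations with a single exponent. For a nonreal
    exponent [|phi| = |psi|] can only be crossed in one direction (here [a > 0] is used), so periodic
    eigenfunctions are unique up to a complex factor; for a real one the Wronskian of two
    eigenfunctions never changes sign. In both cases equal exponents force equal winding numbers,
    and no nontrivial relation is left.

    The coefficients of [u(r, .)] in this basis are bounded by [max |u(r, .)|] and, by the same
    resolvent argument, evolve by the factor [r^(sigma_j)]. Comparing two radii gives both
    the estimate and the geometric convergence of the series. *)

(* A continuous function of [t] may have a divergent series in the family, and [Q] is unbounded, so
   neither termwise evaluation nor termwise application of [Q] is available. A tail series with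
   coefficients [F v j] is therefore encoded as [v + K0 v], with [v] continuous and [K0] collecting
   only the O(1/j) deviations from [e^(ijt)]: Bessel's inequality makes that sum uniformly
   convergent and bounds [K0] by 1/4 in the sup norm, so no Hilbert space is built. The operator [Q]
   enters the relations only through its resolvent, in Fourier form: dividing by [tau - sigma_j]
   gains 1/|j|, after which series converge absolutely. The number [tau] is real because [Q] is only
   R-linear.

   That a nonreal exponent is shared by [w_j^+] and [w_j^-] is assumed in [fixed_family] only for
   large [j]. For small [j] it is deduced from completeness; it lets the two real coefficients merge
   into one complex coordinate that evolves by [r^(sigma_j)].

   All constants bound coefficient functionals on the circle and are fixed before [delta], [Rmax]
   and [u], hence their uniformity. *)
From Stdlib Require Import Reals ZArith Lra Lia Classical ClassicalEpsilon List.
From Coquelicot Require Import Coquelicot.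
Require Import Defs.
Open Scope R_scope.

(** * Complex numbers *)

Declare Scope Cx_scope.
Delimit Scope Cx_scope with Cx.
Bind Scope Cx_scope with Cx.

Definition Cinv (z : Cx) : Cx :=
  mkC (Cre z / (Cre z ^ 2 + Cim z ^ 2)) (- Cim z / (Cre z ^ 2 + Cim z ^ 2)).
Definition Cdiv (z w : Cx) : Cx := Cmul z (Cinv w).

Infix "+" := Cadd : Cx_scope.
Infix "*" := Cmul : Cx_scope.
Infix "-" := Csub : Cx_scope.
Infix "/" := Cdiv : Cx_scope.
Notation "- x" := (Copp x) : Cx_scope.
Notation "/ x" := (Cinv x) : Cx_scope.

Lemma Cx_ext (z w : Cx) : Cre z = Cre w -> Cim z = Cim w -> z = w.
Proof. destruct z, w; simpl; intros; subst; reflexivity. Qed.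

Ltac cx := apply Cx_ext; simpl; try ring.

Lemma Cx_sqr_neq0 (z : Cx) : z <> C0 -> Cre z ^ 2 + Cim z ^ 2 <> 0.
Proof.
  intros H E; apply H.
  assert (Cre z = 0) by nra. assert (Cim z = 0) by nra. apply Cx_ext; simpl; lra.
Qed.

Lemma Cx_field_theory : field_theory C0 C1 Cadd Cmul Csub Copp Cdiv Cinv (@eq Cx).
Proof.
  constructor.
  - constructor; intros; try (cx; fail).
  - intros E. apply (f_equal Cre) in E. simpl in E. lra.
  - reflexivity.
  - intros z H. apply Cx_sqr_neq0 in H. apply Cx_ext; simpl; field; simpl in H; contradict H; rewrite <- H; ring.
Qed.
Add Field Cx_field : Cx_field_theory.

(** [Cnorm] is convertible to Coquelicot's [Cmod], from which multiplicativity and the triangle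
    inequality are inherited. *)
Lemma Cnorm_Cmod (z : Cx) : Cnorm z = Cmod (Cre z, Cim z).
Proof. reflexivity. Qed.

Lemma Cnorm_ge0 z : 0 <= Cnorm z.
Proof. apply sqrt_pos. Qed.

Lemma Cnorm_sqr z : Cnorm z ^ 2 = Cre z ^ 2 + Cim z ^ 2.
Proof. unfold Cnorm. rewrite pow2_sqrt; nra. Qed.

Lemma Cnorm_mul z w : Cnorm (z * w)%Cx = Cnorm z * Cnorm w.
Proof. rewrite !Cnorm_Cmod, <- Cmod_mult. reflexivity. Qed.

Lemma Cnorm_add z w : Cnorm (z + w)%Cx <= Cnorm z + Cnorm w.
Proof. rewrite !Cnorm_Cmod. apply (Cmod_triangle (Cre z, Cim z) (Cre w, Cim w)). Qed.

Lemma Cnorm_opp z : Cnorm (- z)%Cx = Cnorm z.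
Proof. unfold Cnorm; simpl; f_equal; ring. Qed.

Lemma Cnorm_sub z w : Cnorm (z - w)%Cx <= Cnorm z + Cnorm w.
Proof. unfold Csub. rewrite <- (Cnorm_opp w). apply Cnorm_add. Qed.

Lemma Cnorm_subC z w : Cnorm (z - w)%Cx = Cnorm (w - z)%Cx.
Proof. rewrite <- Cnorm_opp. f_equal. ring. Qed.

Lemma Cnorm_conj z : Cnorm (Cconj z) = Cnorm z.
Proof. unfold Cnorm; simpl; f_equal; ring. Qed.

Lemma Cnorm_CofR x : Cnorm (CofR x) = Rabs x.
Proof. unfold Cnorm; simpl. rewrite <- sqrt_Rsqr_abs. f_equal. unfold Rsqr; ring. Qed.

Lemma Cnorm_C0 : Cnorm C0 = 0.
Proof. change C0 with (CofR 0). rewrite Cnorm_CofR, Rabs_R0; reflexivity. Qed.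

Lemma Cnorm_C1 : Cnorm C1 = 1.
Proof. change C1 with (CofR 1). rewrite Cnorm_CofR, Rabs_R1; reflexivity. Qed.

Lemma Cnorm_Ci : Cnorm Ci = 1.
Proof. unfold Cnorm; simpl. replace (0 * (0 * 1) + 1 * (1 * 1)) with 1 by ring. apply sqrt_1. Qed.

Lemma Cnorm_eq0 z : Cnorm z = 0 -> z = C0.
Proof.
  intros H. assert (Cnorm z ^ 2 = 0) by (rewrite H; ring).
  rewrite Cnorm_sqr in H0. apply Cx_ext; simpl; nra.
Qed.

Lemma Cnorm_gt0 z : z <> C0 -> 0 < Cnorm z.
Proof.
  intros H. destruct (Rle_lt_or_eq_dec _ _ (Cnorm_ge0 z)); auto.
  exfalso; apply H, Cnorm_eq0; auto.
Qed.

Lemma Cnorm_inv z : z <> C0 -> Cnorm (/ z)%Cx = / Cnorm z.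
Proof.
  intros H. pose proof (Cnorm_gt0 z H).
  apply Rmult_eq_reg_l with (Cnorm z); [|lra].
  rewrite <- Cnorm_mul, Rinv_r by lra. replace (z * / z)%Cx with C1 by (field; auto).
  apply Cnorm_C1.
Qed.

Lemma Cre_le_norm z : Rabs (Cre z) <= Cnorm z.
Proof.
  pose proof (Cnorm_sqr z). pose proof (Cnorm_ge0 z). apply Rabs_le. split; nra.
Qed.

Lemma Cim_le_norm z : Rabs (Cim z) <= Cnorm z.
Proof.
  pose proof (Cnorm_sqr z). pose proof (Cnorm_ge0 z). apply Rabs_le. split; nra.
Qed.

Lemma Cnorm_le_sum z : Cnorm z <= Rabs (Cre z) + Rabs (Cim z).
Proof.
  replace z with (CofR (Cre z) + CofR (Cim z) * Ci)%Cx at 1 by cx.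
  eapply Rle_trans; [apply Cnorm_add|]. rewrite Cnorm_mul, !Cnorm_CofR, Cnorm_Ci; lra.
Qed.

Lemma Cmul_eq0 z w : (z * w)%Cx = C0 -> z = C0 \/ w = C0.
Proof.
  intros H. apply (f_equal Cnorm) in H. rewrite Cnorm_mul, Cnorm_C0 in H.
  apply Rmult_integral in H. destruct H; [left|right]; apply Cnorm_eq0; auto.
Qed.

Lemma Csub_eq0 z w : (z - w)%Cx = C0 -> z = w.
Proof. intros H. replace z with ((z - w) + w)%Cx by ring. rewrite H; ring. Qed.

Lemma Cconj_add z w : Cconj (z + w) = (Cconj z + Cconj w)%Cx.
Proof. cx. Qed.
Lemma Cconj_sub z w : Cconj (z - w) = (Cconj z - Cconj w)%Cx.
Proof. cx. Qed.
Lemma Cconj_mul z w : Cconj (z * w) = (Cconj z * Cconj w)%Cx.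
Proof. cx. Qed.
Lemma Cconj_conj z : Cconj (Cconj z) = z.
Proof. cx. Qed.
Lemma Cconj_CofR x : Cconj (CofR x) = CofR x.
Proof. cx. Qed.
Lemma Cconj_inv z : Cconj (/ z) = (/ Cconj z)%Cx.
Proof. apply Cx_ext; simpl; replace (- Cim z * (- Cim z * 1)) with (Cim z * (Cim z * 1)) by ring; unfold Rdiv; ring. Qed.

Lemma CofR_add x y : CofR (x + y) = (CofR x + CofR y)%Cx.
Proof. cx. Qed.
Lemma CofR_mul x y : CofR (x * y) = (CofR x * CofR y)%Cx.
Proof. cx. Qed.
Lemma CofR_opp x : CofR (- x) = (- CofR x)%Cx.
Proof. cx. Qed.
Lemma CofR_sub x y : CofR (x - y) = (CofR x - CofR y)%Cx.
Proof. cx. Qed.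
Lemma CofR_neq0 x : x <> 0 -> CofR x <> C0.
Proof. intros H E; apply H. exact (f_equal Cre E). Qed.

Lemma Cexp_add z w : Cexp (z + w) = (Cexp z * Cexp w)%Cx.
Proof. apply Cx_ext; simpl; rewrite exp_plus, ?cos_plus, ?sin_plus; ring. Qed.

Lemma Cexp_C0 : Cexp C0 = C1.
Proof. apply Cx_ext; simpl; rewrite exp_0, ?cos_0, ?sin_0; ring. Qed.

Lemma Cnorm_Cexp z : Cnorm (Cexp z) = exp (Cre z).
Proof.
  assert (H : Cnorm (Cexp z) ^ 2 = exp (Cre z) ^ 2).
  { rewrite Cnorm_sqr; simpl. pose proof (sin2_cos2 (Cim z)) as S. unfold Rsqr in S.
    transitivity (exp (Cre z) ^ 2 * (sin (Cim z) * sin (Cim z) + cos (Cim z) * cos (Cim z))); [ring|].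
    rewrite S; ring. }
  pose proof (Cnorm_ge0 (Cexp z)). pose proof (exp_pos (Cre z)). nra.
Qed.

Lemma Cexp_neq0 z : Cexp z <> C0.
Proof.
  intros H. apply (f_equal Cnorm) in H. rewrite Cnorm_Cexp, Cnorm_C0 in H.
  pose proof (exp_pos (Cre z)); lra.
Qed.

Lemma Cpow_1 s : Cpow 1 s = C1.
Proof. unfold Cpow. rewrite ln_1, !Rmult_0_r. apply Cexp_C0. Qed.

Lemma Cnorm_Cpow r s : Cnorm (Cpow r s) = Rpower r (Cre s).
Proof. unfold Cpow. rewrite Cnorm_Cexp. reflexivity. Qed.

Lemma Cpow_opp r s : (Cpow r s * Cpow r (- s))%Cx = C1.
Proof.
  unfold Cpow. rewrite <- Cexp_add, <- Cexp_C0. f_equal. cx.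
Qed.

(** * Symmetric sums over the integers *)

Fixpoint rsum (f : Z -> R) (N : nat) : R :=
  match N with
  | O => f 0%Z
  | S n => rsum f n + f (Z.of_nat (S n)) + f (- Z.of_nat (S n))%Z
  end.

Lemma rsum_le f g N : (forall j, (Z.abs j <= Z.of_nat N)%Z -> f j <= g j) -> rsum f N <= rsum g N.
Proof.
  induction N; intros H; cbn [rsum].
  - apply H; lia.
  - assert (rsum f N <= rsum g N) by (apply IHN; intros; apply H; lia).
    pose proof (H (Z.of_nat (S N)) ltac:(lia)). pose proof (H (- Z.of_nat (S N))%Z ltac:(lia)). lra.
Qed.

Lemma rsum_plus f g N : rsum (fun j => f j + g j) N = rsum f N + rsum g N.
Proof. induction N; cbn [rsum]; [reflexivity|rewrite IHN; ring]. Qed.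

Lemma rsum_scal k f N : rsum (fun j => k * f j) N = k * rsum f N.
Proof. induction N; cbn [rsum]; [reflexivity|rewrite IHN; ring]. Qed.

Lemma rsum_ge0 f N : (forall j, 0 <= f j) -> 0 <= rsum f N.
Proof.
  intros H; induction N; cbn [rsum]; [apply H|].
  pose proof (H (Z.of_nat (S N))). pose proof (H (- Z.of_nat (S N))%Z). lra.
Qed.

Lemma rsum_mono f m n : (forall j, 0 <= f j) -> (m <= n)%nat -> rsum f m <= rsum f n.
Proof.
  intros H L; induction L; [lra|]. cbn [rsum].
  pose proof (H (Z.of_nat (S m0))). pose proof (H (- Z.of_nat (S m0))%Z). lra.
Qed.

Lemma symsum_ext f g N :
  (forall j, (Z.abs j <= Z.of_nat N)%Z -> f j = g j) -> symsum f N = symsum g N.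
Proof.
  induction N; intros H; cbn [symsum].
  - apply H; lia.
  - rewrite IHN, !H by (intros; try apply H; lia). reflexivity.
Qed.

Lemma symsum_add f g N : symsum (fun j => f j + g j)%Cx N = (symsum f N + symsum g N)%Cx.
Proof. induction N; cbn [symsum]; [reflexivity|rewrite IHN; ring]. Qed.

Lemma symsum_mul z f N : symsum (fun j => z * f j)%Cx N = (z * symsum f N)%Cx.
Proof. induction N; cbn [symsum]; [reflexivity|rewrite IHN; ring]. Qed.

Lemma symsum_conj f N : symsum (fun j => Cconj (f j)) N = Cconj (symsum f N).
Proof. induction N; cbn [symsum]; [reflexivity|rewrite IHN, !Cconj_add; ring]. Qed.

Lemma symsum_norm f N : Cnorm (symsum f N) <= rsum (fun j => Cnorm (f j)) N.
Proof.
  induction N; cbn [symsum rsum]; [lra|].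
  eapply Rle_trans; [apply Cnorm_add|]. apply Rplus_le_compat_r.
  eapply Rle_trans; [apply Cnorm_add|]. lra.
Qed.

Lemma symsum_diff_norm f b m n :
  (forall j, Cnorm (f j) <= b j) -> (m <= n)%nat ->
  Cnorm (symsum f n - symsum f m)%Cx <= rsum b n - rsum b m.
Proof.
  intros H L; induction L.
  - replace (symsum f m - symsum f m)%Cx with C0 by ring. rewrite Cnorm_C0; lra.
  - cbn [symsum rsum].
    set (x := f (Z.of_nat (S m0))). set (y := f (- Z.of_nat (S m0))%Z).
    replace (symsum f m0 + x + y - symsum f m)%Cx with ((symsum f m0 - symsum f m) + x + y)%Cx by ring.
    eapply Rle_trans; [apply Cnorm_add|]. unfold y at 1. pose proof (H (- Z.of_nat (S m0))%Z).
    pose proof (Cnorm_add (symsum f m0 - symsum f m) x). pose proof (H (Z.of_nat (S m0))). fold x in H2. lra.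
Qed.

(** * Convergence in norm and series with a summable majorant *)

Definition ccv (s : nat -> Cx) (l : Cx) : Prop :=
  forall eps, 0 < eps -> exists N, forall n, (N <= n)%nat -> Cnorm (s n - l)%Cx < eps.

Lemma ccv_Cseq_cv s l : ccv s l -> Cseq_cv s l.
Proof.
  intros H; split; intros eps He; destruct (H eps He) as [N HN]; exists N; intros n Hn;
    specialize (HN n Hn); unfold R_dist.
  - eapply Rle_lt_trans; [|exact HN]. apply (Cre_le_norm (s n - l)).
  - eapply Rle_lt_trans; [|exact HN]. apply (Cim_le_norm (s n - l)).
Qed.

Lemma Cseq_cv_ccv s l : Cseq_cv s l -> ccv s l.
Proof.
  intros [H1 H2] eps He.
  destruct (H1 (eps / 2)) as [N1 A1]; [lra|]. destruct (H2 (eps / 2)) as [N2 A2]; [lra|].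
  exists (N1 + N2)%nat; intros n Hn.
  specialize (A1 n ltac:(lia)). specialize (A2 n ltac:(lia)). unfold R_dist in *.
  pose proof (Cnorm_le_sum (s n - l)). simpl in H. unfold Rminus in *. lra.
Qed.

Lemma small_eq0 x : (forall eps, 0 < eps -> Rabs x <= eps) -> x = 0.
Proof.
  intros H. destruct (Req_dec x 0) as [|n]; auto. exfalso.
  pose proof (Rabs_pos_lt x n). specialize (H (Rabs x / 2) ltac:(lra)). lra.
Qed.

Lemma Csmall_eq0 z : (forall eps, 0 < eps -> Cnorm z <= eps) -> z = C0.
Proof.
  intros H. apply Cnorm_eq0, small_eq0. intros eps He. rewrite Rabs_pos_eq by apply Cnorm_ge0. auto.
Qed.

Lemma ccv_unique s l l' : ccv s l -> ccv s l' -> l = l'.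
Proof.
  intros H H'. apply Csub_eq0, Csmall_eq0. intros eps He.
  destruct (H (eps / 2) ltac:(lra)) as [N A]. destruct (H' (eps / 2) ltac:(lra)) as [N' A'].
  specialize (A (N + N')%nat ltac:(lia)). specialize (A' (N + N')%nat ltac:(lia)).
  rewrite Cnorm_subC in A. replace (l - l')%Cx with ((l - s (N + N')%nat) + (s (N + N')%nat - l'))%Cx by ring.
  eapply Rle_trans; [apply Cnorm_add|]. lra.
Qed.

Lemma ccv_ext s s' l : (forall n, s n = s' n) -> ccv s l -> ccv s' l.
Proof. intros E H eps He. destruct (H eps He) as [N A]. exists N; intros; rewrite <- E; auto. Qed.

Lemma ccv_add s s' l l' : ccv s l -> ccv s' l' -> ccv (fun n => s n + s' n)%Cx (l + l')%Cx.
Proof.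
  intros H H' eps He.
  destruct (H (eps / 2) ltac:(lra)) as [N A]. destruct (H' (eps / 2) ltac:(lra)) as [N' A'].
  exists (N + N')%nat; intros n Hn. specialize (A n ltac:(lia)). specialize (A' n ltac:(lia)).
  replace (s n + s' n - (l + l'))%Cx with ((s n - l) + (s' n - l'))%Cx by ring.
  eapply Rle_lt_trans; [apply Cnorm_add|]. lra.
Qed.

Lemma ccv_lip (T : Cx -> Cx) k s l :
  (forall x y, Cnorm (T x - T y)%Cx <= k * Cnorm (x - y)%Cx) -> ccv s l -> ccv (fun n => T (s n)) (T l).
Proof.
  intros HT H eps He. set (k' := Rmax k 1). assert (0 < k') by (unfold k'; pose proof (Rmax_r k 1); lra).
  destruct (H (eps / k')) as [N A]; [apply Rdiv_lt_0_compat; lra|].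
  exists N; intros n Hn. specialize (A n Hn). eapply Rle_lt_trans; [apply HT|].
  apply Rle_lt_trans with (k' * Cnorm (s n - l)%Cx).
  - apply Rmult_le_compat_r; [apply Cnorm_ge0|apply Rmax_l].
  - apply (Rmult_lt_compat_l k') in A; auto. replace (k' * (eps / k')) with eps in A by (field; lra). auto.
Qed.

Lemma ccv_mul z s l : ccv s l -> ccv (fun n => z * s n)%Cx (z * l)%Cx.
Proof.
  apply (ccv_lip (fun x => z * x)%Cx (Cnorm z)). intros x y.
  replace (z * x - z * y)%Cx with (z * (x - y))%Cx by ring. rewrite Cnorm_mul; lra.
Qed.

Lemma ccv_conj s l : ccv s l -> ccv (fun n => Cconj (s n)) (Cconj l).
Proof.
  apply (ccv_lip Cconj 1). intros x y. rewrite <- Cconj_sub, Cnorm_conj; lra.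
Qed.

Lemma ccv_bound s l B : ccv s l -> (forall n, Cnorm (s n) <= B) -> Cnorm l <= B.
Proof.
  intros H HB. apply Rnot_lt_le. intros Hl. destruct (H (Cnorm l - B) ltac:(lra)) as [N A].
  specialize (A N (le_n _)). specialize (HB N). rewrite Cnorm_subC in A.
  pose proof (Cnorm_add (l - s N) (s N)). replace (l - s N + s N)%Cx with l in H0 by ring. lra.
Qed.

Definition summable (b : Z -> R) : Prop :=
  (forall j, 0 <= b j) /\ exists B, forall N, rsum b N <= B.

(** Made total by [Lim_seq]: the value is the sum only when the symmetric partial sums converge,
    hence the summable majorant in most of the lemmas on it. *)
Definition zsum (f : Z -> Cx) : Cx :=
  mkC (real (Lim_seq (fun N => Cre (symsum f N)))) (real (Lim_seq (fun N => Cim (symsum f N)))).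

Lemma summable_cauchy b : summable b ->
  forall eps, 0 < eps -> exists N, forall m n, (N <= m)%nat -> (m <= n)%nat -> rsum b n - rsum b m <= eps.
Proof.
  intros [Hp [B HB]] eps He.
  destruct (growing_cv (rsum b)) as [l Hl].
  - intros n. apply rsum_mono; auto.
  - exists B. intros x [n ->]. apply HB.
  - destruct (Hl (eps / 2) ltac:(lra)) as [N A]. exists N. intros m n Hm Hn.
    pose proof (A m ltac:(lia)) as A1. pose proof (A n ltac:(lia)) as A2. unfold R_dist in *.
    apply Rabs_def2 in A1. apply Rabs_def2 in A2. lra.
Qed.

Lemma symsum_ccv_zsum f b : summable b -> (forall j, Cnorm (f j) <= b j) -> ccv (symsum f) (zsum f).
Proof.
  intros Hb Hf. apply Cseq_cv_ccv.
  assert (G : forall g : Cx -> R, (forall z w, Rabs (g z - g w) <= Cnorm (z - w)%Cx) ->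
    Un_cv (fun N => g (symsum f N)) (real (Lim_seq (fun N => g (symsum f N))))).
  { intros g Hg. apply is_lim_seq_Reals. apply Lim_seq_correct'. apply ex_lim_seq_cauchy_corr.
    intros [eps He]. destruct (summable_cauchy b Hb (eps / 2) ltac:(lra)) as [N A]. exists N.
    assert (W : forall n m, (N <= n)%nat -> (N <= m)%nat -> (m <= n)%nat ->
              Rabs (g (symsum f n) - g (symsum f m)) < eps).
    { intros n m Hn Hm L. eapply Rle_lt_trans; [apply Hg|].
      eapply Rle_lt_trans; [apply symsum_diff_norm with (b := b); auto|].
      specialize (A m n Hm L). lra. }
    intros n m Hn Hm. simpl. destruct (Nat.le_ge_cases m n); [auto|rewrite Rabs_minus_sym; auto]. }
  split; simpl.
  - apply G. intros z w. apply (Cre_le_norm (z - w)).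
  - apply G. intros z w. apply (Cim_le_norm (z - w)).
Qed.

(* The rank [N] depends only on the dominating family, which is what makes limits uniform in [t]. *)
Lemma zsum_uniform b : summable b -> forall eps, 0 < eps ->
  exists N, forall f, (forall j, Cnorm (f j) <= b j) ->
    forall n, (N <= n)%nat -> Cnorm (zsum f - symsum f n)%Cx <= eps.
Proof.
  intros Hb eps He. destruct (summable_cauchy b Hb (eps / 2) ltac:(lra)) as [N A]. exists N.
  intros f Hf n Hn. destruct (symsum_ccv_zsum f b Hb Hf (eps / 2) ltac:(lra)) as [N' A'].
  specialize (A' (n + N')%nat ltac:(lia)). rewrite Cnorm_subC in A'.
  replace (zsum f - symsum f n)%Cx
    with ((zsum f - symsum f (n + N')%nat) + (symsum f (n + N')%nat - symsum f n))%Cx by ring.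
  eapply Rle_trans; [apply Cnorm_add|].
  pose proof (symsum_diff_norm f b n (n + N')%nat Hf ltac:(lia)).
  specialize (A n (n + N')%nat Hn ltac:(lia)). lra.
Qed.

Lemma zsum_eq f b l : summable b -> (forall j, Cnorm (f j) <= b j) -> ccv (symsum f) l -> zsum f = l.
Proof. intros Hb Hf H. eapply ccv_unique; [eapply symsum_ccv_zsum; eauto|auto]. Qed.

Lemma zsum_ext f g : (forall j, f j = g j) -> zsum f = zsum g.
Proof.
  intros H. unfold zsum. f_equal; f_equal; apply Lim_seq_ext; intros n; f_equal;
    apply symsum_ext; auto.
Qed.

Lemma summable_plus b b' : summable b -> summable b' -> summable (fun j => b j + b' j).
Proof.
  intros [H [B HB]] [H' [B' HB']]. split.
  - intros j. pose proof (H j); pose proof (H' j); lra.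
  - exists (B + B'). intros N. rewrite rsum_plus. pose proof (HB N); pose proof (HB' N); lra.
Qed.

Lemma summable_scal k b : 0 <= k -> summable b -> summable (fun j => k * b j).
Proof.
  intros Hk [H [B HB]]. split.
  - intros j. apply Rmult_le_pos; auto.
  - exists (k * B). intros N. rewrite rsum_scal. apply Rmult_le_compat_l; auto.
Qed.

Lemma summable_le b b' : (forall j, 0 <= b j <= b' j) -> summable b' -> summable b.
Proof.
  intros H [H' [B HB]]. split; [intros j; apply H|]. exists B. intros N.
  eapply Rle_trans; [|apply (HB N)]. apply rsum_le. intros; apply H.
Qed.

Lemma zsum_add f g b b' : summable b -> summable b' ->
  (forall j, Cnorm (f j) <= b j) -> (forall j, Cnorm (g j) <= b' j) ->
  zsum (fun j => f j + g j)%Cx = (zsum f + zsum g)%Cx.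
Proof.
  intros. apply zsum_eq with (b := fun j => b j + b' j).
  - apply summable_plus; auto.
  - intros j. eapply Rle_trans; [apply Cnorm_add|]. pose proof (H1 j); pose proof (H2 j); lra.
  - eapply ccv_ext; [intros; symmetry; apply symsum_add|]. apply ccv_add; [apply symsum_ccv_zsum with b|apply symsum_ccv_zsum with b']; auto.
Qed.

Lemma zsum_mul z f b : summable b -> (forall j, Cnorm (f j) <= b j) ->
  zsum (fun j => z * f j)%Cx = (z * zsum f)%Cx.
Proof.
  intros. apply zsum_eq with (b := fun j => Cnorm z * b j).
  - apply summable_scal; auto. apply Cnorm_ge0.
  - intros j. rewrite Cnorm_mul. apply Rmult_le_compat_l; auto. apply Cnorm_ge0.
  - eapply ccv_ext; [intros; symmetry; apply symsum_mul|]. apply ccv_mul; eapply symsum_ccv_zsum; eauto.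
Qed.

Lemma zsum_bound f b B : summable b -> (forall j, Cnorm (f j) <= b j) ->
  (forall N, rsum b N <= B) -> Cnorm (zsum f) <= B.
Proof.
  intros Hb Hf HB. eapply ccv_bound; [eapply symsum_ccv_zsum; eauto|].
  intros n. eapply Rle_trans; [apply symsum_norm|]. eapply Rle_trans; [|apply (HB n)]. apply rsum_le; auto.
Qed.

Lemma symsum_finite f N : (forall j, (Z.of_nat N < Z.abs j)%Z -> f j = C0) ->
  forall n, (N <= n)%nat -> symsum f n = symsum f N.
Proof.
  intros H n L; induction L; auto. cbn [symsum]. rewrite IHL, !H by lia. ring.
Qed.

Lemma zsum_finite f N : (forall j, (Z.of_nat N < Z.abs j)%Z -> f j = C0) -> zsum f = symsum f N.
Proof.
  intros H. assert (C : ccv (symsum f) (symsum f N)).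
  { intros eps He. exists N. intros n Hn. rewrite (symsum_finite f N H n Hn).
    replace (symsum f N - symsum f N)%Cx with C0 by ring. rewrite Cnorm_C0; auto. }
  apply ccv_Cseq_cv in C. destruct C as [A B]. apply is_lim_seq_Reals in A, B.
  apply is_lim_seq_unique in A, B. unfold zsum. rewrite A, B. destruct (symsum f N); reflexivity.
Qed.

Lemma symsum_single f n N : (forall j, j <> n -> f j = C0) -> (Z.abs n <= Z.of_nat N)%Z -> symsum f N = f n.
Proof.
  intros H. induction N; intros L; cbn [symsum].
  - f_equal; lia.
  - destruct (Z_le_gt_dec (Z.abs n) (Z.of_nat N)).
    + rewrite IHN, (H (Z.of_nat (S N))), (H (- Z.of_nat (S N))%Z) by lia. ring.
    + rewrite (symsum_ext f (fun _ => C0) N) by (intros; apply H; lia).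
      assert (E : symsum (fun _ => C0) N = C0) by (clear; induction N; cbn [symsum]; [|rewrite IHN]; auto; ring).
      rewrite E. destruct (Z_le_gt_dec 0 n).
      * rewrite (H (- Z.of_nat (S N))%Z) by lia. replace n with (Z.of_nat (S N)) by lia. ring.
      * rewrite (H (Z.of_nat (S N))) by lia. replace n with (- Z.of_nat (S N))%Z by lia. ring.
Qed.

Lemma zsum_single f n : (forall j, j <> n -> f j = C0) -> zsum f = f n.
Proof.
  intros H. rewrite (zsum_finite f (Z.abs_nat n)) by (intros; apply H; lia).
  apply symsum_single; auto; lia.
Qed.

(** * Periodic functions and Fourier coefficients *)

Lemma two_PI_pos : 0 < 2 * PI.
Proof. pose proof PI_RGT_0; lra. Qed.

Definition Pc (f : R -> Cx) : Prop := Ccont f /\ periodic2pi f.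

Lemma Ccont_re f : Ccont f -> continuity (fun t => Cre (f t)).
Proof. intros [H _]; exact H. Qed.

Lemma Ccont_const z : Ccont (fun _ => z).
Proof. split; intros t; apply continuity_pt_const; intros x y; reflexivity. Qed.

Lemma Ccont_add f g : Ccont f -> Ccont g -> Ccont (fun t => f t + g t)%Cx.
Proof.
  intros [F1 F2] [G1 G2]. split; intros t; simpl.
  - apply (continuity_pt_plus _ _ t (F1 t) (G1 t)).
  - apply (continuity_pt_plus _ _ t (F2 t) (G2 t)).
Qed.

Lemma Ccont_mul f g : Ccont f -> Ccont g -> Ccont (fun t => f t * g t)%Cx.
Proof.
  intros [F1 F2] [G1 G2]. split; intros t; simpl.
  - apply (continuity_pt_minus (fun t => Cre (f t) * Cre (g t)) (fun t => Cim (f t) * Cim (g t)));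
      [apply (continuity_pt_mult _ _ t (F1 t) (G1 t))|apply (continuity_pt_mult _ _ t (F2 t) (G2 t))].
  - apply (continuity_pt_plus (fun t => Cre (f t) * Cim (g t)) (fun t => Cim (f t) * Cre (g t)));
      [apply (continuity_pt_mult _ _ t (F1 t) (G2 t))|apply (continuity_pt_mult _ _ t (F2 t) (G1 t))].
Qed.

Lemma Ccont_conj f : Ccont f -> Ccont (fun t => Cconj (f t)).
Proof.
  intros [F1 F2]. split; intros t; simpl; [apply F1|].
  apply (continuity_pt_opp _ t (F2 t)).
Qed.

Lemma Ccont_ext f g : (forall t, f t = g t) -> Ccont f -> Ccont g.
Proof.
  intros E [F1 F2]. split; intros t; [apply continuity_pt_ext with (fun t => Cre (f t))
  |apply continuity_pt_ext with (fun t => Cim (f t))]; intros; rewrite ?E; auto.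
Qed.

Lemma Ccont_eps f :
  Ccont f <-> forall t eps, 0 < eps -> exists d, 0 < d /\
     forall t', Rabs (t' - t) < d -> Cnorm (f t' - f t)%Cx < eps.
Proof.
  split.
  - intros [F1 F2] t eps He.
    destruct (proj1 (continuity_pt_locally _ _) (F1 t) (mkposreal (eps / 2) ltac:(lra))) as [d1 H1].
    destruct (proj1 (continuity_pt_locally _ _) (F2 t) (mkposreal (eps / 2) ltac:(lra))) as [d2 H2].
    exists (Rmin d1 d2). split; [apply Rmin_pos; [apply d1|apply d2]|]. intros t' Ht.
    assert (B1 : ball t d1 t') by (eapply Rlt_le_trans; [exact Ht|apply Rmin_l]).
    assert (B2 : ball t d2 t') by (eapply Rlt_le_trans; [exact Ht|apply Rmin_r]).
    specialize (H1 _ B1). specialize (H2 _ B2). simpl in *.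
    pose proof (Cnorm_le_sum (f t' - f t)%Cx). simpl in H. unfold Rminus in *. lra.
  - intros H. split; intros t; apply continuity_pt_locally; intros [eps He];
      destruct (H t eps He) as [d [Hd A]]; exists (mkposreal d Hd); intros t' Ht; simpl;
      eapply Rle_lt_trans; [|apply (A t' Ht)| |apply (A t' Ht)].
    + apply (Cre_le_norm (f t' - f t)%Cx).
    + apply (Cim_le_norm (f t' - f t)%Cx).
Qed.

Lemma Pc_const z : Pc (fun _ => z).
Proof. split; [apply Ccont_const|intros t; auto]. Qed.
Lemma Pc_add f g : Pc f -> Pc g -> Pc (fun t => f t + g t)%Cx.
Proof. intros [A B] [A' B']. split; [apply Ccont_add; auto|intros t; rewrite B, B'; auto]. Qed.
Lemma Pc_mul f g : Pc f -> Pc g -> Pc (fun t => f t * g t)%Cx.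
Proof. intros [A B] [A' B']. split; [apply Ccont_mul; auto|intros t; rewrite B, B'; auto]. Qed.
Lemma Pc_conj f : Pc f -> Pc (fun t => Cconj (f t)).
Proof. intros [A B]. split; [apply Ccont_conj; auto|intros t; rewrite B; auto]. Qed.
Lemma Pc_scal z f : Pc f -> Pc (fun t => z * f t)%Cx.
Proof. intros H. apply (Pc_mul (fun _ => z) f); [apply Pc_const|auto]. Qed.
Lemma Pc_ext f g : (forall t, f t = g t) -> Pc f -> Pc g.
Proof. intros E [A B]. split; [eapply Ccont_ext; eauto|intros t; rewrite <- !E; auto]. Qed.
Lemma Pc_sub f g : Pc f -> Pc g -> Pc (fun t => f t - g t)%Cx.
Proof.
  intros H H'. apply Pc_ext with (fun t => f t + (CofR (-1)) * g t)%Cx; [intros; cx|].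
  apply Pc_add; auto. apply Pc_scal; auto.
Qed.

Lemma period_reduce t : exists (k : Z) t0, 0 <= t0 < 2 * PI /\ t = t0 + 2 * PI * IZR k.
Proof.
  pose proof two_PI_pos as H. destruct (archimed (t / (2 * PI))) as [A B].
  set (k := (up (t / (2 * PI)) - 1)%Z). exists k, (t - 2 * PI * IZR k).
  unfold k. rewrite minus_IZR. set (u := IZR (up (t / (2 * PI)))) in *.
  assert (E : t = 2 * PI * (t / (2 * PI))) by (field; lra). set (q := t / (2 * PI)) in *.
  clearbody q u. split; [|ring]. subst t. split; nra.
Qed.

Lemma periodic_Z f : periodic2pi f -> forall (k : Z) t, f (t + 2 * PI * IZR k) = f t.
Proof.
  intros H. assert (P : forall (n : nat) t, f (t + 2 * PI * INR n) = f t).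
  { induction n; intros t; [f_equal; simpl; ring|]. rewrite S_INR.
    replace (t + 2 * PI * (INR n + 1)) with ((t + 2 * PI * INR n) + 2 * PI) by ring. rewrite H; auto. }
  intros k t. destruct (Z_le_gt_dec 0 k).
  - replace k with (Z.of_nat (Z.to_nat k)) by lia. rewrite <- INR_IZR_INZ. apply P.
  - rewrite <- (P (Z.to_nat (- k)) (t + 2 * PI * IZR k)). f_equal.
    rewrite INR_IZR_INZ, Z2Nat.id, opp_IZR by lia. ring.
Qed.

Lemma Pc_bounded f : Pc f -> exists M, 0 < M /\ forall t, Cnorm (f t) <= M.
Proof.
  intros [[C1' C2'] P].
  assert (B : forall g : R -> R, continuity g -> exists m, forall t, 0 <= t <= 2 * PI -> Rabs (g t) <= m).
  { intros g Hg. destruct (continuity_ab_maj (fun t => Rabs (g t)) 0 (2 * PI)) as [x [Hx _]].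
    - pose proof two_PI_pos; lra.
    - intros t _. apply continuity_pt_comp with (f2 := Rabs); [apply Hg|apply Rcontinuity_abs].
    - exists (Rabs (g x)). intros; apply Hx; auto. }
  destruct (B _ C1') as [m1 H1]. destruct (B _ C2') as [m2 H2].
  exists (Rabs m1 + Rabs m2 + 1). split; [pose proof (Rabs_pos m1); pose proof (Rabs_pos m2); lra|].
  intros t. destruct (period_reduce t) as [k [t0 [Ht ->]]]. rewrite periodic_Z by auto.
  pose proof (Cnorm_le_sum (f t0)). pose proof (H1 t0 ltac:(lra)). pose proof (H2 t0 ltac:(lra)).
  pose proof (Rle_abs m1). pose proof (Rle_abs m2). lra.
Qed.

Definition en (n : Z) (t : R) : Cx := Cexp (mkC 0 (IZR n * t)).

Lemma en_add m n t : (en m t * en n t)%Cx = en (m + n) t.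
Proof. unfold en. rewrite <- Cexp_add, plus_IZR. f_equal. cx. Qed.

Lemma en_0 t : en 0 t = C1.
Proof. unfold en. rewrite Rmult_0_l. apply Cexp_C0. Qed.

Lemma Cnorm_en n t : Cnorm (en n t) = 1.
Proof. unfold en. rewrite Cnorm_Cexp. simpl. apply exp_0. Qed.

Lemma en_conj n t : Cconj (en n t) = en (- n) t.
Proof.
  unfold en, Cexp, Cconj; simpl. rewrite opp_IZR.
  replace (- IZR n * t) with (- (IZR n * t)) by ring. rewrite cos_neg, sin_neg. f_equal; ring.
Qed.

Lemma en_plus_t n t u : en n (t + u) = (en n t * en n u)%Cx.
Proof. unfold en. rewrite <- Cexp_add. f_equal. cx. Qed.

Lemma en_2PI n : en n (2 * PI) = C1.
Proof.
  assert (E : en 1 (2 * PI) = C1).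
  { unfold en, Cexp; simpl. rewrite Rmult_1_l, cos_2PI, sin_2PI, exp_0. cx. }
  assert (E' : en (-1) (2 * PI) = C1) by (change (-1)%Z with (- (1))%Z; rewrite <- en_conj, E; cx).
  induction n using Z.peano_ind.
  - apply en_0.
  - unfold Z.succ. rewrite <- en_add, IHn, E. ring.
  - unfold Z.pred. rewrite <- en_add, IHn, E'. ring.
Qed.

Lemma Pc_en n : Pc (en n).
Proof.
  split.
  - unfold en, Cexp; split; intros t; simpl; reg.
  - intros t. rewrite en_plus_t, en_2PI. ring.
Qed.

Definition rmean (g : R -> R) : R := / (2 * PI) * RInt g 0 (2 * PI).
Definition mean (f : R -> Cx) : Cx := mkC (rmean (fun t => Cre (f t))) (rmean (fun t => Cim (f t))).
Definition F (f : R -> Cx) (n : Z) : Cx := mean (fun t => f t * en (- n) t)%Cx.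

Lemma ex_RInt_cont g x y : continuity g -> ex_RInt g x y.
Proof.
  intros H. apply (ex_RInt_continuous (V := R_CompleteNormedModule)). intros z _. apply continuity_pt_filterlim. apply H.
Qed.

Lemma rmean_ext g h : (forall t, g t = h t) -> rmean g = rmean h.
Proof. intros E. unfold rmean. f_equal. apply RInt_ext; auto. Qed.

Lemma rmean_plus g h : continuity g -> continuity h -> rmean (fun t => g t + h t) = rmean g + rmean h.
Proof.
  intros. unfold rmean. rewrite (RInt_plus g h) by (apply ex_RInt_cont; auto).
  unfold plus; simpl. ring.
Qed.

Lemma rmean_scal k g : continuity g -> rmean (fun t => k * g t) = k * rmean g.
Proof.
  intros. unfold rmean. pose proof (RInt_scal (V := R_CompleteNormedModule) g 0 (2 * PI) k ltac:(apply ex_RInt_cont; auto)) as E.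
  unfold scal in E; simpl in E; unfold mult in E; simpl in E. rewrite E. ring.
Qed.

Lemma rmean_const k : rmean (fun _ => k) = k.
Proof.
  unfold rmean. rewrite RInt_const. unfold scal; simpl; unfold mult; simpl.
  field. pose proof two_PI_pos; lra.
Qed.

Lemma rmean_le g h : continuity g -> continuity h -> (forall t, g t <= h t) -> rmean g <= rmean h.
Proof.
  intros. pose proof two_PI_pos. unfold rmean. apply Rmult_le_compat_l.
  - left; apply Rinv_0_lt_compat; auto.
  - apply RInt_le; [lra|apply ex_RInt_cont; auto|apply ex_RInt_cont; auto|auto].
Qed.

Lemma rmean_abs g M : continuity g -> (forall t, Rabs (g t) <= M) -> Rabs (rmean g) <= M.
Proof.
  intros H B. apply Rabs_le. split.
  - rewrite <- (rmean_const (- M)). apply rmean_le; auto.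
    + apply continuity_const; intros x y; auto.
    + intros t. specialize (B t). apply Rabs_le_between in B. lra.
  - rewrite <- (rmean_const M). apply rmean_le; auto.
    + apply continuity_const; intros x y; auto.
    + intros t. specialize (B t). apply Rabs_le_between in B. lra.
Qed.

Lemma mean_ext f g : (forall t, f t = g t) -> mean f = mean g.
Proof. intros E. unfold mean. f_equal; apply rmean_ext; intros; rewrite E; auto. Qed.

Lemma mean_add f g : Ccont f -> Ccont g -> mean (fun t => f t + g t)%Cx = (mean f + mean g)%Cx.
Proof.
  intros [A B] [A' B']. apply Cx_ext; simpl; [apply (rmean_plus _ _ A A')|apply (rmean_plus _ _ B B')].
Qed.

Lemma mean_mul z f : Ccont f -> mean (fun t => z * f t)%Cx = (z * mean f)%Cx.
Proof.
  intros [A B]. assert (S : forall k g, continuity g -> continuity (fun t => k * g t)).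
  { intros k g Hg t. apply (continuity_pt_scal g k t (Hg t)). }
  apply Cx_ext; simpl.
  - rewrite (rmean_ext _ (fun t => Cre z * Cre (f t) + (- Cim z) * Cim (f t))) by (intros; ring).
    rewrite rmean_plus, !rmean_scal by auto. ring.
  - rewrite rmean_plus, !rmean_scal by auto. ring.
Qed.

(** The factor 2 comes from bounding real and imaginary parts separately. For Fourier coefficients
    [F_norm] removes it by projecting onto one exponential. *)
Lemma mean_norm f M : Ccont f -> (forall t, Cnorm (f t) <= M) -> Cnorm (mean f) <= 2 * M.
Proof.
  intros [A B] H. eapply Rle_trans; [apply Cnorm_le_sum|]. simpl.
  assert (Rabs (rmean (fun t => Cre (f t))) <= M)
    by (apply rmean_abs; auto; intros t; eapply Rle_trans; [apply Cre_le_norm|auto]).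
  assert (Rabs (rmean (fun t => Cim (f t))) <= M)
    by (apply rmean_abs; auto; intros t; eapply Rle_trans; [apply Cim_le_norm|auto]).
  lra.
Qed.

Lemma mean_const z : mean (fun _ => z) = z.
Proof. apply Cx_ext; simpl; apply rmean_const. Qed.

Lemma is_deriv_add f g t l m : is_deriv_C f t l -> is_deriv_C g t m ->
  is_deriv_C (fun t => f t + g t)%Cx t (l + m)%Cx.
Proof. intros [A B] [A' B']. split; simpl; apply (derivable_pt_lim_plus _ _ t); auto. Qed.

Lemma is_deriv_mul f g t l m : is_deriv_C f t l -> is_deriv_C g t m ->
  is_deriv_C (fun t => f t * g t)%Cx t (l * g t + f t * m)%Cx.
Proof.
  intros [A B] [A' B']. split; simpl.
  - replace (Cre l * Cre (g t) - Cim l * Cim (g t) + (Cre (f t) * Cre m - Cim (f t) * Cim m))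
      with ((Cre l * Cre (g t) + Cre (f t) * Cre m) - (Cim l * Cim (g t) + Cim (f t) * Cim m)) by ring.
    apply (derivable_pt_lim_minus (fun t => Cre (f t) * Cre (g t)) (fun t => Cim (f t) * Cim (g t)));
      [apply (derivable_pt_lim_mult _ _ t _ _ A A')|apply (derivable_pt_lim_mult _ _ t _ _ B B')].
  - replace (Cre l * Cim (g t) + Cim l * Cre (g t) + (Cre (f t) * Cim m + Cim (f t) * Cre m))
      with ((Cre l * Cim (g t) + Cre (f t) * Cim m) + (Cim l * Cre (g t) + Cim (f t) * Cre m)) by ring.
    apply (derivable_pt_lim_plus (fun t => Cre (f t) * Cim (g t)) (fun t => Cim (f t) * Cre (g t)));
      [apply (derivable_pt_lim_mult _ _ t _ _ A B')|apply (derivable_pt_lim_mult _ _ t _ _ B A')].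
Qed.

Lemma is_deriv_const z t : is_deriv_C (fun _ => z) t C0.
Proof. split; simpl; apply derivable_pt_lim_const. Qed.

Lemma is_deriv_scal z f t l : is_deriv_C f t l -> is_deriv_C (fun t => z * f t)%Cx t (z * l)%Cx.
Proof.
  intros H. replace (z * l)%Cx with (C0 * f t + z * l)%Cx by ring.
  apply (is_deriv_mul (fun _ => z)); auto. apply is_deriv_const.
Qed.

Lemma is_deriv_conj f t l : is_deriv_C f t l -> is_deriv_C (fun t => Cconj (f t)) t (Cconj l).
Proof. intros [A B]. split; simpl; auto. apply (derivable_pt_lim_opp _ t); auto. Qed.

Lemma is_deriv_unique f t l m : is_deriv_C f t l -> is_deriv_C f t m -> l = m.
Proof. intros [A B] [A' B']. apply Cx_ext; eapply uniqueness_limite; eauto. Qed.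

Lemma is_deriv_ext f g t l : (forall t, f t = g t) -> is_deriv_C f t l -> is_deriv_C g t l.
Proof.
  intros E [A B]. split; [apply is_derive_Reals, is_derive_ext with (fun t => Cre (f t))
  |apply is_derive_Reals, is_derive_ext with (fun t => Cim (f t))];
  try (intros; rewrite E; reflexivity); apply is_derive_Reals; auto.
Qed.

Lemma is_deriv_Ccont f f' : (forall t, is_deriv_C f t (f' t)) -> Ccont f.
Proof.
  intros H; split; intros t; destruct (H t) as [A B]; apply derivable_continuous_pt;
    [exists (Cre (f' t))|exists (Cim (f' t))]; auto.
Qed.

Lemma is_deriv_en n t : is_deriv_C (en n) t (mkC 0 (IZR n) * en n t)%Cx.
Proof.
  unfold en, Cexp; split; simpl; apply is_derive_Reals; auto_derive; auto; rewrite exp_0; ring.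
Qed.

Lemma mean_deriv f f' : (forall t, is_deriv_C f t (f' t)) -> Ccont f' -> periodic2pi f -> mean f' = C0.
Proof.
  intros H [A B] P.
  assert (G : forall g g' : R -> R, (forall t, derivable_pt_lim g t (g' t)) -> continuity g' ->
     g (2 * PI) = g 0 -> rmean g' = 0).
  { intros g g' D C E. unfold rmean. rewrite (is_RInt_unique g' 0 (2 * PI) (minus (g (2 * PI)) (g 0))).
    - rewrite E. unfold minus, plus, opp; simpl. ring.
    - apply (is_RInt_derive g g'); intros; [apply is_derive_Reals; auto|apply continuity_pt_filterlim; apply C]. }
  specialize (P 0). rewrite Rplus_0_l in P.
  apply Cx_ext; simpl; eapply G; eauto; try (intros t; apply (H t)); simpl; rewrite P; auto.
Qed.

Lemma mean_en n : n <> 0%Z -> mean (en n) = C0.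
Proof.
  intros Hn. assert (N0 : mkC 0 (IZR n) <> C0).
  { intros E. apply (f_equal Cim) in E. simpl in E. apply eq_IZR in E. auto. }
  assert (E : mean (fun t => mkC 0 (IZR n) * en n t)%Cx = C0).
  { apply mean_deriv with (f := en n); [apply is_deriv_en| |apply Pc_en].
    apply Ccont_mul; [apply Ccont_const|apply Pc_en]. }
  rewrite mean_mul in E by apply Pc_en. apply Cmul_eq0 in E. tauto.
Qed.

Lemma F_ext f g n : (forall t, f t = g t) -> F f n = F g n.
Proof. intros E. apply mean_ext. intros; rewrite E; auto. Qed.

Lemma F_add f g n : Pc f -> Pc g -> F (fun t => f t + g t)%Cx n = (F f n + F g n)%Cx.
Proof.
  intros [A _] [B _]. unfold F. rewrite <- mean_add by (apply Ccont_mul; auto; apply Pc_en).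
  apply mean_ext. intros; ring.
Qed.

Lemma F_scal z f n : Pc f -> F (fun t => z * f t)%Cx n = (z * F f n)%Cx.
Proof.
  intros [A _]. unfold F. rewrite <- mean_mul by (apply Ccont_mul; auto; apply Pc_en).
  apply mean_ext. intros; ring.
Qed.

Lemma F_sub f g n : Pc f -> Pc g -> F (fun t => f t - g t)%Cx n = (F f n - F g n)%Cx.
Proof.
  intros A B. rewrite (F_ext _ (fun t => f t + (- C1) * g t)%Cx) by (intros; ring).
  rewrite F_add, F_scal; auto; [ring|apply Pc_scal; auto].
Qed.

Lemma F_zero n : F (fun _ => C0) n = C0.
Proof. unfold F. rewrite (mean_ext _ (fun _ => C0)) by (intros; ring). apply mean_const. Qed.

Lemma F_en j n : F (en j) n = if Z.eq_dec j n then C1 else C0.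
Proof.
  unfold F. rewrite (mean_ext _ (en (j - n))) by (intros; rewrite en_add; f_equal; lia).
  destruct (Z.eq_dec j n) as [->|].
  - rewrite (mean_ext _ (fun _ => C1)); [apply mean_const|]. intros; rewrite Z.sub_diag; apply en_0.
  - apply mean_en; lia.
Qed.

Lemma F_crude f M n : Pc f -> (forall t, Cnorm (f t) <= M) -> Cnorm (F f n) <= 2 * M.
Proof.
  intros H B. apply mean_norm; [apply Ccont_mul; [apply H|apply Pc_en]|].
  intros t. rewrite Cnorm_mul, Cnorm_en, Rmult_1_r; auto.
Qed.

Lemma F_deriv f f' n : (forall t, is_deriv_C f t (f' t)) -> Pc f -> Pc f' ->
  F f' n = (mkC 0 (IZR n) * F f n)%Cx.
Proof.
  intros H Hf Hf'.
  assert (E : mean (fun t => f' t * en (- n) t + f t * (mkC 0 (IZR (- n)) * en (- n) t))%Cx = C0).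
  { apply mean_deriv with (f := fun t => (f t * en (- n) t)%Cx).
    - intros t. apply is_deriv_mul; auto. apply is_deriv_en.
    - apply Ccont_add; apply Ccont_mul; try apply Hf; try apply Hf'; try apply Pc_en.
      apply Ccont_mul; [apply Ccont_const|apply Pc_en].
    - apply (Pc_mul f (en (- n)) Hf (Pc_en _)). }
  rewrite (mean_ext _ (fun t => f' t * en (- n) t + mkC 0 (- IZR n) * (f t * en (- n) t))%Cx) in E
    by (intros; rewrite opp_IZR; ring).
  assert (C : Ccont (fun t => f t * en (- n) t)%Cx) by (apply Ccont_mul; [apply Hf|apply Pc_en]).
  rewrite mean_add, mean_mul in E; auto.
  - fold (F f' n) in E. fold (F f n) in E.
    replace (mkC 0 (- IZR n)) with (- mkC 0 (IZR n))%Cx in E by cx.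
    apply Csub_eq0. rewrite <- E. ring.
  - apply Ccont_mul; [apply Hf'|apply Pc_en].
  - apply Ccont_mul; auto. apply Ccont_const.
Qed.

(** * Uniformly convergent series of periodic functions *)

Section UniformSeries.
Variables (f : Z -> R -> Cx) (b : Z -> R).
Hypothesis f_Pc : forall j, Pc (f j).
Hypothesis b_summable : summable b.
Hypothesis f_le : forall j t, Cnorm (f j t) <= b j.

Lemma symsum_Pc N : Pc (fun t => symsum (fun j => f j t) N).
Proof. induction N; cbn [symsum]; [apply f_Pc|]. apply Pc_add; auto. apply Pc_add; auto. Qed.

Lemma symsum_F n N : F (fun t => symsum (fun j => f j t) N) n = symsum (fun j => F (f j) n) N.
Proof.
  induction N; cbn [symsum]; [reflexivity|]. rewrite !F_add, IHN; auto.
  - apply symsum_Pc.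
  - apply Pc_add; auto. apply symsum_Pc.
Qed.

Lemma zsum_Pc : Pc (fun t => zsum (fun j => f j t)).
Proof.
  split.
  - apply Ccont_eps. intros t eps He.
    destruct (zsum_uniform b b_summable (eps / 4) ltac:(lra)) as [N A].
    destruct (proj1 (Ccont_eps _) (proj1 (symsum_Pc N)) t (eps / 4) ltac:(lra)) as [d [Hd B]].
    exists d. split; auto. intros t' Ht.
    pose proof (A (fun j => f j t) (fun j => f_le j t) N (le_n _)) as A1.
    pose proof (A (fun j => f j t') (fun j => f_le j t') N (le_n _)) as A2. specialize (B t' Ht).
    rewrite Cnorm_subC in A1.
    set (x := zsum (fun j => f j t)) in *. set (x' := zsum (fun j => f j t')) in *.
    set (y := symsum (fun j => f j t) N) in *. set (y' := symsum (fun j => f j t') N) in *.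
    replace (x' - x)%Cx with ((x' - y') + (y' - y) + (y - x))%Cx by ring.
    pose proof (Cnorm_add ((x' - y') + (y' - y)) (y - x)). pose proof (Cnorm_add (x' - y') (y' - y)). lra.
  - intros t. apply zsum_ext. intros j. apply f_Pc.
Qed.

Lemma zsum_F_ccv n : ccv (symsum (fun j => F (f j) n)) (F (fun t => zsum (fun j => f j t)) n).
Proof.
  intros eps He. destruct (zsum_uniform b b_summable (eps / 4) ltac:(lra)) as [N A].
  exists N. intros m Hm. rewrite <- symsum_F, Cnorm_subC, <- F_sub by (apply zsum_Pc || apply symsum_Pc).
  eapply Rle_lt_trans; [apply F_crude with (M := eps / 4)|lra].
  - apply Pc_sub; [apply zsum_Pc|apply symsum_Pc].
  - intros t. apply A; auto.
Qed.
End UniformSeries.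

(** * Bessel's inequality *)

Definition sqmean (f : R -> Cx) : R := rmean (fun t => Cnorm (f t) ^ 2).

Lemma Cnorm2_cont f : Ccont f -> continuity (fun t => Cnorm (f t) ^ 2).
Proof.
  intros H t. apply continuity_pt_ext with (fun t => Cre (f t * Cconj (f t))%Cx).
  - intros x. rewrite Cnorm_sqr. simpl. ring.
  - apply (Ccont_re _ (Ccont_mul _ _ H (Ccont_conj _ H))).
Qed.

(** Pythagoras for the projection onto one exponential: the mean of the cross term is [- 2 |z|^2],
    that of the square of the projection is [|z|^2]. *)
Lemma sqmean_project f n : Pc f ->
  sqmean (fun t => f t - F f n * en n t)%Cx = sqmean f - Cnorm (F f n) ^ 2.
Proof.
  intros [C P]. set (z := F f n).
  assert (C1' : Ccont (fun t => f t * en (- n) t)%Cx) by (apply Ccont_mul; auto; apply Pc_en).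
  assert (C2' : Ccont (fun t => Cconj z * (f t * en (- n) t))%Cx) by (apply Ccont_mul; auto; apply Ccont_const).
  transitivity (rmean (fun t => Cnorm (f t) ^ 2 + ((-2) * Cre (Cconj z * (f t * en (- n) t))%Cx + Cnorm z ^ 2))).
  { apply rmean_ext. intros t.
    assert (E : Cnorm (z * en n t)%Cx ^ 2 = Cnorm z ^ 2) by (rewrite Cnorm_mul, Cnorm_en, Rmult_1_r; auto).
    rewrite <- E, <- en_conj, !Cnorm_sqr. simpl. ring. }
  rewrite rmean_plus.
  - rewrite rmean_plus.
    + rewrite rmean_scal by (apply Ccont_re; auto). rewrite rmean_const.
      change (rmean (fun t => Cre (Cconj z * (f t * en (- n) t))%Cx))
        with (Cre (mean (fun t => Cconj z * (f t * en (- n) t))%Cx)).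
      rewrite mean_mul by auto. fold (F f n). fold z. unfold sqmean. rewrite !Cnorm_sqr. simpl. ring.
    + intros t. apply (continuity_pt_scal _ (-2) t (Ccont_re _ C2' t)).
    + apply continuity_const; intros x y; auto.
  - apply Cnorm2_cont; auto.
  - intros t. apply (continuity_pt_plus (fun t => (-2) * Cre (Cconj z * (f t * en (- n) t))%Cx) (fun _ => Cnorm z ^ 2)).
    + apply (continuity_pt_scal _ (-2) t (Ccont_re _ C2' t)).
    + apply continuity_pt_const; intros x y; auto.
Qed.

Lemma F_project f n m : Pc f -> m <> n -> F (fun t => f t - F f n * en n t)%Cx m = F f m.
Proof.
  intros H Hm. rewrite F_sub, F_scal, F_en; auto; try apply Pc_en; [|apply Pc_scal; apply Pc_en].
  destruct (Z.eq_dec n m); [congruence|ring].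
Qed.

Lemma Pc_project f n : Pc f -> Pc (fun t => f t - F f n * en n t)%Cx.
Proof. intros. apply Pc_sub; auto. apply Pc_scal. apply Pc_en. Qed.

Lemma sqmean_ge0 f : Ccont f -> 0 <= sqmean f.
Proof.
  intros H. rewrite <- (rmean_const 0). apply rmean_le; [apply continuity_const; intros x y; auto|
  apply Cnorm2_cont; auto|]. intros t. apply pow2_ge_0.
Qed.

(** Subtracting the projections on the frequencies [N + 1] and [- (N + 1)] leaves all other
    coefficients unchanged, so the induction hypothesis applies to the remainder and no double sum
    is expanded. *)
Lemma bessel N : forall f, Pc f -> rsum (fun n => Cnorm (F f n) ^ 2) N <= sqmean f.
Proof.
  induction N; intros f H; cbn [rsum].
  - pose proof (sqmean_project f 0 H). pose proof (sqmean_ge0 _ (proj1 (Pc_project f 0 H))). lra.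
  - set (p := Z.of_nat (S N)). set (g := fun t => (f t - F f p * en p t)%Cx).
    assert (Hg : Pc g) by (apply Pc_project; auto).
    set (h := fun t => (g t - F g (- p) * en (- p) t)%Cx).
    assert (Hh : Pc h) by (apply Pc_project; auto).
    pose proof (sqmean_project f p H) as E1. pose proof (sqmean_project g (- p)%Z Hg) as E2.
    fold g in E1. fold h in E2. assert (E3 : F g (- p) = F f (- p)) by (apply F_project; auto; unfold p; lia).
    rewrite E3 in E2. specialize (IHN h Hh).
    assert (rsum (fun n => Cnorm (F f n) ^ 2) N <= rsum (fun n => Cnorm (F h n) ^ 2) N).
    { apply rsum_le. intros j Hj. unfold h. rewrite F_project by (auto; unfold p; lia).
      unfold g. rewrite F_project by (auto; unfold p; lia). lra. }
    lra.
Qed.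

Lemma sqmean_le f M : Ccont f -> (forall t, Cnorm (f t) <= M) -> sqmean f <= M ^ 2.
Proof.
  intros H B. rewrite <- (rmean_const (M ^ 2)). apply rmean_le; [apply Cnorm2_cont; auto|
  apply continuity_const; intros x y; auto|]. intros t. pose proof (B t). pose proof (Cnorm_ge0 (f t)). nra.
Qed.

Lemma F_norm f M n : Pc f -> (forall t, Cnorm (f t) <= M) -> Cnorm (F f n) <= M.
Proof.
  intros H B. pose proof (sqmean_le f M (proj1 H) B). pose proof (sqmean_project f n H).
  pose proof (sqmean_ge0 _ (proj1 (Pc_project f n H))). pose proof (Cnorm_ge0 (F f n)).
  pose proof (Rle_trans _ _ _ (Cnorm_ge0 _) (B 0)). nra.
Qed.

(** Cauchy-Schwarz in the form of Young's inequality. With [eps] the square root of [B] the bound is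
    [M * eps]: an l2 bound on multipliers becomes a bound in terms of the sup norm of [f]. *)
Lemma bessel_weighted f M b B eps N : Pc f -> 0 < M -> 0 < eps -> (forall t, Cnorm (f t) <= M) ->
  (forall N, rsum (fun n => b n ^ 2) N <= B) ->
  rsum (fun n => Cnorm (F f n) * b n) N <= M * ((eps + B / eps) / 2).
Proof.
  intros H HM He Hf Hb.
  apply Rle_trans with (rsum (fun n => eps / (2 * M) * Cnorm (F f n) ^ 2 + M / (2 * eps) * b n ^ 2) N).
  - apply rsum_le. intros j _. set (x := Cnorm (F f j)). set (y := b j).
    assert (0 <= / (2 * M * eps) * (eps * x - M * y) ^ 2).
    { apply Rmult_le_pos; [|apply pow2_ge_0]. left. apply Rinv_0_lt_compat.
      apply Rmult_lt_0_compat; lra. }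
    replace (eps / (2 * M) * x ^ 2 + M / (2 * eps) * y ^ 2)
      with (x * y + / (2 * M * eps) * (eps * x - M * y) ^ 2) by (field; lra). lra.
  - rewrite rsum_plus, !rsum_scal.
    pose proof (bessel N f H) as B1. pose proof (sqmean_le f M (proj1 H) Hf) as B2. pose proof (Hb N) as B3.
    assert (0 < eps / (2 * M)) by (apply Rdiv_lt_0_compat; lra).
    assert (0 < M / (2 * eps)) by (apply Rdiv_lt_0_compat; lra).
    replace (M * ((eps + B / eps) / 2)) with (eps / (2 * M) * M ^ 2 + M / (2 * eps) * B) by (field; lra).
    apply Rplus_le_compat; apply Rmult_le_compat_l; lra.
Qed.

(** * Uniqueness of Fourier coefficients *)

Lemma cos_far d x : 0 < d <= PI -> d <= Rabs x <= 2 * PI - d -> cos x <= cos d.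
Proof.
  intros Hd Hx. replace (cos x) with (cos (Rabs x))
    by (unfold Rabs; destruct (Rcase_abs x); [apply cos_neg|auto]).
  set (y := Rabs x) in *. destruct (Rle_dec y PI).
  - apply cos_decr_1; lra.
  - replace (cos y) with (cos (2 * PI - y)).
    + apply cos_decr_1; lra.
    + rewrite cos_minus, cos_2PI, sin_2PI. ring.
Qed.

Lemma cos_near d x : 0 < d <= PI -> Rabs x <= d -> cos d <= cos x.
Proof.
  intros Hd Hx. replace (cos x) with (cos (Rabs x))
    by (unfold Rabs; destruct (Rcase_abs x); [apply cos_neg|auto]).
  pose proof (Rabs_pos x). apply cos_decr_1; lra.
Qed.

(* The kernels [(1 + cos (t - t0)) ^ m] concentrate at [t0], and they are trigonometric polynomials. *)
Lemma cos_kernel_moment h t0 : continuity h -> 0 < t0 < 2 * PI -> 0 < h t0 ->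
  ~ (forall m, RInt (fun t => h t * (1 + cos (t - t0)) ^ m) 0 (2 * PI) = 0).
Proof.
  intros Hc Ht Hp HI.
  destruct (proj1 (continuity_pt_locally _ _) (Hc t0) (mkposreal (h t0 / 2) ltac:(lra))) as [[d0 Hd0] D].
  destruct (continuity_ab_maj (fun t => Rabs (h t)) 0 (2 * PI)) as [xm [Hm _]]; [lra| |].
  { intros t _. apply continuity_pt_comp with (f2 := Rabs); [apply Hc|apply Rcontinuity_abs]. }
  set (H := Rabs (h xm)) in *.
  set (d := Rmin (d0 / 2) (Rmin (t0 / 2) ((2 * PI - t0) / 2))).
  assert (Hd : 0 < d) by (unfold d; repeat apply Rmin_pos; lra).
  assert (d <= d0 / 2) by apply Rmin_l.
  assert (d <= t0 / 2) by (eapply Rle_trans; [apply Rmin_r|apply Rmin_l]).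
  assert (d <= (2 * PI - t0) / 2) by (eapply Rle_trans; [apply Rmin_r|apply Rmin_r]).
  clearbody d. assert (d <= PI / 2) by lra. pose proof PI_RGT_0.
  set (eta := h t0 / 2) in *. assert (0 < eta) by (unfold eta; lra).
  assert (Hin : forall t, Rabs (t - t0) <= d -> eta < h t).
  { intros t Ha. assert (Bt : ball t0 d0 t) by (change (Rabs (t - t0) < d0); lra).
    specialize (D t Bt). simpl in D. apply Rabs_def2 in D. unfold eta in *. lra. }
  set (rho := 1 + cos d). set (rho' := 1 + cos (d / 2)).
  assert (0 <= cos d) by (apply cos_ge_0; lra).
  assert (cos d < cos (d / 2)) by (apply cos_decreasing_1; lra).
  assert (1 <= rho) by (unfold rho; lra). assert (rho < rho') by (unfold rho, rho'; lra).
  assert (0 <= H) by apply Rabs_pos.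
  (* Farther than [d] from [t0] the kernel is at most [rho ^ m], so adding the constant
     [H * rho ^ m] makes the integrand nonnegative on the whole period. Within [d / 2] of [t0] it is
     at least [eta * rho' ^ m], and [rho' > rho] contradicts this inequality for large [m]. *)
  assert (K0 : forall m, d * (eta * rho' ^ m) <= 2 * PI * (H * rho ^ m)).
  { intros m. set (k := fun t => h t * (1 + cos (t - t0)) ^ m + H * rho ^ m).
    assert (Ck0 : continuity (fun t => h t * (1 + cos (t - t0)) ^ m)).
    { intros t. apply (continuity_pt_mult h (fun t => (1 + cos (t - t0)) ^ m)); [apply Hc|].
      apply derivable_continuous_pt. apply ex_derive_Reals_0. auto_derive; auto. }
    assert (Ck : continuity k).
    { intros t. apply (continuity_pt_plus (fun t => h t * (1 + cos (t - t0)) ^ m) (fun _ => H * rho ^ m)); auto.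
      apply continuity_pt_const; intros x y; auto. }
    assert (E : RInt k 0 (2 * PI) = 2 * PI * (H * rho ^ m)).
    { unfold k. rewrite (RInt_plus (V := R_CompleteNormedModule) (fun t => h t * (1 + cos (t - t0)) ^ m) (fun _ => H * rho ^ m)).
      - rewrite HI, RInt_const. unfold plus, scal; simpl; unfold mult; simpl. ring.
      - apply ex_RInt_cont; auto.
      - apply ex_RInt_const. }
    rewrite <- E.
    assert (Tpos : forall t, 0 <= 1 + cos (t - t0)) by (intros t; pose proof (COS_bound (t - t0)); lra).
    assert (kpos : forall t, 0 <= t <= 2 * PI -> 0 <= k t).
    { intros t Hr. unfold k. assert (0 <= (1 + cos (t - t0)) ^ m) by (apply pow_le; auto).
      assert (0 <= rho ^ m) by (apply pow_le; lra).
      destruct (Rle_dec (Rabs (t - t0)) d) as [Hn|Hn].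
      - specialize (Hin t Hn). assert (0 <= h t) by lra. apply Rplus_le_le_0_compat; apply Rmult_le_pos; auto.
      - assert (cos (t - t0) <= cos d).
        { apply cos_far; [lra|]. split; [lra|]. apply Rabs_le. lra. }
        assert ((1 + cos (t - t0)) ^ m <= rho ^ m) by (apply pow_incr; split; [auto|unfold rho; lra]).
        specialize (Hm t Hr). fold H in Hm. apply Rabs_le_between in Hm. nra. }
    set (p := t0 - d / 2). set (q := t0 + d / 2).
    assert (Ex : forall x y, ex_RInt k x y) by (intros; apply ex_RInt_cont; auto).
    rewrite <- (RInt_Chasles (V := R_CompleteNormedModule) k 0 p (2 * PI)) by auto.
    rewrite <- (RInt_Chasles (V := R_CompleteNormedModule) k p q (2 * PI)) by auto.
    unfold plus; simpl.
    assert (0 <= RInt k 0 p).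
    { apply RInt_ge_0; auto; [unfold p; lra|]. intros x Hx; apply kpos; unfold p in *; lra. }
    assert (0 <= RInt k q (2 * PI)).
    { apply RInt_ge_0; auto; [unfold q; lra|]. intros x Hx; apply kpos; unfold q in *; lra. }
    assert (RInt (fun _ => eta * rho' ^ m) p q <= RInt k p q).
    { apply RInt_le; auto; [unfold p, q; lra|apply ex_RInt_const|]. intros x Hx. unfold k.
      assert (Ha : Rabs (x - t0) <= d / 2) by (apply Rabs_le; unfold p, q in *; lra).
      pose proof (Hin x ltac:(lra)).
      assert (rho' ^ m <= (1 + cos (x - t0)) ^ m).
      { apply pow_incr. split; [lra|]. unfold rho'. pose proof (cos_near (d / 2) (x - t0) ltac:(lra) Ha). lra. }
      assert (0 <= rho' ^ m) by (apply pow_le; lra). assert (0 <= rho ^ m) by (apply pow_le; lra). nra. }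
    rewrite RInt_const in H13. unfold scal in H13; simpl in H13; unfold mult in H13; simpl in H13.
    replace (q - p) with d in H13 by (unfold p, q; lra). lra. }
  assert (Hr : Rabs (rho' / rho) > 1).
  { rewrite Rabs_pos_eq; [|left; apply Rdiv_lt_0_compat; lra].
    apply Rmult_lt_reg_r with rho; [lra|]. unfold Rdiv. rewrite Rmult_assoc, Rinv_l by lra. lra. }
  assert (0 < d * eta) by (apply Rmult_lt_0_compat; lra).
  destruct (Pow_x_infinity (rho' / rho) Hr ((2 * PI * H + 1) / (d * eta))) as [m HM].
  specialize (HM m (le_n _)). specialize (K0 m). unfold Rdiv in HM. rewrite Rpow_mult_distr, pow_inv in HM.
  assert (0 < rho ^ m) by (apply pow_lt; lra). assert (0 < rho' ^ m) by (apply pow_lt; lra).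
  rewrite Rabs_pos_eq in HM by (left; apply Rmult_lt_0_compat; [|apply Rinv_0_lt_compat]; auto).
  apply Rge_le in HM. apply (Rmult_le_compat_r (d * eta * rho ^ m)) in HM; [|apply Rmult_le_pos; lra].
  replace ((2 * PI * H + 1) * / (d * eta) * (d * eta * rho ^ m)) with ((2 * PI * H + 1) * rho ^ m) in HM
    by (field; lra).
  replace (rho' ^ m * / rho ^ m * (d * eta * rho ^ m)) with (d * (eta * rho' ^ m)) in HM
    by (field; lra). nra.
Qed.

Lemma F_shift f k n : F (fun t => f t * en k t)%Cx n = F f (n - k).
Proof.
  unfold F. apply mean_ext. intros t. replace (- (n - k))%Z with (k + - n)%Z by lia.
  rewrite <- en_add. ring.
Qed.

(** If [f t0 <> 0], the real part of [conj (f t0) * f] is positive at [t0], yet its integrals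
    against all powers of [1 + cos (t - t0)] vanish, being combinations of Fourier coefficients of
    [f]. *)
Lemma F_eq0 f : Pc f -> (forall n, F f n = C0) -> forall t, f t = C0.
Proof.
  intros Hf HF.
  assert (I : forall t0, 0 < t0 < 2 * PI -> f t0 = C0).
  { intros t0 Ht. apply NNPP. intros Hn.
    set (g := fun m t => (f t * CofR ((1 + cos (t - t0)) ^ m))%Cx).
    (* Multiplication by [1 + cos (t - t0)] adds two frequency shifts of [g m], so the vanishing of
       all coefficients passes from [m] to [S m]. *)
    assert (Eg : forall m t, g (S m) t = (g m t + (CofR (/2) * en (-1) t0) * (g m t * en 1 t)
                + (CofR (/2) * en 1 t0) * (g m t * en (-1) t))%Cx).
    { intros m t. unfold g.
      assert (E : CofR (1 + cos (t - t0)) = (C1 + (CofR (/2) * en (-1) t0) * en 1 t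
           + (CofR (/2) * en 1 t0) * en (-1) t)%Cx).
      { change (-1)%Z with (- (1))%Z. rewrite <- !en_conj. unfold en, Cexp; apply Cx_ext; simpl;
          rewrite !Rmult_1_l, exp_0, ?cos_minus; field. }
      cbn [pow]. rewrite CofR_mul, E. ring. }
    assert (Pg : forall m, Pc (g m)).
    { induction m.
      - apply Pc_ext with f; auto. intros; unfold g; simpl. cx.
      - eapply Pc_ext; [intros; symmetry; apply Eg|].
        repeat apply Pc_add; auto; apply Pc_scal; apply Pc_mul; auto; apply Pc_en. }
    assert (Fg : forall m n, F (g m) n = C0).
    { induction m; intros n.
      - rewrite <- (HF n). apply F_ext. intros; unfold g; simpl. cx.
      - rewrite (F_ext _ _ _ (Eg m)). rewrite !F_add, !F_scal, !F_shift, !IHm; [ring| | | | | |];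
        repeat apply Pc_add; auto; try apply Pc_scal; apply Pc_mul; auto; apply Pc_en. }
    apply (cos_kernel_moment (fun t => Cre (Cconj (f t0) * f t)%Cx) t0); auto.
    - apply Ccont_re. apply Ccont_mul; [apply Ccont_const|apply Hf].
    - pose proof (Cx_sqr_neq0 _ Hn). simpl in *. assert (0 <= Cre (f t0) * Cre (f t0)) by nra.
      assert (0 <= Cim (f t0) * Cim (f t0)) by nra. lra.
    - intros m.
      assert (E : mean (fun t => Cconj (f t0) * g m t)%Cx = C0).
      { rewrite mean_mul by apply Pg. specialize (Fg m 0%Z). unfold F in Fg.
        rewrite (mean_ext _ (g m)) in Fg; [rewrite Fg; ring|]. intros t. simpl. rewrite en_0. ring. }
      apply (f_equal Cre) in E. simpl in E. unfold rmean in E.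
      apply Rmult_integral in E. destruct E as [E|E].
      { pose proof two_PI_pos. pose proof (Rinv_0_lt_compat _ H). lra. }
      etransitivity; [|exact E]. apply RInt_ext. intros t _. simpl. ring. }
  (* The kernel argument needs [t0] inside the period; the endpoint follows by continuity. *)
  assert (Z0 : f 0 = C0).
  { apply Csmall_eq0. intros eps He.
    destruct (proj1 (Ccont_eps f) (proj1 Hf) 0 eps He) as [d [Hd A]].
    set (t := Rmin (d / 2) PI). pose proof PI_RGT_0.
    assert (0 < t) by (apply Rmin_pos; lra). assert (t <= d / 2) by apply Rmin_l. assert (t <= PI) by apply Rmin_r.
    specialize (A t). rewrite (I t) in A by lra. rewrite Cnorm_subC in A.
    replace (f 0 - C0)%Cx with (f 0) in A by ring. left. apply A. apply Rabs_def1; lra. }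
  intros t. destruct (period_reduce t) as [k [t0 [Ht ->]]]. rewrite periodic_Z by apply Hf.
  destruct (Rle_lt_or_eq_dec 0 t0 (proj1 Ht)) as [|<-]; auto. apply I; lra.
Qed.

Lemma F_inj f g : Pc f -> Pc g -> (forall n, F f n = F g n) -> forall t, f t = g t.
Proof.
  intros Hf Hg H t. apply Csub_eq0. apply (F_eq0 (fun t => f t - g t)%Cx).
  - apply Pc_sub; auto.
  - intros n. rewrite F_sub, H by auto. ring.
Qed.

(** * Absolutely convergent trigonometric series and l2 weights *)

Section TrigSeries.
Variables (al : Z -> Cx) (b : Z -> R).
Hypothesis b_summable : summable b.
Hypothesis al_le : forall j, Cnorm (al j) <= b j.

Lemma trig_term_le j t : Cnorm (al j * en j t)%Cx <= b j.
Proof. rewrite Cnorm_mul, Cnorm_en, Rmult_1_r; auto. Qed.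

Lemma trig_Pc : Pc (fun t => zsum (fun j => al j * en j t)%Cx).
Proof.
  apply (zsum_Pc (fun j t => al j * en j t)%Cx b); auto; [|apply trig_term_le].
  intros; apply Pc_scal, Pc_en.
Qed.

Lemma trig_F n : F (fun t => zsum (fun j => al j * en j t)%Cx) n = al n.
Proof.
  eapply ccv_unique.
  - apply (zsum_F_ccv (fun j t => al j * en j t)%Cx b); auto; [|apply trig_term_le].
    intros; apply Pc_scal, Pc_en.
  - assert (E : forall j, F (fun t => al j * en j t)%Cx n = if Z.eq_dec j n then al n else C0).
    { intros j. rewrite F_scal, F_en by apply Pc_en. destruct (Z.eq_dec j n); subst; ring. }
    intros eps He. exists (Z.abs_nat n). intros N HN.
    rewrite (symsum_ext _ (fun j => if Z.eq_dec j n then al n else C0)) by (intros; apply E).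
    rewrite (symsum_single _ n); [|intros j Hj; destruct (Z.eq_dec j n); congruence|lia].
    destruct (Z.eq_dec n n); [|congruence]. replace (al n - al n)%Cx with C0 by ring. rewrite Cnorm_C0; auto.
Qed.
End TrigSeries.

Lemma fourier_inversion f b : Pc f -> summable b -> (forall j, Cnorm (F f j) <= b j) ->
  forall t, f t = zsum (fun j => F f j * en j t)%Cx.
Proof.
  intros Hf Hb H. apply F_inj; auto; [eapply trig_Pc; eauto|]. intros n. symmetry. eapply trig_F; eauto.
Qed.

(** Telescoping with [1/(x+1)^2 <= 1/x - 1/(x+1)]: the two half-lines contribute at most [2/A], the
    term [n = 0] at most [1/A] because [A >= 1]. *)
Lemma rsum_inv_sqr_shift A N : 1 <= A -> rsum (fun n => (/ (A + Rabs (IZR n))) ^ 2) N <= 3 / A.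
Proof.
  intros HA.
  assert (G : rsum (fun n => (/ (A + Rabs (IZR n))) ^ 2) N <= 3 / A - 2 / (A + INR N)).
  { induction N.
    - cbn [rsum]. rewrite Rabs_R0, Rplus_0_r. simpl INR. rewrite Rplus_0_r.
      assert (/ A <= 1) by (rewrite <- Rinv_1; apply Rinv_le_contravar; lra).
      assert (0 < / A) by (apply Rinv_0_lt_compat; lra).
      replace (3 / A - 2 / A) with (/ A) by (field; lra). nra.
    - cbn [rsum]. rewrite opp_IZR, Rabs_Ropp, <- INR_IZR_INZ.
      rewrite (Rabs_pos_eq (INR (S N))) by apply pos_INR. rewrite S_INR in *.
      pose proof (pos_INR N). set (x := A + INR N) in *. replace (A + (INR N + 1)) with (x + 1) by (unfold x; ring).
      assert (0 < x) by (unfold x; lra).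
      assert ((/ (x + 1)) ^ 2 <= / x - / (x + 1)).
      { replace (/ x - / (x + 1)) with ((/ (x + 1)) ^ 2 + / (x * (x + 1) ^ 2)) by (field; lra).
        assert (0 < / (x * (x + 1) ^ 2)) by (apply Rinv_0_lt_compat; nra). lra. }
      unfold Rdiv in *. lra. }
  assert (0 < 2 / (A + INR N)) by (pose proof (pos_INR N); apply Rdiv_lt_0_compat; lra). lra.
Qed.

Lemma summable_F_weighted f b B : Pc f -> (forall j, 0 <= b j) -> (forall N, rsum (fun n => b n ^ 2) N <= B) ->
  summable (fun j => Cnorm (F f j) * b j).
Proof.
  intros Hf Hb HB. split.
  - intros j. apply Rmult_le_pos; auto. apply Cnorm_ge0.
  - destruct (Pc_bounded f Hf) as [M [HM HfM]]. eexists. intros N.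
    apply (bessel_weighted f M b B 1 N); auto; lra.
Qed.

(** Any bound on [u] can be halved, hence halved indefinitely, starting from a bound given by
    periodicity and continuity. *)
Lemma contraction_zero u : Pc u ->
  (forall M, 0 < M -> (forall t, Cnorm (u t) <= M) -> forall t, Cnorm (u t) <= M / 2) -> forall t, u t = C0.
Proof.
  intros Hu Half. destruct (Pc_bounded u Hu) as [M [HM Bu]].
  assert (It : forall k t, Cnorm (u t) <= M * (/ 2) ^ k).
  { induction k; intros t; simpl; [rewrite Rmult_1_r; auto|].
    replace (M * (/ 2 * (/ 2) ^ k)) with (M * (/ 2) ^ k / 2) by field. apply Half; auto.
    apply Rmult_lt_0_compat; auto. apply pow_lt; lra. }
  intros t. apply Csmall_eq0. intros e He.
  destruct (pow_lt_1_zero (/ 2)) with (y := e / M) as [N HN].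
  - rewrite Rabs_pos_eq; lra.
  - apply Rdiv_lt_0_compat; auto.
  - specialize (HN N (le_n _)). rewrite Rabs_pos_eq in HN by (apply pow_le; lra).
    eapply Rle_trans; [apply (It N)|]. apply (Rmult_lt_compat_l M) in HN; auto.
    replace (M * (e / M)) with e in HN by (field; lra). lra.
Qed.

(** * Eigenfunctions of the tangential operator *)

(* [E phi psi (r^s)] is the basic solution [r^s phi + conj (r^s psi)]. *)
Definition E (phi psi : R -> Cx) (z : Cx) (t : R) : Cx := (z * phi t + Cconj (z * psi t))%Cx.

Lemma E_add phi psi z w t : E phi psi (z + w)%Cx t = (E phi psi z t + E phi psi w t)%Cx.
Proof. unfold E. cx. Qed.
Lemma E_real phi psi x z t : E phi psi (CofR x * z)%Cx t = (CofR x * E phi psi z t)%Cx.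
Proof. unfold E. cx. Qed.
Lemma E_0 phi psi t : E phi psi C0 t = C0.
Proof. unfold E. cx. Qed.

Lemma E_Pc phi psi z : Pc phi -> Pc psi -> Pc (E phi psi z).
Proof.
  intros. unfold E. apply Pc_add; [apply Pc_scal; auto|].
  apply (Pc_conj (fun t => z * psi t)%Cx). apply Pc_scal; auto.
Qed.

Section Eigen.
Variables (a b nu : R) (c : R -> Cx).
Hypothesis a_pos : 0 < a.
Hypothesis b_neq0 : b <> 0.
Hypothesis nu_range : 0 <= nu < 1.
Hypothesis c_Pc : Pc c.

Let lam := mkC a b.

Lemma ab_sqr_pos : 0 < a ^ 2 + b ^ 2.
Proof. apply Rplus_lt_le_0_compat; [apply pow_lt; auto|apply pow2_ge_0]. Qed.

Lemma lam_neq0 : mkC a b <> C0.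
Proof. intros H. apply (f_equal Cre) in H. simpl in H. lra. Qed.

Lemma lam_conj_neq0 : Cconj (mkC a b) <> C0.
Proof. intros H. apply (f_equal Cre) in H. simpl in H. lra. Qed.

(* Fourier form of [tau u - Q u = f], where [Q u = - i lam u_t + lam nu u + i c conj u];
   it makes sense for [u] merely continuous. *)
Definition weak (tau : R) (u f : R -> Cx) : Prop := forall n,
  ((CofR tau - lam * CofR (IZR n + nu)) * F u n - F (fun t => Ci * (c t * Cconj (u t))) n = F f n)%Cx.

Lemma Pc_cu u : Pc u -> Pc (fun t => Ci * (c t * Cconj (u t)))%Cx.
Proof. intros. apply Pc_scal, Pc_mul; auto. apply Pc_conj; auto. Qed.

Lemma weak_add tau u u' f f' : Pc u -> Pc u' -> Pc f -> Pc f' -> weak tau u f -> weak tau u' f' ->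
  weak tau (fun t => u t + u' t)%Cx (fun t => f t + f' t)%Cx.
Proof.
  intros Hu Hu' Hf Hf' H H' n. rewrite !F_add by auto. rewrite <- H, <- H'.
  rewrite (F_ext (fun t => Ci * (c t * Cconj (u t + u' t)))%Cx
    (fun t => Ci * (c t * Cconj (u t)) + Ci * (c t * Cconj (u' t)))%Cx) by (intros; rewrite Cconj_add; ring).
  rewrite F_add by (apply Pc_cu; auto). ring.
Qed.

Lemma weak_real tau x u f : Pc u -> Pc f -> weak tau u f ->
  weak tau (fun t => CofR x * u t)%Cx (fun t => CofR x * f t)%Cx.
Proof.
  intros Hu Hf H n. rewrite (F_scal (CofR x) u), (F_scal (CofR x) f) by auto. rewrite <- H.
  rewrite (F_ext (fun t => Ci * (c t * Cconj (CofR x * u t)))%Cx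
    (fun t => CofR x * (Ci * (c t * Cconj (u t))))%Cx) by (intros; rewrite Cconj_mul, Cconj_CofR; ring).
  rewrite F_scal by (apply Pc_cu; auto). ring.
Qed.

Lemma weak_ext tau u u' f f' : (forall t, u t = u' t) -> (forall t, f t = f' t) -> weak tau u f -> weak tau u' f'.
Proof.
  intros E1 E2 H n. rewrite <- (F_ext f f' n E2), <- (F_ext u u' n E1), <- (H n).
  rewrite (F_ext (fun t => Ci * (c t * Cconj (u' t)))%Cx (fun t => Ci * (c t * Cconj (u t)))%Cx); auto.
  intros; rewrite E1; auto.
Qed.

Lemma weak_zero tau : weak tau (fun _ => C0) (fun _ => C0).
Proof.
  intros n. rewrite (F_ext (fun t => Ci * (c t * Cconj C0))%Cx (fun _ => C0)) by (intros; cx).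
  rewrite F_zero. ring.
Qed.

(** The line [R lam] is not real because [b <> 0], so the distance from a real [tau] to it controls
    both [tau] and [n]. In squared form the estimate is an identity: the slack is the sum of two
    squares displayed in the proof. *)
Lemma symbol_lower : exists g, 0 < g /\ forall A n, 0 <= A ->
  g * (A + Rabs (IZR n)) <= Cnorm (CofR (A + 1) - lam * CofR (IZR n + nu))%Cx.
Proof.
  set (L := a ^ 2 + b ^ 2). pose proof ab_sqr_pos as HL. fold L in HL.
  assert (Hb : 0 < b ^ 2) by nra.
  set (q := b ^ 2 / (2 * (1 + L))). assert (Hq : 0 < q) by (apply Rdiv_lt_0_compat; lra).
  exists (sqrt q). split; [apply sqrt_lt_R0; auto|]. intros A n HA.
  set (X := (CofR (A + 1) - lam * CofR (IZR n + nu))%Cx).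
  set (m := IZR n + nu). set (tau := A + 1).
  pose proof (sqrt_pos q) as Sq. pose proof (Cnorm_ge0 X) as NX. pose proof (Rabs_pos (IZR n)) as Rn.
  assert (ES : sqrt q ^ 2 = q) by (rewrite pow2_sqrt; lra).
  assert (EX : Cnorm X ^ 2 = (tau - a * m) ^ 2 + (b * m) ^ 2)
    by (rewrite Cnorm_sqr; unfold X, tau, m, lam; simpl; ring).
  assert (H1 : (1 + L) * Cnorm X ^ 2 >= b ^ 2 * (tau ^ 2 + m ^ 2)).
  { rewrite EX. replace ((1 + L) * ((tau - a * m) ^ 2 + (b * m) ^ 2))
      with (b ^ 2 * (tau ^ 2 + m ^ 2) + (tau - a * m) ^ 2 + (L * m - a * tau) ^ 2) by (unfold L; ring).
    pose proof (pow2_ge_0 (tau - a * m)). pose proof (pow2_ge_0 (L * m - a * tau)). lra. }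
  (* The unit in [tau = A + 1] pays for replacing [n] by [n + nu], since [nu < 1]. *)
  assert (H2 : (A + Rabs (IZR n)) ^ 2 <= 2 * (tau ^ 2 + m ^ 2)).
  { assert (Rabs (IZR n) <= Rabs m + 1).
    { replace (IZR n) with (m + - nu) by (unfold m; ring). eapply Rle_trans; [apply Rabs_triang|].
      rewrite Rabs_Ropp, (Rabs_pos_eq nu) by lra. lra. }
    assert (Rabs m ^ 2 = m ^ 2) by (rewrite pow2_abs; auto). pose proof (Rabs_pos m).
    assert (0 <= A + Rabs (IZR n) <= tau + Rabs m) by (unfold tau; lra).
    pose proof (pow2_ge_0 (tau - Rabs m)). nra. }
  assert (H3 : (sqrt q * (A + Rabs (IZR n))) ^ 2 <= Cnorm X ^ 2).
  { rewrite Rpow_mult_distr, ES. apply Rle_trans with (q * (2 * (tau ^ 2 + m ^ 2))).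
    - apply Rmult_le_compat_l; lra.
    - unfold q. apply Rmult_le_reg_l with (1 + L); [lra|].
      replace ((1 + L) * (b ^ 2 / (2 * (1 + L)) * (2 * (tau ^ 2 + m ^ 2)))) with (b ^ 2 * (tau ^ 2 + m ^ 2)) by (field; lra).
      lra. }
  apply Rsqr_incr_0_var; auto. unfold Rsqr. nra.
Qed.

(* Off the lines [R lam] and [R (conj lam)] the multiplier [1/(tau - lam (n + nu))] has small
   l2 norm, so [u -> i c conj u] followed by it is a contraction in the sup norm. *)
Lemma weak_kernel : exists tau, forall u, Pc u -> weak tau u (fun _ => C0) -> forall t, u t = C0.
Proof.
  destruct symbol_lower as [g [Hg SL]]. destruct (Pc_bounded c c_Pc) as [Mc [HMc Bc]].
  (* [eps] makes [Mc * M * eps] equal to [M / 2], the contraction sought; [A] then brings the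
     squared l2 norm [3 / (g^2 A)] of the multipliers below [eps ^ 2]. *)
  set (eps := / (2 * Mc)). assert (Heps : 0 < eps) by (apply Rinv_0_lt_compat; lra).
  set (A := 1 + 3 / (g ^ 2 * eps ^ 2)).
  assert (Hge : 0 < g ^ 2 * eps ^ 2) by (apply Rmult_lt_0_compat; apply pow_lt; auto).
  assert (HA' : 0 < 3 / (g ^ 2 * eps ^ 2)) by (apply Rdiv_lt_0_compat; lra).
  assert (HA : 1 <= A) by (unfold A; lra).
  exists (A + 1). intros u Hu HW.
  apply contraction_zero; auto.
  intros M HM Bu. set (v := fun t => (Ci * (c t * Cconj (u t)))%Cx).
    assert (Pv : Pc v) by (apply Pc_cu; auto).
    assert (Bv : forall t, Cnorm (v t) <= Mc * M).
    { intros t. unfold v. rewrite !Cnorm_mul, Cnorm_Ci, Cnorm_conj, Rmult_1_l.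
      apply Rmult_le_compat; auto; apply Cnorm_ge0. }
    set (be := fun n => / g * / (A + Rabs (IZR n))).
    assert (Hpos : forall n, 0 < A + Rabs (IZR n)) by (intros n; pose proof (Rabs_pos (IZR n)); lra).
    assert (Hbe : forall n, 0 <= be n).
    { intros n. unfold be. apply Rmult_le_pos; left; apply Rinv_0_lt_compat; auto. }
    assert (HB : forall N, rsum (fun n => be n ^ 2) N <= eps ^ 2).
    { intros N. unfold be. apply Rle_trans with ((/ g) ^ 2 * (3 / A)).
      - apply Rle_trans with (rsum (fun n => (/ g) ^ 2 * (/ (A + Rabs (IZR n))) ^ 2) N).
        + apply rsum_le. intros; rewrite Rpow_mult_distr; lra.
        + rewrite rsum_scal. apply Rmult_le_compat_l; [apply pow2_ge_0|]. apply rsum_inv_sqr_shift; auto.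
      - apply Rmult_le_reg_l with (g ^ 2 * A); [apply Rmult_lt_0_compat; [apply pow_lt; auto|lra]|].
        replace (g ^ 2 * A * ((/ g) ^ 2 * (3 / A))) with 3 by (field; lra).
        replace (g ^ 2 * A * eps ^ 2) with (g ^ 2 * eps ^ 2 * A) by ring. unfold A.
        rewrite Rmult_plus_distr_l. replace (g ^ 2 * eps ^ 2 * (3 / (g ^ 2 * eps ^ 2))) with 3 by (field; split; lra).
        lra. }
    assert (Fu : forall n, Cnorm (F u n) <= Cnorm (F v n) * be n).
    { intros n. specialize (HW n). fold v in HW. rewrite F_zero in HW. apply Csub_eq0 in HW.
      specialize (SL A n ltac:(lra)). set (X := (CofR (A + 1) - lam * CofR (IZR n + nu))%Cx) in *.
      rewrite <- HW, Cnorm_mul. unfold be. pose proof (Hpos n) as Hp. pose proof (Cnorm_ge0 (F u n)) as Hn.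
      apply Rmult_le_reg_l with (g * (A + Rabs (IZR n))); [apply Rmult_lt_0_compat; auto|].
      replace (g * (A + Rabs (IZR n)) * (Cnorm X * Cnorm (F u n) * (/ g * / (A + Rabs (IZR n)))))
        with (Cnorm X * Cnorm (F u n)) by (field; lra).
      apply Rmult_le_compat_r; auto. }
    assert (HS : summable (fun n => Cnorm (F v n) * be n)) by (eapply summable_F_weighted; eauto).
    intros t. rewrite (fourier_inversion u _ Hu HS Fu t).
    eapply zsum_bound; [exact HS| |].
    - intros j. rewrite Cnorm_mul, Cnorm_en, Rmult_1_r. apply Fu.
    - intros N. eapply Rle_trans; [apply (bessel_weighted v (Mc * M) be (eps ^ 2) eps N); auto|].
      + apply Rmult_lt_0_compat; auto.
      + right. unfold eps. field. lra.
Qed.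

(** * The linear system satisfied by an eigenfunction *)

(** [phi' = dphi] and [psi' = dpsi] say that the coefficients of [r^s] and of [conj (r^s)] in
    [L (r^s phi + conj (r^s psi))] vanish, the second equation being conjugated and both solved for
    the derivative. *)
Definition dphi (s : Cx) (phi psi : R -> Cx) (t : R) : Cx :=
  (((Ci * s - Ci * lam * CofR nu) * phi t + c t * psi t) / lam)%Cx.
Definition dpsi (s : Cx) (phi psi : R -> Cx) (t : R) : Cx :=
  (((Ci * Cconj lam * CofR nu - Ci * s) * psi t + Cconj (c t) * phi t) / Cconj lam)%Cx.

(* Equivalent to [Q (E phi psi z) = E phi psi (s z)] for all [z]. *)
Definition eig (s : Cx) (phi psi : R -> Cx) : Prop :=
  Pc phi /\ Pc psi /\
  (forall t, is_deriv_C phi t (dphi s phi psi t)) /\ (forall t, is_deriv_C psi t (dpsi s phi psi t)).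

Lemma eig_Pc s phi psi z : eig s phi psi -> Pc (E phi psi z).
Proof. intros [H [H' _]]. apply E_Pc; auto. Qed.

Lemma Pc_dphi s phi psi : Pc phi -> Pc psi -> Pc (dphi s phi psi).
Proof.
  intros. unfold dphi, Cdiv. apply Pc_mul; [|apply Pc_const].
  apply Pc_add; [apply Pc_scal; auto|apply Pc_mul; auto].
Qed.

Lemma Pc_dpsi s phi psi : Pc phi -> Pc psi -> Pc (dpsi s phi psi).
Proof.
  intros. unfold dpsi, Cdiv. apply Pc_mul; [|apply Pc_const].
  apply Pc_add; [apply Pc_scal; auto|apply Pc_mul; auto]. apply Pc_conj; auto.
Qed.

(** Integration by parts replaces [u_t] by [i n], and [i lam (i n) = - lam n]. *)
Lemma weak_classical tau u du f : Pc u -> Pc du -> (forall t, is_deriv_C u t (du t)) ->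
  (forall t, f t = CofR tau * u t + Ci * lam * du t - lam * CofR nu * u t - Ci * (c t * Cconj (u t)))%Cx ->
  weak tau u f.
Proof.
  intros Hu Hdu HD Hf n.
  rewrite (F_ext f (fun t => (CofR tau - lam * CofR nu) * u t + (Ci * lam) * du t - Ci * (c t * Cconj (u t)))%Cx)
    by (intros; rewrite Hf; ring).
  rewrite F_sub, F_add, !F_scal, (F_deriv u du n); auto 7 using Pc_scal, Pc_add, Pc_cu, Pc_mul, Pc_conj.
  rewrite CofR_add. replace (mkC 0 (IZR n)) with (Ci * CofR (IZR n))%Cx by cx.
  replace (Ci * lam * (Ci * CofR (IZR n) * F u n))%Cx with (- (lam * CofR (IZR n) * F u n))%Cx.
  - ring.
  - replace (Ci * lam * (Ci * CofR (IZR n) * F u n))%Cx with ((Ci * Ci) * (lam * CofR (IZR n) * F u n))%Cx by ring.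
    replace (Ci * Ci)%Cx with (- C1)%Cx by cx. ring.
Qed.

(** [Q] maps [E phi psi z] to [E phi psi (s z)]. Since [E] is only R-linear in [z], absorbing [tau]
    into [z] requires [tau] real. *)
Lemma weak_E s phi psi tau z : eig s phi psi ->
  weak tau (E phi psi z) (E phi psi ((CofR tau - s) * z)%Cx).
Proof.
  intros [H1 [H2 [D1 D2]]].
  apply weak_classical with (du := fun t => (z * dphi s phi psi t + Cconj (z * dpsi s phi psi t))%Cx).
  - apply E_Pc; auto.
  - apply (E_Pc (dphi s phi psi) (dpsi s phi psi) z); [apply Pc_dphi|apply Pc_dpsi]; auto.
  - intros t. unfold E. apply is_deriv_add; [apply is_deriv_scal; auto|].
    apply (is_deriv_conj (fun t => z * psi t)%Cx). apply is_deriv_scal; auto.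
  - intros t. unfold E, dphi, dpsi, Cdiv. rewrite !Cconj_add, !Cconj_mul, Cconj_inv, !Cconj_add, !Cconj_mul.
    rewrite !Cconj_sub, !Cconj_mul, !Cconj_conj, !Cconj_CofR.
    replace (Cconj Ci) with (- Ci)%Cx by cx.
    pose proof lam_neq0 as HL. fold lam in HL.
    set (x := phi t). set (y := psi t). set (k := c t). clearbody lam x y k.
    transitivity (CofR tau * (z * x + Cconj z * Cconj y) + Ci * ((z * ((Ci * s - Ci * lam * CofR nu) * x + k * y)) +
       Cconj z * (((- Ci) * lam * CofR nu - (- Ci) * Cconj s) * Cconj y + k * Cconj x))
      - lam * CofR nu * (z * x + Cconj z * Cconj y) - Ci * (k * (Cconj z * Cconj x + z * y)))%Cx; [cx|field; auto].
Qed.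

(** The same function with its two summands exchanged: [E phi psi z = E (conj psi) (conj phi) (conj
    z)]. This is why an exponent and its conjugate have to be treated as one class. *)
Lemma eig_star s phi psi : eig s phi psi ->
  eig (Cconj s) (fun t => Cconj (psi t)) (fun t => Cconj (phi t)).
Proof.
  intros [H1 [H2 [D1 D2]]]. split; [apply Pc_conj; auto|]. split; [apply Pc_conj; auto|]. split; intros t.
  - replace (dphi (Cconj s) (fun t0 => Cconj (psi t0)) (fun t0 => Cconj (phi t0)) t) with (Cconj (dpsi s phi psi t)).
    + apply is_deriv_conj; auto.
    + unfold dphi, dpsi, Cdiv. rewrite Cconj_mul, Cconj_inv. f_equal; [cx|f_equal; cx].
  - replace (dpsi (Cconj s) (fun t0 => Cconj (psi t0)) (fun t0 => Cconj (phi t0)) t) with (Cconj (dphi s phi psi t)).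
    + apply is_deriv_conj; auto.
    + unfold dphi, dpsi, Cdiv. rewrite Cconj_mul, Cconj_inv. f_equal; cx.
Qed.

(** The system for the pair [(phi, psi)] is C-linear, although [Q] itself is only R-linear. *)
Lemma eig_lin s al be phi psi phi' psi' : eig s phi psi -> eig s phi' psi' ->
  eig s (fun t => al * phi t + be * phi' t)%Cx (fun t => al * psi t + be * psi' t)%Cx.
Proof.
  intros [H1 [H2 [D1 D2]]] [H1' [H2' [D1' D2']]].
  split; [apply Pc_add; apply Pc_scal; auto|]. split; [apply Pc_add; apply Pc_scal; auto|]. split; intros t.
  - replace (dphi s _ _ t) with (al * dphi s phi psi t + be * dphi s phi' psi' t)%Cx.
    + apply is_deriv_add; apply is_deriv_scal; auto.
    + unfold dphi, Cdiv. ring.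
  - replace (dpsi s _ _ t) with (al * dpsi s phi psi t + be * dpsi s phi' psi' t)%Cx.
    + apply is_deriv_add; apply is_deriv_scal; auto.
    + unfold dpsi, Cdiv. ring.
Qed.

(* [exp (- 2 A t) (|phi|^2 - |psi|^2)] with [A = Re (i s / lam)] is strictly monotone as long as [psi <> 0]. *)
Lemma eig_nonreal_zero s phi psi t0 : Cim s <> 0 -> eig s phi psi ->
  Cnorm (phi t0) = Cnorm (psi t0) -> forall t, phi t = C0 /\ psi t = C0.
Proof.
  intros Hs [[C1' P1] [[C2' P2] [D1 D2]]] H0. pose proof ab_sqr_pos as HL.
  set (A := Cre (Ci * s / lam)%Cx).
  (* In the derivative of [|phi|^2 - |psi|^2] the terms with [c] cancel. What is left beside the
     growth rate [2 A] is [2 mu |psi|^2], where [mu = Re (i s / lam) + Re (i s / conj lam)]; it is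
     nonzero as [a > 0] and [Im s <> 0]. *)
  set (mu := (-2) * a * Cim s / (a ^ 2 + b ^ 2)).
  set (h := fun t => (CofR (exp (- (2 * A) * t)) * (phi t * Cconj (phi t) + (- C1) * (psi t * Cconj (psi t))))%Cx).
  assert (Eh : forall t, Cre (h t) = exp (- (2 * A) * t) * (Cnorm (phi t) ^ 2 - Cnorm (psi t) ^ 2)).
  { intros t. unfold h. rewrite !Cnorm_sqr. simpl. ring. }
  assert (Dh : forall t, derivable_pt_lim (fun t => Cre (h t)) t (2 * mu * (exp (- (2 * A) * t) * Cnorm (psi t) ^ 2))).
  { intros t.
    assert (De : is_deriv_C (fun t => CofR (exp (- (2 * A) * t))) t (CofR (- (2 * A) * exp (- (2 * A) * t)))).
    { split; simpl; [|apply derivable_pt_lim_const]. apply is_derive_Reals. auto_derive; auto. ring. }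
    pose proof (is_deriv_mul _ _ t _ _ De (is_deriv_add _ _ t _ _
      (is_deriv_mul _ _ t _ _ (D1 t) (is_deriv_conj _ _ _ (D1 t)))
      (is_deriv_scal (- C1)%Cx _ t _ (is_deriv_mul _ _ t _ _ (D2 t) (is_deriv_conj _ _ _ (D2 t)))))) as [X _].
    match type of X with derivable_pt_lim _ _ ?l => replace (2 * mu * (exp (- (2 * A) * t) * Cnorm (psi t) ^ 2)) with l end.
    - exact X.
    - rewrite Cnorm_sqr. unfold dphi, dpsi, mu, A, lam. simpl. field. simpl in HL. nra. }
  (* [|phi|^2 - |psi|^2] is periodic, so its zero at [t0] recurs in every period, whatever the
     exponential factor. *)
  assert (Hz : forall k : Z, Cre (h (t0 + 2 * PI * IZR k)) = 0).
  { intros k. rewrite Eh, (periodic_Z phi), (periodic_Z psi), H0; auto. ring. }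
  assert (Hmu : mu <> 0).
  { unfold mu. intros E0. apply (f_equal (fun x => x * (a ^ 2 + b ^ 2))) in E0.
    replace (-2 * a * Cim s / (a ^ 2 + b ^ 2) * (a ^ 2 + b ^ 2)) with (-2 * a * Cim s) in E0 by (field; lra).
    rewrite Rmult_0_l in E0. apply Rmult_integral in E0. destruct E0; [lra|auto]. }
  assert (Mono : forall x y, x < y -> 0 <= Cre (h y) / mu - Cre (h x) / mu).
  { intros x y Hxy.
    destruct (MVT_cor2 (fun t => Cre (h t)) _ x y Hxy (fun t _ => Dh t)) as [w [E0 _]].
    replace (Cre (h y) / mu - Cre (h x) / mu) with ((Cre (h y) - Cre (h x)) / mu) by (field; auto).
    rewrite E0. replace (2 * mu * (exp (- (2 * A) * w) * Cnorm (psi w) ^ 2) * (y - x) / mu)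
      with (2 * (exp (- (2 * A) * w) * Cnorm (psi w) ^ 2) * (y - x)) by (field; auto).
    pose proof (exp_pos (- (2 * A) * w)). pose proof (pow2_ge_0 (Cnorm (psi w))).
    apply Rmult_le_pos; [|lra]. apply Rmult_le_pos; [lra|]. apply Rmult_le_pos; lra. }
  (* Every [t] lies between two of these zeros, and [h / mu] is monotone; hence [h] vanishes
     identically, and so does its derivative, a multiple of [|psi|^2]. *)
  assert (Zh : forall t, Cre (h t) = 0).
  { intros t. destruct (period_reduce (t - t0)) as [k [r [Hr Er]]].
    pose proof (Mono (t0 + 2 * PI * IZR (k - 1)) t) as M1. pose proof (Mono t (t0 + 2 * PI * IZR (k + 1))) as M2.
    rewrite Hz in M1, M2. rewrite minus_IZR in M1. rewrite plus_IZR in M2. pose proof two_PI_pos.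
    specialize (M1 ltac:(nra)). specialize (M2 ltac:(nra)).
    assert (E0 : Cre (h t) / mu = 0) by (unfold Rdiv in *; lra).
    unfold Rdiv in E0. apply Rmult_integral in E0. destruct E0 as [|E0]; auto.
    pose proof (Rinv_neq_0_compat mu Hmu); lra. }
  assert (Zp : forall t, psi t = C0).
  { intros t. apply Cnorm_eq0.
    assert (E0 : 2 * mu * (exp (- (2 * A) * t) * Cnorm (psi t) ^ 2) = 0).
    { eapply uniqueness_limite; [apply Dh|]. apply is_derive_Reals.
      apply is_derive_ext with (fun _ => 0); [intros; symmetry; apply Zh|]. apply is_derive_Reals, derivable_pt_lim_const. }
    apply Rmult_integral in E0. destruct E0 as [E0|E0]; [lra|]. apply Rmult_integral in E0.
    pose proof (exp_pos (- (2 * A) * t)). destruct E0 as [E0|E0]; [lra|]. nra. }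
  intros t. split; auto. apply Cnorm_eq0. specialize (Zh t). rewrite Eh, Zp, Cnorm_C0 in Zh.
  apply Rmult_integral in Zh. pose proof (exp_pos (- (2 * A) * t)). destruct Zh as [|Zh]; [lra|]. nra.
Qed.

(** The weights [al], [be] are those for which the two components of the combined pair agree at [0];
    by [eig_nonreal_zero] that combination is zero, and [be <> 0] by the strict inequality. *)
Lemma eig_nonreal_simple s phi psi phi' psi' : Cim s <> 0 -> eig s phi psi -> eig s phi' psi' ->
  Cnorm (psi 0) < Cnorm (phi 0) ->
  exists k, forall t, phi' t = (k * phi t)%Cx /\ psi' t = (k * psi t)%Cx.
Proof.
  intros Hs H H' Hlt. set (be := (phi 0 - psi 0)%Cx). set (al := (- (phi' 0 - psi' 0))%Cx).
  assert (Hbe : be <> C0).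
  { intros E0. apply Csub_eq0 in E0. rewrite E0 in Hlt. lra. }
  pose proof (eig_nonreal_zero s _ _ 0 Hs (eig_lin s al be _ _ _ _ H H')) as Z. simpl in Z.
  exists ((- al) / be)%Cx. intros t. destruct (Z ltac:(f_equal; unfold al, be; ring) t) as [Z1 Z2].
  split; apply Csub_eq0.
  - transitivity ((al * phi t + be * phi' t) / be)%Cx; [field; auto|]. rewrite Z1. field; auto.
  - transitivity ((al * psi t + be * psi' t) / be)%Cx; [field; auto|]. rewrite Z2. field; auto.
Qed.

(** When [psi = conj phi] the system is a real planar one. The terms with [c] contribute to the
    derivative of [conj phi * phi'] two mutually conjugate numbers, whose sum has no imaginary part,
    so only the rate [2 Re (i s / lam)] remains. *)
Lemma eig_real_wronskian s phi phi' : Cim s = 0 ->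
  eig s phi (fun t => Cconj (phi t)) -> eig s phi' (fun t => Cconj (phi' t)) ->
  exists A, forall t, Cim (Cconj (phi t) * phi' t)%Cx = Cim (Cconj (phi 0) * phi' 0)%Cx * exp (A * t).
Proof.
  intros Hs [_ [_ [D1 _]]] [_ [_ [D2 _]]]. pose proof ab_sqr_pos as HL.
  set (A := 2 * Cre (Ci * s / lam)%Cx). exists A.
  set (h := fun t => (CofR (exp (- A * t)) * (Cconj (phi t) * phi' t))%Cx).
  assert (Dh : forall t, derivable_pt_lim (fun t => Cim (h t)) t 0).
  { intros t.
    assert (De : is_deriv_C (fun t => CofR (exp (- A * t))) t (CofR (- A * exp (- A * t)))).
    { split; simpl; [|apply derivable_pt_lim_const]. apply is_derive_Reals. auto_derive; auto. ring. }
    pose proof (is_deriv_mul _ _ t _ _ De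
      (is_deriv_mul _ _ t _ _ (is_deriv_conj _ _ _ (D1 t)) (D2 t))) as [_ X].
    match type of X with derivable_pt_lim _ _ ?l => assert (El : l = 0) end; [|rewrite El in X; exact X].
    unfold dphi, A, lam. simpl. rewrite Hs. field. simpl in HL. nra. }
  intros t.
  assert (E0 : Cim (h t) = Cim (h 0)).
  { destruct (Rtotal_order t 0) as [L|[->|L]]; auto;
      destruct (MVT_cor2 (fun t => Cim (h t)) (fun _ => 0) _ _ L (fun t _ => Dh t)) as [w [Ew _]]; lra. }
  assert (Eh : forall t, Cim (h t) = exp (- A * t) * Cim (Cconj (phi t) * phi' t)%Cx)
    by (intros; unfold h; simpl; ring).
  rewrite !Eh, Rmult_0_r, exp_0, Rmult_1_l in E0. rewrite <- E0.
  rewrite Rmult_comm, <- Rmult_assoc, <- exp_plus. replace (A * t + - A * t) with 0 by ring. rewrite exp_0; ring.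
Qed.
End Eigen.

(** * Comparison of winding numbers *)

(** A continuous angle with a nonzero total increment sweeps a full half-turn from its initial
    value, in the direction given by the sign of [k]. *)
Lemma angle_ivt (D : R -> R) (k : Z) : continuity D -> k <> 0%Z -> D (2 * PI) = D 0 + 2 * PI * IZR k ->
  exists eps, (eps = 1 \/ eps = -1) /\ forall y, 0 <= y <= PI -> exists t, D t = D 0 + eps * y.
Proof.
  intros Hc Hk HD. pose proof PI_RGT_0.
  destruct (Z_lt_le_dec 0 k) as [L|L].
  - exists 1. split; auto. intros y Hy. assert (1 <= IZR k) by (apply IZR_le; lia).
    destruct (IVT_gen D 0 (2 * PI) (D 0 + 1 * y) Hc) as [t [_ Ht]]; [|exists t; auto].
    rewrite HD. rewrite Rmin_left, Rmax_right; nra.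
  - exists (-1). split; auto. intros y Hy. assert (IZR k <= -1) by (apply IZR_le; lia).
    destruct (IVT_gen D 0 (2 * PI) (D 0 + (-1) * y) Hc) as [t [_ Ht]]; [|exists t; auto].
    rewrite HD. rewrite Rmin_right, Rmax_left; nra.
Qed.

(** The angle difference [D] has constant [exp (i D)]. If the winding numbers differed, [D] would
    move by half a turn and reverse the sign of that constant. *)
Lemma winding_scal phi phi' k j j' : (forall t, phi t <> C0) -> k <> C0 ->
  (forall t, phi' t = (k * phi t)%Cx) -> winding phi j -> winding phi' j' -> j = j'.
Proof.
  intros Hn Hk HE [th [Ct [Et Pt]]] [th' [Ct' [Et' Pt']]].
  apply NNPP. intros Hj. set (D := fun t => th' t - th t).
  assert (Hw : forall t, Cexp (mkC 0 (D t)) = (k / CofR (Cnorm k))%Cx).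
  { intros t. pose proof (Et t) as E1. pose proof (Et' t) as E2. rewrite HE, Cnorm_mul, CofR_mul in E2.
    pose proof (Cnorm_gt0 _ (Hn t)) as N1. pose proof (Cnorm_gt0 _ Hk) as N2.
    assert (X1 : CofR (Cnorm (phi t)) <> C0) by (apply CofR_neq0; lra).
    assert (X2 : CofR (Cnorm k) <> C0) by (apply CofR_neq0; lra).
    pose proof (Cexp_neq0 (mkC 0 (th t))) as X3.
    assert (E3 : Cexp (mkC 0 (th' t)) = (Cexp (mkC 0 (D t)) * Cexp (mkC 0 (th t)))%Cx).
    { rewrite <- Cexp_add. f_equal. unfold D. cx. }
    rewrite E3 in E2. set (x := Cnorm (phi t)) in *. rewrite E1 in E2.
    set (e := Cexp (mkC 0 (th t))) in *. set (d := Cexp (mkC 0 (D t))) in *.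
    transitivity ((CofR (Cnorm k) * CofR x * (d * e)) / (CofR (Cnorm k) * CofR x * e))%Cx; [field; auto|].
    rewrite <- E2. field; auto. }
  destruct (angle_ivt D (j' - j)) as [eps [He Hi]].
  - intros t. apply (continuity_pt_minus th' th); auto.
  - lia.
  - unfold D. specialize (Pt 0). specialize (Pt' 0). rewrite Rplus_0_l in *. rewrite Pt, Pt', minus_IZR. ring.
  - destruct (Hi PI) as [t Ht]; [pose proof PI_RGT_0; lra|].
    pose proof (Hw t) as A. rewrite <- (Hw 0), Ht in A.
    assert (B : Cexp (mkC 0 (D 0 + eps * PI)) = (- Cexp (mkC 0 (D 0)))%Cx).
    { unfold Cexp; simpl. rewrite cos_plus, sin_plus.
      assert (cos (eps * PI) = -1 /\ sin (eps * PI) = 0) as [-> ->].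
      { destruct He as [->| ->]; [rewrite Rmult_1_l, cos_PI, sin_PI; auto|].
        replace (-1 * PI) with (- PI) by ring. rewrite cos_neg, sin_neg, cos_PI, sin_PI. split; ring. }
      cx. }
    rewrite B in A. apply (Cexp_neq0 (mkC 0 (D 0))). set (x := Cexp (mkC 0 (D 0))) in *.
    apply Cx_ext; [apply (f_equal Cre) in A|apply (f_equal Cim) in A]; simpl in *; lra.
Qed.

(** The Wronskian equals [|phi| |phi'| sin D] and cannot change sign. If the winding numbers
    differed, a half-turn of [D] would force [sin (D 0) = 0], so [sin D] would vanish everywhere,
    which fails after a quarter-turn. *)
Lemma winding_wronskian phi phi' A j j' : (forall t, phi t <> C0) -> (forall t, phi' t <> C0) ->
  (forall t, Cim (Cconj (phi t) * phi' t)%Cx = Cim (Cconj (phi 0) * phi' 0)%Cx * exp (A * t)) ->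
  winding phi j -> winding phi' j' -> j = j'.
Proof.
  intros Hn Hn' HW [th [Ct [Et Pt]]] [th' [Ct' [Et' Pt']]].
  apply NNPP. intros Hj. set (D := fun t => th' t - th t).
  assert (Hw : forall t, Cim (Cconj (phi t) * phi' t)%Cx = Cnorm (phi t) * Cnorm (phi' t) * sin (D t)).
  { intros t. rewrite (Et t), (Et' t) at 1. unfold D. rewrite sin_minus. simpl. rewrite exp_0. ring. }
  destruct (angle_ivt D (j' - j)) as [eps [He Hi]].
  - intros t. apply (continuity_pt_minus th' th); auto.
  - lia.
  - unfold D. specialize (Pt 0). specialize (Pt' 0). rewrite Rplus_0_l in *. rewrite Pt, Pt', minus_IZR. ring.
  - pose proof PI_RGT_0.
    assert (Pos : forall t, 0 < Cnorm (phi t) * Cnorm (phi' t))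
      by (intros; apply Rmult_lt_0_compat; apply Cnorm_gt0; auto).
    destruct (Hi PI) as [t Ht]; [lra|]. destruct (Hi (PI / 2)) as [t' Ht']; [lra|].
    assert (S1 : sin (D t) = - sin (D 0)).
    { rewrite Ht. destruct He as [->| ->].
      - rewrite Rmult_1_l, sin_plus, cos_PI, sin_PI. ring.
      - replace (-1 * PI) with (- PI) by ring. rewrite sin_plus, cos_neg, sin_neg, cos_PI, sin_PI. ring. }
    assert (Z0 : sin (D 0) = 0).
    { pose proof (HW t) as X. rewrite !Hw, S1 in X. pose proof (Pos t). pose proof (Pos 0).
      pose proof (exp_pos (A * t)).
      assert (0 < Cnorm (phi 0) * Cnorm (phi' 0) * exp (A * t)) by (apply Rmult_lt_0_compat; auto). nra. }
    assert (Z1 : sin (D t') = 0).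
    { pose proof (HW t') as X. rewrite !Hw, Z0, Rmult_0_r, Rmult_0_l in X. apply Rmult_integral in X.
      pose proof (Pos t'). destruct X; [lra|auto]. }
    rewrite Ht' in Z1. rewrite sin_plus, Z0 in Z1. pose proof (sin2_cos2 (D 0)) as S. unfold Rsqr in S. rewrite Z0 in S.
    destruct He as [->| ->].
    + rewrite Rmult_1_l, sin_PI2 in Z1. nra.
    + replace (-1 * (PI / 2)) with (- (PI / 2)) in Z1 by ring. rewrite sin_neg, sin_PI2 in Z1. nra.
Qed.

(** * Basic solutions as eigenfunctions *)

Lemma is_deriv_ext_loc f g t l d : 0 < d -> (forall t', Rabs (t' - t) < d -> f t' = g t') ->
  is_deriv_C f t l -> is_deriv_C g t l.
Proof.
  intros Hd HE [A B]. split; apply is_derive_Reals; apply is_derive_Reals in A, B.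
  - apply is_derive_ext_loc with (fun t => Cre (f t)); auto.
    exists (mkposreal d Hd). intros y Hy. rewrite HE; auto.
  - apply is_derive_ext_loc with (fun t => Cim (f t)); auto.
    exists (mkposreal d Hd). intros y Hy. rewrite HE; auto.
Qed.

Lemma is_deriv_Cpow s r : 0 < r -> is_deriv_C (fun r => Cpow r s) r (s * Cpow r s / CofR r)%Cx.
Proof.
  intros Hr. unfold Cpow, Cexp; split; simpl; apply is_derive_Reals; auto_derive; auto; field; lra.
Qed.

(** For nonreal [s] the power [r^s] rotates. Its values at [1] and at this [r] are independent over
    R, so two radii suffice to separate [phi] from [psi]. *)
Lemma Cpow_quarter s : Cim s <> 0 -> exists r rho, 0 < r /\ 0 < rho /\ Cpow r s = (CofR rho * Ci)%Cx.
Proof.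
  intros Hs. exists (exp (PI / 2 / Cim s)), (exp (Cre s * (PI / 2 / Cim s))).
  split; [apply exp_pos|]. split; [apply exp_pos|]. unfold Cpow. rewrite ln_exp. unfold Cexp; simpl.
  replace (Cim s * (PI / 2 / Cim s)) with (PI / 2) by (field; auto).
  rewrite cos_PI2, sin_PI2. cx.
Qed.

Lemma Cpow_real r s : Cim s = 0 -> Cpow r s = CofR (Rpower r (Cre s)).
Proof.
  intros H. unfold Cpow, Cexp; simpl. rewrite H, Rmult_0_l, cos_0, sin_0. unfold Rpower. cx.
Qed.

Lemma E_split phi psi rho z t w w' : 0 < rho -> w = E phi psi z t -> w' = E phi psi (CofR rho * Ci * z)%Cx t ->
  (z * phi t)%Cx = (CofR (/ 2) * (w - Ci * CofR (/ rho) * w'))%Cx /\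
  Cconj (z * psi t) = (CofR (/ 2) * (w + Ci * CofR (/ rho) * w'))%Cx.
Proof.
  intros Hr -> ->. unfold E. split; apply Cx_ext; simpl; field; lra.
Qed.

(** Needed because the definition of a basic solution and the asymptotic normalisation of the family
    each supply a pair for the same function. *)
Lemma E_Cpow_inj s phi psi phi' psi' : Cim s <> 0 ->
  (forall r t, 0 < r -> E phi psi (Cpow r s) t = E phi' psi' (Cpow r s) t) ->
  forall t, phi t = phi' t /\ psi t = psi' t.
Proof.
  intros Hs H t. destruct (Cpow_quarter s Hs) as [r [rho [Hr [Hrho HP]]]].
  pose proof (H 1 t ltac:(lra)) as H1. pose proof (H r t Hr) as H2. rewrite Cpow_1 in H1. rewrite HP in H2.
  replace (CofR rho * Ci)%Cx with (CofR rho * Ci * C1)%Cx in H2 by ring.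
  destruct (E_split phi psi rho C1 t _ _ Hrho eq_refl eq_refl) as [A B].
  destruct (E_split phi' psi' rho C1 t _ _ Hrho H1 H2) as [A' B']. rewrite <- A in A'. rewrite <- B in B'.
  split; [rewrite <- (Cconj_conj (phi t)), <- (Cconj_conj (phi' t))|
    rewrite <- (Cconj_conj (psi t)), <- (Cconj_conj (psi' t))]; f_equal.
  - replace (C1 * phi t)%Cx with (phi t) in A' by ring. replace (C1 * phi' t)%Cx with (phi' t) in A' by ring.
    congruence.
  - replace (C1 * psi t)%Cx with (psi t) in B' by ring. replace (C1 * psi' t)%Cx with (psi' t) in B' by ring.
    congruence.
Qed.

Section Items.
Variables (a b nu : R) (c : R -> Cx).
Hypothesis a_pos : 0 < a.
Let lam := mkC a b.

Lemma sol_radial w s phi psi ur : 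
  (forall r t, 0 < r -> is_deriv_C (fun x => w x t) r (ur r t)) ->
  (forall r t, 0 < r -> w r t = E phi psi (Cpow r s) t) ->
  forall r t, 0 < r -> (CofR r * ur r t)%Cx = E phi psi (s * Cpow r s)%Cx t.
Proof.
  intros D H r t Hr.
  assert (D2 : is_deriv_C (fun x => w x t) r (E phi psi (s * Cpow r s / CofR r)%Cx t)).
  { apply is_deriv_ext_loc with (f := fun x => E phi psi (Cpow x s) t) (d := r); auto.
    - intros x Hx. symmetry. apply H. apply Rabs_def2 in Hx. lra.
    - unfold E. pose proof (is_deriv_Cpow s r Hr) as DP. apply is_deriv_add.
      + replace (s * Cpow r s / CofR r * phi t)%Cx with ((s * Cpow r s / CofR r) * phi t + Cpow r s * C0)%Cx by ring.
        apply (is_deriv_mul (fun x => Cpow x s) (fun _ => phi t)); auto. apply is_deriv_const.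
      + apply (is_deriv_conj (fun x => Cpow x s * psi t)%Cx).
        replace (s * Cpow r s / CofR r * psi t)%Cx with ((s * Cpow r s / CofR r) * psi t + Cpow r s * C0)%Cx by ring.
        apply (is_deriv_mul (fun x => Cpow x s) (fun _ => psi t)); auto. apply is_deriv_const. }
  rewrite (is_deriv_unique _ _ _ _ (D r t Hr) D2).
  rewrite <- E_real. f_equal. field. apply CofR_neq0. lra.
Qed.

(** Basic solutions come with merely continuous [phi] and [psi]; writing these as combinations of
    [w] at two radii gives their differentiability. *)
Lemma eig_of_nonreal w s phi psi : L_solution lam nu c (fun r => 0 < r) w -> Cim s <> 0 ->
  periodic2pi phi -> periodic2pi psi ->
  (forall r t, 0 < r -> w r t = E phi psi (Cpow r s) t) -> eig a b nu c s phi psi.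
Proof.
  intros [_ [ur [ut [D [_ [_ [_ HL]]]]]]] Hs Pp Pq Hw.
  destruct (Cpow_quarter s Hs) as [r [rho [Hr [Hrho HP]]]].
  assert (Dr : forall r t, 0 < r -> is_deriv_C (fun x => w x t) r (ur r t)) by (intros; apply D; auto).
  assert (Dt : forall r t, 0 < r -> is_deriv_C (fun x => w r x) t (ut r t)) by (intros; apply D; auto).
  pose proof (sol_radial w s phi psi ur Dr Hw) as Hur.
  (* Candidates for the derivatives of [phi] and of [conj psi], by the inversion formula of
     [E_split]. *)
  set (p := fun t => (CofR (/ 2) * (ut 1 t - Ci * CofR (/ rho) * ut r t))%Cx).
  set (q := fun t => (CofR (/ 2) * (ut 1 t + Ci * CofR (/ rho) * ut r t))%Cx).
  assert (H1 : 0 < 1) by lra.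
  assert (W1 : forall t, w 1 t = E phi psi C1 t) by (intros; rewrite Hw, Cpow_1; auto).
  assert (Wr : forall t, w r t = E phi psi (CofR rho * Ci * C1)%Cx t)
    by (intros; rewrite Hw, HP by auto; f_equal; ring).
  assert (Ephi : forall t, phi t = (CofR (/ 2) * (w 1 t + (- (Ci * CofR (/ rho))) * w r t))%Cx).
  { intros t. destruct (E_split phi psi rho C1 t _ _ Hrho (W1 t) (Wr t)) as [A _].
    replace (phi t) with (C1 * phi t)%Cx by ring. rewrite A. ring. }
  assert (Epsi : forall t, psi t = Cconj (CofR (/ 2) * (w 1 t + (Ci * CofR (/ rho)) * w r t))%Cx).
  { intros t. destruct (E_split phi psi rho C1 t _ _ Hrho (W1 t) (Wr t)) as [_ A].
    rewrite <- A, Cconj_conj. ring. }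
  assert (D1 : forall t, is_deriv_C phi t (p t)).
  { intros t. eapply is_deriv_ext; [intros; symmetry; apply Ephi|].
    replace (p t) with (CofR (/ 2) * (ut 1 t + (- (Ci * CofR (/ rho))) * ut r t))%Cx by (unfold p; ring).
    apply is_deriv_scal. apply is_deriv_add; [apply Dt; auto|]. apply is_deriv_scal. apply Dt; auto. }
  assert (D2 : forall t, is_deriv_C psi t (Cconj (q t))).
  { intros t. eapply is_deriv_ext; [intros; symmetry; apply Epsi|].
    apply (is_deriv_conj (fun t => CofR (/ 2) * (w 1 t + (Ci * CofR (/ rho)) * w r t))%Cx).
    apply is_deriv_scal. apply is_deriv_add; [apply Dt; auto|]. apply is_deriv_scal. apply Dt; auto. }
  assert (X : forall t, p t = dphi a b nu c s phi psi t /\ Cconj (q t) = dpsi a b nu c s phi psi t).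
  { intros t. pose proof (HL 1 t H1) as L1. pose proof (HL r t Hr) as L2.
    unfold L_expr in L1, L2. rewrite Hur, Hw in L1, L2 by auto. rewrite Cpow_1 in L1. rewrite HP in L2.
    assert (U1 : ut 1 t = (p t + q t)%Cx) by (unfold p, q; apply Cx_ext; simpl; field; lra).
    assert (U2 : ut r t = (CofR rho * Ci * (p t - q t))%Cx) by (unfold p, q; apply Cx_ext; simpl; field; lra).
    rewrite U1 in L1. rewrite U2 in L2. clear U1 U2. set (x := p t) in *. set (y := q t) in *. clearbody x y.
    (* [X] and [Y] are the defects of the two equations. The radius [1] gives [X + Y = 0]; at the
       quarter-turn radius [conj (r^s)] has the opposite factor, which gives [X - Y = 0]. *)
    set (X := (lam * x - Ci * s * phi t + Ci * lam * CofR nu * phi t - c t * psi t)%Cx).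
    set (Y := (lam * y - Ci * Cconj s * Cconj (psi t) + Ci * lam * CofR nu * Cconj (psi t) - c t * Cconj (phi t))%Cx).
    assert (S1 : (X + Y)%Cx = C0) by (rewrite <- L1; unfold X, Y, E; cx).
    assert (S2 : (CofR rho * (Ci * (X - Y)))%Cx = C0) by (rewrite <- L2; unfold X, Y, E; cx).
    assert (S3 : (X - Y)%Cx = C0).
    { apply Cmul_eq0 in S2. destruct S2 as [S2|S2]; [apply CofR_neq0 in S2; [tauto|lra]|].
      apply Cmul_eq0 in S2. destruct S2 as [S2|S2]; auto. apply (f_equal Cim) in S2; simpl in S2; lra. }
    assert (X0 : X = C0) by (apply (f_equal Cre) in S1 as S1r; apply (f_equal Cim) in S1; apply (f_equal Cre) in S3 as S3r;
      apply (f_equal Cim) in S3; apply Cx_ext; simpl in *; lra).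
    assert (Y0 : Y = C0) by (apply (f_equal Cre) in S1 as S1r; apply (f_equal Cim) in S1; apply (f_equal Cre) in S3 as S3r;
      apply (f_equal Cim) in S3; apply Cx_ext; simpl in *; lra).
    pose proof (lam_neq0 a b a_pos) as N1. pose proof (lam_conj_neq0 a b a_pos) as N2. fold lam in N1, N2.
    split.
    - apply Csub_eq0. unfold dphi. fold lam. transitivity (X / lam)%Cx; [unfold X; field; auto|]. rewrite X0; field; auto.
    - apply Csub_eq0. unfold dpsi. fold lam. transitivity (Cconj Y / Cconj lam)%Cx; [|rewrite Y0; cx; unfold Rdiv; ring].
      unfold Y. replace (Cconj (lam * y - Ci * Cconj s * Cconj (psi t) + Ci * lam * CofR nu * Cconj (psi t) - c t * Cconj (phi t)))
        with (Cconj lam * Cconj y + Ci * s * psi t - Ci * Cconj lam * CofR nu * psi t - Cconj (c t) * phi t)%Cx by cx.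
      field; auto. }
  split; [split; [apply (is_deriv_Ccont _ _ D1)|auto]|].
  split; [split; [apply (is_deriv_Ccont _ _ D2)|auto]|].
  split; intros t; [rewrite <- (proj1 (X t))|rewrite <- (proj2 (X t))]; auto.
Qed.

(** A real power satisfies [r^s f = r^s (f/2) + conj (r^s conj (f/2))], which brings real exponents
    into the formalism of pairs. *)
Lemma eig_of_real w s f : L_solution lam nu c (fun r => 0 < r) w -> Cim s = 0 ->
  Pc f -> (forall r t, 0 < r -> w r t = (Cpow r s * f t)%Cx) ->
  eig a b nu c s (fun t => CofR (/ 2) * f t)%Cx (fun t => Cconj (CofR (/ 2) * f t)%Cx).
Proof.
  intros [_ [ur [ut [D [_ [_ [_ HL]]]]]]] Hs Pf Hw.
  set (phi := fun t => (CofR (/ 2) * f t)%Cx). set (psi := fun t => Cconj (phi t)).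
  assert (HwE : forall r t, 0 < r -> w r t = E phi psi (Cpow r s) t).
  { intros r t Hr. rewrite Hw by auto. rewrite Cpow_real by auto. unfold E, psi, phi. apply Cx_ext; simpl; field. }
  assert (Dr : forall r t, 0 < r -> is_deriv_C (fun x => w x t) r (ur r t)) by (intros; apply D; auto).
  pose proof (sol_radial w s phi psi ur Dr HwE) as Hur.
  assert (H1 : 0 < 1) by lra.
  assert (D1 : forall t, is_deriv_C phi t (CofR (/ 2) * ut 1 t)%Cx).
  { intros t. apply is_deriv_scal. apply is_deriv_ext with (fun x => w 1 x); [|apply D; auto].
    intros x. rewrite Hw by auto. rewrite Cpow_1. ring. }
  assert (X : forall t, (CofR (/ 2) * ut 1 t)%Cx = dphi a b nu c s phi psi t).
  { intros t. pose proof (HL 1 t H1) as L1. unfold L_expr in L1. rewrite Hur, HwE, Cpow_1 in L1 by auto.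
    assert (Ep : E phi psi C1 t = (phi t + phi t)%Cx) by (unfold E, psi; cx).
    assert (Eps : E phi psi (s * C1) t = (s * (phi t + phi t))%Cx).
    { unfold E, psi. apply Cx_ext; simpl; rewrite Hs; ring. }
    rewrite Ep, Eps in L1. unfold dphi. fold lam. unfold psi.
    pose proof (lam_neq0 a b a_pos) as N1. fold lam in N1. apply Csub_eq0.
    transitivity (CofR (/ 2) * (lam * ut 1 t - Ci * (s * (phi t + phi t)) + Ci * (lam * (CofR nu * (phi t + phi t)))
       - c t * Cconj (phi t + phi t)) / lam)%Cx; [|rewrite L1; field; auto].
    rewrite Cconj_add. replace (CofR (/ 2)) with (C1 / (C1 + C1))%Cx by (apply Cx_ext; simpl; field).
    field. split; auto. intros E0. apply (f_equal Cre) in E0. simpl in E0. lra. }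
  assert (Pphi : Pc phi) by (apply Pc_scal; auto).
  split; auto. split; [apply Pc_conj; auto|]. split; intros t.
  - fold psi. rewrite <- X. auto.
  - replace (dpsi a b nu c s phi (fun t => Cconj (CofR (/ 2) * f t)%Cx) t) with (Cconj (dphi a b nu c s phi psi t)).
    + apply (is_deriv_conj phi). rewrite <- X; auto.
    + unfold dphi, dpsi, psi. fold lam. fold (phi t). unfold Cdiv. rewrite Cconj_mul, Cconj_inv. f_equal.
      apply Cx_ext; simpl; rewrite ?Hs; ring.
Qed.

(** Common form of the two kinds of basic solutions; in the real case the two summands are equal
    halves. *)
Record item (w : R -> R -> Cx) (s : Cx) (j : Z) (phi psi : R -> Cx) : Prop := {
  item_eig : eig a b nu c s phi psi;
  item_w : forall r t, 0 < r -> w r t = E phi psi (Cpow r s) t;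
  item_neq0 : forall t, phi t <> C0;
  item_winding : winding phi j;
  item_nonreal : Cim s <> 0 -> forall t, Cnorm (psi t) < Cnorm (phi t);
  item_real : Cim s = 0 -> psi = fun t => Cconj (phi t) }.
Arguments item_eig {w s j phi psi}.
Arguments item_w {w s j phi psi}.
Arguments item_neq0 {w s j phi psi}.
Arguments item_winding {w s j phi psi}.
Arguments item_nonreal {w s j phi psi}.
Arguments item_real {w s j phi psi}.

Lemma basic_item w s j : basic_solution lam nu c w s j -> exists phi psi, item w s j phi psi.
Proof.
  intros [HL [_ [HN HR]]]. destruct (Req_dec (Cim s) 0) as [Hs|Hs].
  - destruct (HR Hs) as [f [Cf [Pf [Nf [Hw [th [Ct [Et Pt]]]]]]]].
    exists (fun t => CofR (/ 2) * f t)%Cx, (fun t => Cconj (CofR (/ 2) * f t)%Cx).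
    assert (N2 : CofR (/ 2) <> C0) by (apply CofR_neq0; lra).
    split; auto.
    + apply eig_of_real with w; auto. split; auto.
    + intros r t Hr. rewrite Hw by auto. rewrite Cpow_real by auto. unfold E. apply Cx_ext; simpl; field.
    + intros t H. apply Cmul_eq0 in H. destruct H; auto. apply (Nf t); auto.
    + exists th. split; auto. split; auto. intros t. rewrite Cnorm_mul, Cnorm_CofR, Rabs_pos_eq by lra.
      rewrite (Et t) at 1. rewrite CofR_mul. ring.
    + intros; contradiction.
  - destruct (HN Hs) as [phi [psi [Cp [Cq [Pp [Pq [Hlt [Hw Wd]]]]]]]].
    exists phi, psi. split; auto.
    + eapply eig_of_nonreal; eauto.
    + intros t H. specialize (Hlt t). rewrite H, Cnorm_C0 in Hlt. pose proof (Cnorm_ge0 (psi t)). lra.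
    + intros; contradiction.
Qed.

(** Equal exponents give proportional pairs by [eig_nonreal_simple]. Conjugate ones are excluded:
    exchanging the summands of the second pair would make it proportional to the first, with the
    inequality between the moduli reversed. *)
Lemma item_class_nonreal w s j phi psi w' s' j' phi' psi' :
  item w s j phi psi -> item w' s' j' phi' psi' -> Cim s <> 0 -> s' = s \/ s' = Cconj s ->
  j' = j /\ s' = s /\ exists k, k <> C0 /\ forall t, phi' t = (k * phi t)%Cx /\ psi' t = (k * psi t)%Cx.
Proof.
  intros I I' Hs Hc.
  assert (Hs' : Cim s' <> 0) by (destruct Hc; subst; simpl; lra).
  destruct Hc as [->|Hc].
  - destruct (eig_nonreal_simple a b nu c a_pos s phi psi phi' psi' Hs (item_eig I) (item_eig I')) as [k Hk].
    { apply (item_nonreal I); auto. }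
    assert (Nk : k <> C0).
    { intros ->. apply (item_neq0 I' 0). rewrite (proj1 (Hk 0)). ring. }
    split; [|split; eauto]. symmetry. apply (winding_scal phi phi' k); auto;
      [apply (item_neq0 I)|intros; apply Hk|apply (item_winding I)|apply (item_winding I')].
  - exfalso. pose proof (eig_star a b nu c _ _ _ (item_eig I')) as ES. rewrite Hc, Cconj_conj in ES.
    destruct (eig_nonreal_simple a b nu c a_pos s phi psi _ _ Hs (item_eig I) ES) as [k Hk].
    { apply (item_nonreal I); auto. }
    destruct (Hk 0) as [E1 E2]. apply (f_equal Cnorm) in E1, E2. rewrite Cnorm_conj, Cnorm_mul in E1, E2.
    pose proof (item_nonreal I Hs 0). pose proof (item_nonreal I' Hs' 0).
    pose proof (Cnorm_ge0 k). nra.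
Qed.

Lemma item_class_real w s j phi psi w' j' phi' psi' :
  item w s j phi psi -> item w' s j' phi' psi' -> Cim s = 0 -> j' = j.
Proof.
  intros I I' Hs. pose proof (item_eig I) as G. pose proof (item_eig I') as G'.
  rewrite (item_real I Hs) in G. rewrite (item_real I' Hs) in G'.
  destruct (eig_real_wronskian a b nu c a_pos s phi phi' Hs G G') as [A HA].
  symmetry. apply (winding_wronskian phi phi' A); auto;
    [apply (item_neq0 I)|apply (item_neq0 I')|apply (item_winding I)|apply (item_winding I')].
Qed.

Lemma item_E_inj w s j phi psi z : item w s j phi psi -> Cim s <> 0 ->
  (forall t, E phi psi z t = C0) -> z = C0.
Proof.
  intros I Hs H. specialize (H 0). unfold E in H.
  assert (E0 : (z * phi 0)%Cx = (- Cconj (z * psi 0))%Cx) by (apply Csub_eq0; rewrite <- H; ring).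
  apply (f_equal Cnorm) in E0. rewrite Cnorm_opp, Cnorm_conj, !Cnorm_mul in E0.
  pose proof (item_nonreal I Hs 0). pose proof (Cnorm_ge0 z). apply Cnorm_eq0. nra.
Qed.

(** For a real exponent [E phi psi z = 2 (Re z) phi] does not see the imaginary part of [z], hence
    the restriction to real coefficients. *)
Lemma item_E_real_inj w s j phi psi x : item w s j phi psi ->
  (forall t, E phi psi (CofR x) t = C0) -> x = 0.
Proof.
  intros I H. destruct (Req_dec (Cim s) 0) as [Hs|Hs].
  - specialize (H 0). unfold E in H. rewrite (item_real I Hs) in H.
    assert (E0 : (CofR (2 * x) * phi 0)%Cx = C0) by (rewrite <- H; cx).
    apply Cmul_eq0 in E0. destruct E0 as [E0|E0]; [|exfalso; apply (item_neq0 I 0); auto].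
    apply (f_equal Cre) in E0. simpl in E0. lra.
  - apply (item_E_inj _ _ _ _ _ _ I Hs) in H. apply (f_equal Cre) in H. exact H.
Qed.
End Items.
Arguments item_eig {a b nu c w s j phi psi}.
Arguments item_w {a b nu c w s j phi psi}.
Arguments item_class_nonreal {a b nu c} a_pos {w s j phi psi w' s' j' phi' psi'}.
Arguments item_class_real {a b nu c} a_pos {w s j phi psi w' j' phi' psi'}.
Arguments item_E_inj {a b nu c w s j phi psi z}.
Arguments item_E_real_inj {a b nu c w s j phi psi}.

(** * Finite linear systems *)

Definition lsum {A : Type} (f : A -> R) (l : list A) : R := fold_right (fun i acc => f i + acc) 0 l.

Lemma lsum_ext {A} (f g : A -> R) l : (forall i, In i l -> f i = g i) -> lsum f l = lsum g l.
Proof. induction l; simpl; intros H; [auto|]. rewrite H, IHl; auto. Qed.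

Lemma lsum_app {A} (f : A -> R) l l' : lsum f (l ++ l') = lsum f l + lsum f l'.
Proof. induction l; simpl; [ring|rewrite IHl; ring]. Qed.

Lemma lsum_middle {A} (f : A -> R) l1 l2 i : lsum f (l1 ++ i :: l2) = f i + lsum f (l1 ++ l2).
Proof. rewrite !lsum_app; simpl. ring. Qed.

Lemma lsum_comb {A} (f g : A -> R) k l : lsum (fun i => f i + k * g i) l = lsum f l + k * lsum g l.
Proof. induction l; simpl; [ring|rewrite IHl; ring]. Qed.

Lemma lsum_0 {A} (f : A -> R) l : (forall i, In i l -> f i = 0) -> lsum f l = 0.
Proof. induction l; simpl; intros H; [auto|]. rewrite H, IHl; auto. ring. Qed.

Lemma lsum_ge0 {A} (f : A -> R) l : (forall i, 0 <= f i) -> 0 <= lsum f l.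
Proof. intros H; induction l; simpl; [lra|]. specialize (H a). lra. Qed.

Lemma lsum_In_le {A} (f : A -> R) l i : (forall i, 0 <= f i) -> In i l -> f i <= lsum f l.
Proof.
  intros H; induction l; simpl; [tauto|]. pose proof (lsum_ge0 f l H). intros [->|Hi]; [lra|].
  specialize (IHl Hi). specialize (H a). lra.
Qed.

Lemma lsum_abs_le {A} (x m : A -> R) X l : (forall i, In i l -> Rabs (x i) <= X) ->
  Rabs (lsum (fun i => x i * m i) l) <= X * lsum (fun i => Rabs (m i)) l.
Proof.
  induction l; simpl; intros H; [rewrite Rabs_R0; lra|].
  eapply Rle_trans; [apply Rabs_triang|]. rewrite Rabs_mult, Rmult_plus_distr_l.
  apply Rplus_le_compat; auto. apply Rmult_le_compat_r; auto. apply Rabs_pos.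
Qed.

Section LinearSystems.
Context {A B : Type}.
Hypothesis A_dec : forall i j : A, {i = j} + {i <> j}.

Lemma NoDup_middle (l1 l2 : list A) i : NoDup (l1 ++ i :: l2) -> NoDup (l1 ++ l2) /\ ~ In i (l1 ++ l2).
Proof. intros H. split; [eapply NoDup_remove_1; eauto|eapply NoDup_remove_2; eauto]. Qed.

Definition extend (i0 : A) (x0 : R) (x : A -> R) (i : A) : R := if A_dec i i0 then x0 else x i.

Lemma extend_sum l i0 x0 x (m : A -> R) : ~ In i0 l ->
  lsum (fun i => extend i0 x0 x i * m i) l = lsum (fun i => x i * m i) l.
Proof.
  intros H. apply lsum_ext. intros i Hi. unfold extend. destruct (A_dec i i0); [subst; tauto|auto].
Qed.

Lemma linear_dependence (ks : list B) : forall (l : list A) (M : A -> B -> R), NoDup l -> (length ks < length l)%nat ->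
  exists x : A -> R, (exists i, In i l /\ x i <> 0) /\ forall k, In k ks -> lsum (fun i => x i * M i k) l = 0.
Proof.
  induction ks as [|k ks IH]; intros l M ND HL; simpl in HL.
  - destruct l as [|i l]; [simpl in HL; lia|]. exists (fun _ => 1). split; [exists i; split; [left; auto|lra]|].
    intros k [].
  - destruct (classic (exists i0, In i0 l /\ M i0 k <> 0)) as [[i0 [Hi Hp]]|Hno].
    + destruct (in_split _ _ Hi) as [l1 [l2 ->]]. destruct (NoDup_middle _ _ _ ND) as [ND' Nin].
      rewrite length_app in HL. simpl in HL.
      destruct (IH (l1 ++ l2) (fun i k' => M i k' + - (M i k / M i0 k * M i0 k')) ND') as [x [[i [Ii Xi]] Hx]].
      { rewrite length_app. lia. }
      exists (extend i0 (- lsum (fun i => x i * M i k) (l1 ++ l2) / M i0 k) x). split.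
      * exists i. split; [apply in_or_app; apply in_app_or in Ii; simpl; tauto|].
        unfold extend. destruct (A_dec i i0); [subst; tauto|auto].
      * intros k' Hk'. rewrite lsum_middle, extend_sum by auto. unfold extend at 1.
        destruct (A_dec i0 i0); [|tauto]. destruct Hk' as [<-|Hk']; [field; auto|].
        specialize (Hx k' Hk').
        rewrite (lsum_ext _ (fun i => x i * M i k' + (- (M i0 k' / M i0 k)) * (x i * M i k))) in Hx
          by (intros; field; auto).
        rewrite lsum_comb in Hx. rewrite <- Hx. field; auto.
    + destruct (IH l M ND ltac:(lia)) as [x [Nz Hx]]. exists x. split; auto. intros k' [<-|Hk']; auto.
      apply lsum_0. intros i Hi. destruct (Req_dec (M i k) 0) as [->|]; [ring|exfalso; apply Hno; eauto].
Qed.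

(** Gaussian elimination by induction on the equations, carrying a bound on the solution that is
    uniform in the right-hand side; injectivity provides the pivot. *)
Lemma linear_solve (ks : list B) : forall (l : list A) (M : A -> B -> R), NoDup l -> length l = length ks ->
  (forall x : A -> R, (forall k, In k ks -> lsum (fun i => x i * M i k) l = 0) -> forall i, In i l -> x i = 0) ->
  exists C, 0 <= C /\ forall (y : B -> R) Y, 0 <= Y -> (forall k, In k ks -> Rabs (y k) <= Y) ->
    exists x : A -> R, (forall k, In k ks -> lsum (fun i => x i * M i k) l = y k) /\
                       (forall i, In i l -> Rabs (x i) <= C * Y).
Proof.
  induction ks as [|k ks IH]; intros l M ND HL HI; simpl in HL.
  - destruct l; [|simpl in HL; lia]. exists 0. split; [lra|]. intros y Y HY _. exists (fun _ => 0).
    split; intros ? [].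
  - destruct (classic (exists i0, In i0 l /\ M i0 k <> 0)) as [[i0 [Hi Hp]]|Hno].
    + destruct (in_split _ _ Hi) as [l1 [l2 ->]]. destruct (NoDup_middle _ _ _ ND) as [ND' Nin].
      rewrite length_app in HL. simpl in HL.
      set (M' := fun i k' => M i k' + - (M i k / M i0 k * M i0 k')).
      assert (EM : forall x k', lsum (fun i => x i * M' i k') (l1 ++ l2) =
         lsum (fun i => x i * M i k') (l1 ++ l2) + - (M i0 k' / M i0 k) * lsum (fun i => x i * M i k) (l1 ++ l2)).
      { intros x k'. rewrite <- lsum_comb. apply lsum_ext. intros. unfold M'. field; auto. }
      destruct (IH (l1 ++ l2) M' ND') as [C' [HC' Sol]].
      { rewrite length_app. lia. }
      { intros x Hx i Hi'.
        assert (Nz : extend i0 (- lsum (fun i => x i * M i k) (l1 ++ l2) / M i0 k) x i = 0).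
        { apply HI; [|apply in_or_app; apply in_app_or in Hi'; simpl; tauto].
          intros k' Hk'. rewrite lsum_middle, extend_sum by auto. unfold extend at 1.
          destruct (A_dec i0 i0); [|tauto]. destruct Hk' as [<-|Hk']; [field; auto|].
          specialize (Hx k' Hk'). rewrite EM in Hx. rewrite <- Hx. field; auto. }
        unfold extend in Nz. destruct (A_dec i i0); [subst; tauto|auto]. }
      set (p := Rabs (M i0 k)). assert (Hpp : 0 < p) by (apply Rabs_pos_lt; auto).
      set (m := lsum (fun k' => Rabs (M i0 k')) ks).
      assert (Hm : 0 <= m) by (apply lsum_ge0; intros; apply Rabs_pos).
      set (n := lsum (fun i => Rabs (M i k)) (l1 ++ l2)).
      assert (Hn : 0 <= n) by (apply lsum_ge0; intros; apply Rabs_pos).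
      (* [1 + m / p] bounds the growth of the right-hand side under elimination, and
         [(1 + Q * n) / p] the pivot unknown recovered by back substitution. *)
      set (Q := C' * (1 + m / p)).
      assert (Hmp : 0 <= m / p) by (apply Rmult_le_pos; [auto|left; apply Rinv_0_lt_compat; auto]).
      assert (HQ : 0 <= Q) by (unfold Q; apply Rmult_le_pos; lra).
      exists (Q + (1 + Q * n) / p).
      assert (HQn : 0 <= (1 + Q * n) / p).
      { apply Rmult_le_pos; [|left; apply Rinv_0_lt_compat; auto]. assert (0 <= Q * n) by (apply Rmult_le_pos; auto). lra. }
      split; [lra|]. intros y Y HY Hy.
      destruct (Sol (fun k' => y k' + - (M i0 k' / M i0 k) * y k) (Y * (1 + m / p))) as [x [Ex Bx]].
      { apply Rmult_le_pos; lra. }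
      { intros k' Hk'. eapply Rle_trans; [apply Rabs_triang|].
        rewrite Rabs_mult, Rabs_Ropp. unfold Rdiv at 1. rewrite Rabs_mult, Rabs_inv. fold p.
        pose proof (Hy k (or_introl eq_refl)) as Y1. pose proof (Hy k' (or_intror Hk')) as Y2.
        assert (Rabs (M i0 k') <= m) by (apply (lsum_In_le (fun k' => Rabs (M i0 k'))); auto; intros; apply Rabs_pos).
        assert (Rabs (M i0 k') * / p <= m / p) by (apply Rmult_le_compat_r; auto; left; apply Rinv_0_lt_compat; auto).
        assert (Rabs (M i0 k') * / p * Rabs (y k) <= m / p * Y).
        { apply Rmult_le_compat; auto; [|apply Rabs_pos]. apply Rmult_le_pos; [apply Rabs_pos|left; apply Rinv_0_lt_compat; auto]. }
        lra. }
      assert (Bx' : forall i, In i (l1 ++ l2) -> Rabs (x i) <= Q * Y).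
      { intros i Hi'. eapply Rle_trans; [apply Bx; auto|]. unfold Q. right; ring. }
      set (S := lsum (fun i => x i * M i k) (l1 ++ l2)).
      exists (extend i0 ((y k - S) / M i0 k) x). split.
      * intros k' Hk'. rewrite lsum_middle, extend_sum by auto. unfold extend at 1.
        destruct (A_dec i0 i0); [|tauto]. destruct Hk' as [<-|Hk']; [fold S; field; auto|].
        specialize (Ex k' Hk'). rewrite EM in Ex. fold S in Ex.
        replace (lsum (fun i => x i * M i k') (l1 ++ l2))
          with (y k' + - (M i0 k' / M i0 k) * y k + M i0 k' / M i0 k * S) by lra. field; auto.
      * intros i Hi'. unfold extend. destruct (A_dec i i0) as [->|Ne].
        -- unfold Rdiv at 1. rewrite Rabs_mult, Rabs_inv. fold p.
           assert (Rabs (y k - S) <= (1 + Q * n) * Y).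
           { eapply Rle_trans; [apply Rabs_triang|]. rewrite Rabs_Ropp.
             pose proof (Hy k (or_introl eq_refl)). pose proof (lsum_abs_le x (fun i => M i k) (Q * Y) _ Bx').
             cbv beta in H0. fold S in H0. fold n in H0. lra. }
           apply (Rmult_le_compat_r (/ p)) in H; [|left; apply Rinv_0_lt_compat; auto].
           assert (0 <= Q * Y) by (apply Rmult_le_pos; auto). unfold Rdiv. lra.
        -- assert (In i (l1 ++ l2)).
           { apply in_or_app. apply in_app_or in Hi'. simpl in Hi'. intuition congruence. }
           specialize (Bx' i H). assert (0 <= (1 + Q * n) / p * Y) by (apply Rmult_le_pos; auto). lra.
    (* Without a pivot the equation [k] is void, which leaves fewer equations than unknowns and a
       nonzero kernel vector. *)
    + exfalso. destruct (linear_dependence ks l M ND ltac:(lia)) as [x [[i [Ii Nz]] Hx]]. apply Nz, HI; auto.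
      intros k' [<-|Hk']; auto. apply lsum_0. intros i' Hi'.
      destruct (Req_dec (M i' k) 0) as [->|]; [ring|exfalso; apply Hno; eauto].
Qed.
End LinearSystems.

(** * Finite complex sums and the low indices *)

Definition clsum {A : Type} (f : A -> Cx) (l : list A) : Cx := fold_right (fun i acc => f i + acc)%Cx C0 l.

Lemma clsum_ext {A} (f g : A -> Cx) l : (forall i, In i l -> f i = g i) -> clsum f l = clsum g l.
Proof. induction l; simpl; intros H; [auto|]. rewrite H, IHl; auto. Qed.

Lemma clsum_add {A} (f g : A -> Cx) l : clsum (fun i => f i + g i)%Cx l = (clsum f l + clsum g l)%Cx.
Proof. induction l; simpl; [ring|rewrite IHl; ring]. Qed.

Lemma clsum_mul {A} z (f : A -> Cx) l : clsum (fun i => z * f i)%Cx l = (z * clsum f l)%Cx.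
Proof. induction l; simpl; [ring|rewrite IHl; ring]. Qed.

Lemma clsum_0 {A} (f : A -> Cx) l : (forall i, In i l -> f i = C0) -> clsum f l = C0.
Proof. induction l; simpl; intros H; [auto|]. rewrite H, IHl; auto. ring. Qed.

Lemma clsum_single {A} (A_dec : forall i j : A, {i = j} + {i <> j}) (f : A -> Cx) l i0 : NoDup l -> In i0 l ->
  clsum (fun i => if A_dec i i0 then f i else C0) l = f i0.
Proof.
  induction l; simpl; [tauto|]. intros ND Hi. inversion ND; subst. destruct (A_dec a i0) as [->|Ne].
  - rewrite clsum_0; [ring|]. intros i Hi'. destruct (A_dec i i0); [subst; tauto|auto].
  - rewrite IHl; auto; [ring|]. destruct Hi; [congruence|auto].
Qed.

Fixpoint idx (N : nat) : list (Z * bool) :=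
  match N with
  | O => (0%Z, true) :: (0%Z, false) :: nil
  | S n => (Z.of_nat (S n), true) :: (Z.of_nat (S n), false) ::
           (- Z.of_nat (S n), true)%Z :: (- Z.of_nat (S n), false)%Z :: idx n
  end.

Lemma in_idx N j p : In (j, p) (idx N) <-> (Z.abs j <= Z.of_nat N)%Z.
Proof.
  induction N; cbn [idx In].
  - split.
    + intros [H|[H|[]]]; injection H; intros; lia.
    + intros H. replace j with 0%Z by lia. destruct p; auto.
  - rewrite IHN. split.
    + intros [H|[H|[H|[H|H]]]]; try (injection H; intros; lia). lia.
    + intros H. destruct (Z.eq_dec j (Z.of_nat (S N))) as [->|]; [destruct p; auto|].
      destruct (Z.eq_dec j (- Z.of_nat (S N))) as [->|]; [destruct p; auto|]. do 4 right. lia.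
Qed.

Lemma NoDup_idx N : NoDup (idx N).
Proof.
  induction N; cbn [idx].
  - repeat constructor; simpl; intuition congruence.
  - repeat constructor; auto; cbn [In]; rewrite ?in_idx; intros H;
      repeat (destruct H as [H|H]); try (injection H; intros); try lia; try congruence.
Qed.

Lemma clsum_symsum (f : Z * bool -> Cx) N : clsum f (idx N) = symsum (fun j => f (j, true) + f (j, false))%Cx N.
Proof.
  induction N; cbn [idx symsum clsum fold_right]; [ring|].
  change (fold_right (fun i acc => f i + acc)%Cx C0 (idx N)) with (clsum f (idx N)). rewrite IHN. ring.
Qed.

Lemma clsum_pair (f : Z * bool -> Cx) N j0 : (Z.abs j0 <= Z.of_nat N)%Z ->
  (forall i, fst i <> j0 -> f i = C0) -> clsum f (idx N) = (f (j0, true) + f (j0, false))%Cx.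
Proof.
  intros Hj H. rewrite clsum_symsum. rewrite (symsum_single _ j0); auto.
  intros j Hn. rewrite !H by auto. ring.
Qed.

Lemma pair_dec (i j : Z * bool) : {i = j} + {i <> j}.
Proof. decide equality; [apply Bool.bool_dec|apply Z.eq_dec]. Qed.

Lemma choice_fun {A B : Type} (P : A -> B -> Prop) : (forall x, exists y, P x y) -> exists f, forall x, P x (f x).
Proof.
  intros H. exists (fun x => proj1_sig (constructive_indefinite_description _ (H x))).
  intros x. apply (proj2_sig (constructive_indefinite_description _ (H x))).
Qed.

(** * Uniformity in the angle, ranges of radii, geometric series *)

(** Compactness of one period; periodicity extends the estimate to all angles. *)
Lemma cont2_uniform (dom : R -> Prop) g r : cont2_on dom g -> dom r ->
  (exists d, 0 < d /\ forall r', Rabs (r' - r) < d -> dom r') ->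
  (forall r', dom r' -> periodic2pi (g r')) ->
  forall eps, 0 < eps -> exists d, 0 < d /\ forall r', Rabs (r' - r) < d ->
    dom r' /\ forall t, Cnorm (g r' t - g r t)%Cx <= eps.
Proof.
  intros Hg Hr [d0 [Hd0 Ho]] Pg eps He.
  assert (HD : forall t, exists d : posreal, forall r' t', dom r' -> Rabs (r' - r) < d -> Rabs (t' - t) < d ->
    Cnorm (g r' t' - g r t)%Cx < eps / 2).
  { intros t. destruct (Hg r t Hr (eps / 2) ltac:(lra)) as [d [Hd H]]. exists (mkposreal d Hd). exact H. }
  apply choice_fun in HD. destruct HD as [de HD].
  destruct (compactness_value_1d 0 (2 * PI) de) as [d1 H1].
  exists (Rmin d0 d1). split; [apply Rmin_pos; auto; apply d1|]. intros r' Hr'.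
  pose proof (Rmin_l d0 d1). pose proof (Rmin_r d0 d1).
  assert (Dr' : dom r') by (apply Ho; lra). split; auto.
  intros t. destruct (period_reduce t) as [k [t0 [Ht ->]]].
  rewrite (periodic_Z (g r')), (periodic_Z (g r)) by auto.
  apply Rnot_lt_le. intros Hlt. apply (H1 t0); [lra|]. intros [t1 [Ht1 [Hc Hd]]].
  pose proof (HD t1 r' t0 Dr' ltac:(lra) Hc) as A. pose proof (HD t1 r t0 Hr) as B.
  rewrite Rminus_diag, Rabs_R0 in B. specialize (B (cond_pos (de t1)) Hc). rewrite Cnorm_subC in B.
  pose proof (Cnorm_add (g r' t0 - g r t1) (g r t1 - g r t0)) as C.
  replace (g r' t0 - g r t1 + (g r t1 - g r t0))%Cx with (g r' t0 - g r t0)%Cx in C by ring. lra.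
Qed.

(** Mean value theorem on real and imaginary parts, with half of [eps] for each. Uniformity in [t]
    lets sup-norm continuous functionals be differentiated in [r]. *)
Lemma diff_quotient_uniform (dom : R -> Prop) u ur r :
  (forall r t, dom r -> is_deriv_C (fun x => u x t) r (ur r t)) ->
  cont2_on dom ur -> dom r ->
  (exists d, 0 < d /\ forall r', Rabs (r' - r) < d -> dom r') ->
  (forall r', dom r' -> periodic2pi (ur r')) ->
  forall eps, 0 < eps -> exists d, 0 < d /\ forall h, h <> 0 -> Rabs h < d ->
    dom (r + h) /\ forall t, Cnorm (CofR (/ h) * (u (r + h)%R t - u r t) - ur r t)%Cx <= eps.
Proof.
  intros D Hu Hr Ho Pu eps He.
  destruct (cont2_uniform dom ur r Hu Hr Ho Pu (eps / 2) ltac:(lra)) as [d [Hd H]].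
  exists d. split; auto. intros h Hh Hhd. split; [apply H; replace (r + h - r) with h by ring; auto|]. intros t.
  assert (Hin : forall x, Rmin r (r + h) <= x <= Rmax r (r + h) -> Rabs (x - r) < d).
  { intros x Hx. eapply Rle_lt_trans; [|exact Hhd]. unfold Rmin, Rmax in Hx.
    destruct (Rle_dec r (r + h)); unfold Rabs; destruct (Rcase_abs (x - r)); destruct (Rcase_abs h); lra. }
  assert (G : forall p : Cx -> R, (forall x t, dom x -> derivable_pt_lim (fun x => p (u x t)) x (p (ur x t))) ->
     (forall z z', Rabs (p z - p z') <= Cnorm (z - z')%Cx) ->
     Rabs (/ h * (p (u (r + h)%R t) - p (u r t)) - p (ur r t)) <= eps / 2).
  { intros p Dp Lp. destruct (MVT_gen (fun x => p (u x t)) r (r + h) (fun x => p (ur x t))) as [x [Hx E0]].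
    - intros x Hx. apply is_derive_Reals, Dp. apply H, Hin. lra.
    - intros x Hx. apply derivable_continuous_pt. exists (p (ur x t)). apply Dp. apply H, Hin. auto.
    - rewrite E0. replace (/ h * (p (ur x t) * (r + h - r)) - p (ur r t)) with (p (ur x t) - p (ur r t)) by (field; auto).
      eapply Rle_trans; [apply Lp|]. apply H, Hin; auto. }
  eapply Rle_trans; [apply Cnorm_le_sum|].
  pose proof (G Cre (fun x t Hx => proj1 (D x t Hx)) (fun z z' => Cre_le_norm (z - z'))) as G1.
  pose proof (G Cim (fun x t Hx => proj2 (D x t Hx)) (fun z z' => Cim_le_norm (z - z'))) as G2.
  assert (E1 : Cre (CofR (/ h) * (u (r + h)%R t - u r t) - ur r t)%Cx = / h * (Cre (u (r + h)%R t) - Cre (u r t)) - Cre (ur r t))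
    by (simpl; ring).
  assert (E2 : Cim (CofR (/ h) * (u (r + h)%R t - u r t) - ur r t)%Cx = / h * (Cim (u (r + h)%R t) - Cim (u r t)) - Cim (ur r t))
    by (simpl; ring).
  rewrite E1, E2. lra.
Qed.

Lemma in_range_open delta Rmax r : in_range delta Rmax r ->
  exists d, 0 < d /\ forall r', Rabs (r' - r) < d -> in_range delta Rmax r'.
Proof.
  intros [H1 H2]. destruct Rmax as [m|].
  - exists (Rmin (r - delta) (m - r)). split; [apply Rmin_pos; lra|]. intros r' Hr.
    pose proof (Rmin_l (r - delta) (m - r)). pose proof (Rmin_r (r - delta) (m - r)).
    apply Rabs_def2 in Hr. split; lra.
  - exists (r - delta). split; [lra|]. intros r' Hr. apply Rabs_def2 in Hr. split; [lra|auto].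
Qed.

Lemma in_range_convex delta Rmax r r' x : in_range delta Rmax r -> in_range delta Rmax r' -> r <= x <= r' ->
  in_range delta Rmax x.
Proof. intros [H1 H2] [H3 H4] Hx. destruct Rmax; split; auto; lra. Qed.

Lemma in_range_nonempty delta Rmax : below_max delta Rmax -> exists r, in_range delta Rmax r.
Proof.
  destruct Rmax as [m|]; simpl; intros H; [exists ((delta + m) / 2)|exists (delta + 1)]; split; simpl; auto; lra.
Qed.

Lemma summable_geometric q : 0 <= q < 1 -> summable (fun j => q ^ Z.abs_nat j).
Proof.
  intros Hq. split; [intros; apply pow_le; lra|]. exists ((1 + q) / (1 - q)). intros N.
  assert (H : rsum (fun j => q ^ Z.abs_nat j) N <= (1 + q) / (1 - q) - 2 * q ^ S N / (1 - q)).
  { induction N; cbn [rsum].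
    - simpl. right. field. lra.
    - replace (Z.abs_nat (- Z.of_nat (S N))) with (S N) by lia. rewrite Zabs2Nat.id.
      eapply Rle_trans; [apply Rplus_le_compat_r, Rplus_le_compat_r, IHN|]. right. cbn [pow]. field. lra. }
  assert (0 <= 2 * q ^ S N / (1 - q)).
  { apply Rmult_le_pos; [|left; apply Rinv_0_lt_compat; lra]. pose proof (pow_le q (S N) (proj1 Hq)). lra. }
  lra.
Qed.

Lemma exp_mul_INR x n : exp (INR n * x) = exp x ^ n.
Proof.
  induction n; [simpl; rewrite Rmult_0_l; apply exp_0|]. rewrite S_INR. cbn [pow]. rewrite <- IHn, <- exp_plus. f_equal. ring.
Qed.

(** * The tail of the family as a perturbation of the exponentials *)

Section Tail.
Variables (a b nu : R) (c : R -> Cx).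
Hypothesis a_pos : 0 < a.
Hypothesis c_Pc : Pc c.
Variables (w : Z * bool -> R -> R -> Cx) (sg : Z * bool -> Cx) (ph ps : Z * bool -> R -> Cx).
Variables (N0 : nat) (K be : R).
Hypothesis items : forall i, item a b nu c (w i) (sg i) (fst i) (ph i) (ps i).
Local Notation s j := (sg (j, true)).
Local Notation phi j := (ph (j, true)).
Local Notation psi j := (ps (j, true)).

Lemma items_eig i : eig a b nu c (sg i) (ph i) (ps i).
Proof. exact (item_eig (items i)). Qed.

Lemma phi_eig j : eig a b nu c (s j) (phi j) (psi j).
Proof. apply items_eig. Qed.

Hypothesis N0_pos : (1 <= N0)%nat.
Hypothesis K_pos : 0 < K.
Hypothesis be_pos : 0 < be.
Hypothesis N0_large : 768 * K ^ 2 <= INR N0.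

Definition tl (j : Z) : bool := (Z.of_nat N0 <? Z.abs j)%Z.

Hypothesis phi_near : forall j t, tl j = true -> Cnorm (phi j t - en j t)%Cx <= K / Rabs (IZR j).
Hypothesis psi_small : forall j t, tl j = true -> Cnorm (psi j t) <= K / Rabs (IZR j).
Hypothesis s_large : forall j, tl j = true -> be * Rabs (IZR j) <= Rabs (Cim (s j)).

Lemma tl_abs j : tl j = true -> INR N0 + 1 <= Rabs (IZR j).
Proof.
  unfold tl. intros H. apply Z.ltb_lt in H. rewrite Rabs_Zabs, INR_IZR_INZ, <- plus_IZR. apply IZR_le. lia.
Qed.

Lemma INR_N0 : 1 <= INR N0.
Proof. apply (le_INR 1); auto. Qed.

Definition wt (j : Z) : R := if tl j then 2 * K / Rabs (IZR j) else 0.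

Lemma wt_ge0 j : 0 <= wt j.
Proof.
  unfold wt. destruct (tl j) eqn:T; [|lra]. apply tl_abs in T. pose proof INR_N0.
  left; apply Rdiv_lt_0_compat; lra.
Qed.

(** Since [|j| > N0], [2 K / |j| <= 4 K / (N0 + |j|)], so the sum is at most [16 K^2 * 3 / N0]. The
    constant [768 = 16 * 48] in [N0_large] brings this below [1/16]. *)
Lemma wt_sqr N : rsum (fun j => wt j ^ 2) N <= / 16.
Proof.
  pose proof INR_N0 as HN.
  apply Rle_trans with (rsum (fun j => (4 * K) ^ 2 * (/ (INR N0 + Rabs (IZR j))) ^ 2) N).
  - apply rsum_le. intros j _. unfold wt. destruct (tl j) eqn:T.
    + apply tl_abs in T. set (x := Rabs (IZR j)) in *. rewrite <- Rpow_mult_distr.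
      apply pow_incr. split; [left; apply Rdiv_lt_0_compat; lra|].
      apply Rmult_le_reg_l with (x * (INR N0 + x)); [apply Rmult_lt_0_compat; lra|].
      replace (x * (INR N0 + x) * (2 * K / x)) with (2 * K * (INR N0 + x)) by (field; lra).
      replace (x * (INR N0 + x) * (4 * K * / (INR N0 + x))) with (4 * K * x) by (field; lra). nra.
    + rewrite pow_i by lia. apply Rmult_le_pos; apply pow2_ge_0.
  - rewrite rsum_scal. pose proof (rsum_inv_sqr_shift (INR N0) N HN) as H.
    apply (Rmult_le_compat_l ((4 * K) ^ 2)) in H; [|apply pow2_ge_0].
    eapply Rle_trans; [exact H|]. apply Rmult_le_reg_l with (INR N0); [lra|].
    replace (INR N0 * ((4 * K) ^ 2 * (3 / INR N0))) with (48 * K ^ 2) by (field; lra). lra.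
Qed.

Definition Kt (al : Z -> Cx) (j : Z) (t : R) : Cx :=
  if tl j then (al j * (phi j t - en j t) + Cconj (al j * psi j t))%Cx else C0.

(** [v + K0 v] stands for the series of [v] with each tail term [F v j * en j] replaced by
    [E (phi j) (psi j) (F v j)]. The defects are O(1/j) against l2 coefficients, so [K0 v] is
    defined even where the Fourier series of [v] diverges. *)
Definition K0 (v : R -> Cx) (t : R) : Cx := zsum (fun j => Kt (F v) j t).

Lemma Kt_le al j t : Cnorm (Kt al j t) <= Cnorm (al j) * wt j.
Proof.
  unfold Kt, wt. destruct (tl j) eqn:T; [|rewrite Cnorm_C0, Rmult_0_r; lra].
  eapply Rle_trans; [apply Cnorm_add|]. rewrite Cnorm_conj, !Cnorm_mul.
  pose proof (phi_near j t T). pose proof (psi_small j t T). pose proof (Cnorm_ge0 (al j)).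
  replace (2 * K / Rabs (IZR j)) with (K / Rabs (IZR j) + K / Rabs (IZR j)) by (unfold Rdiv; ring). nra.
Qed.

Lemma Kt_Pc al j : Pc (Kt al j).
Proof.
  unfold Kt. destruct (tl j); [|apply Pc_const]. destruct (phi_eig j) as [A [B _]].
  apply Pc_add; [apply Pc_scal, Pc_sub; auto; apply Pc_en|].
  apply (Pc_conj (fun t => al j * psi j t)%Cx). apply Pc_scal; auto.
Qed.

Lemma Kt_summable v : Pc v -> summable (fun j => Cnorm (F v j) * wt j).
Proof. intros H. eapply summable_F_weighted; eauto using wt_ge0, wt_sqr. Qed.

Lemma K0_Pc v : Pc v -> Pc (K0 v).
Proof.
  intros H. apply (zsum_Pc (Kt (F v)) (fun j => Cnorm (F v j) * wt j)); auto using Kt_Pc, Kt_summable.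
  intros; apply Kt_le.
Qed.

(** Young's parameter [/ 4] is the square root of the bound [/ 16] on the weights. *)
Lemma K0_bound v M : Pc v -> 0 < M -> (forall t, Cnorm (v t) <= M) -> forall t, Cnorm (K0 v t) <= M / 4.
Proof.
  intros H HM Hv t. eapply zsum_bound; [apply (Kt_summable v H)|intros; apply Kt_le|].
  intros N. eapply Rle_trans; [apply (bessel_weighted v M wt (/ 16) (/ 4) N); auto using wt_sqr; lra|]. lra.
Qed.

Lemma K0_ext v v' : (forall t, v t = v' t) -> forall t, K0 v t = K0 v' t.
Proof.
  intros H t. apply zsum_ext. intros j. unfold Kt. rewrite (F_ext v v' j H). reflexivity.
Qed.

Lemma K0_add v v' : Pc v -> Pc v' -> forall t, K0 (fun t => v t + v' t)%Cx t = (K0 v t + K0 v' t)%Cx.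
Proof.
  intros H H' t. unfold K0. rewrite <- (zsum_add _ _ _ _ (Kt_summable v H) (Kt_summable v' H'))
    by (intros; apply Kt_le).
  apply zsum_ext. intros j. unfold Kt. destruct (tl j); [|ring]. rewrite F_add by auto. cx.
Qed.

Lemma K0_real x v : Pc v -> forall t, K0 (fun t => CofR x * v t)%Cx t = (CofR x * K0 v t)%Cx.
Proof.
  intros H t. unfold K0. rewrite <- (zsum_mul (CofR x) _ _ (Kt_summable v H)) by (intros; apply Kt_le).
  apply zsum_ext. intros j. unfold Kt. destruct (tl j); [|ring]. rewrite F_scal by auto. cx.
Qed.

Lemma K0_zero t : K0 (fun _ => C0) t = C0.
Proof.
  unfold K0. rewrite (zsum_ext _ (fun _ => C0)).
  - apply (zsum_single (fun _ => C0) 0%Z); auto.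
  - intros j. unfold Kt. rewrite F_zero. destruct (tl j); cx.
Qed.

Lemma K0_inj v : Pc v -> (forall t, (v t + K0 v t)%Cx = C0) -> forall t, v t = C0.
Proof.
  intros H HE. apply contraction_zero; auto. intros M HM Hv t.
  pose proof (K0_bound v M H HM Hv t) as B. replace (v t) with (- K0 v t)%Cx.
  - rewrite Cnorm_opp. lra.
  - apply Csub_eq0. transitivity (- (v t + K0 v t))%Cx; [ring|]. rewrite HE. ring.
Qed.

(** * Inversion of [1 + K0] by a Neumann series *)

Fixpoint neumann_term (u : R -> Cx) (m : nat) : R -> Cx :=
  match m with
  | O => u
  | S n => fun t => (- K0 (neumann_term u n) t)%Cx
  end.

Lemma neumann_Pc u m : Pc u -> Pc (neumann_term u m).
Proof.
  intros H; induction m; simpl; auto. apply Pc_ext with (fun t => CofR (-1) * K0 (neumann_term u m) t)%Cx.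
  - intros; cx.
  - apply Pc_scal, K0_Pc; auto.
Qed.

Lemma neumann_bound u M m : Pc u -> 0 < M -> (forall t, Cnorm (u t) <= M) ->
  forall t, Cnorm (neumann_term u m t) <= M * (/ 4) ^ m.
Proof.
  intros H HM Hu; induction m; intros t; simpl; [rewrite Rmult_1_r; auto|]. rewrite Cnorm_opp.
  replace (M * (/ 4 * (/ 4) ^ m)) with (M * (/ 4) ^ m / 4) by field.
  apply K0_bound; auto using neumann_Pc. apply Rmult_lt_0_compat; auto. apply pow_lt; lra.
Qed.

Lemma one_plus_K0_surj u M : Pc u -> 0 < M -> (forall t, Cnorm (u t) <= M) ->
  exists v, Pc v /\ (forall t, Cnorm (v t) <= 2 * M) /\ forall t, (v t + K0 v t)%Cx = u t.
Proof.
  intros H HM Hu.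
  (* The series over the naturals is placed on Z, with zeros at negative ranks, to reuse [zsum]. The
     two-sided majorant sums to [5/3] of [M], still below [2 M]. *)
  set (f := fun j t => if (j <? 0)%Z then C0 else neumann_term u (Z.to_nat j) t).
  set (bb := fun j : Z => M * (/ 4) ^ Z.abs_nat j).
  assert (Pf : forall j, Pc (f j)).
  { intros j. unfold f. destruct (j <? 0)%Z; [apply Pc_const|apply neumann_Pc; auto]. }
  assert (Hf : forall j t, Cnorm (f j t) <= bb j).
  { intros j t. unfold f, bb. assert (0 < (/ 4) ^ Z.abs_nat j) by (apply pow_lt; lra).
    destruct (j <? 0)%Z eqn:L; [rewrite Cnorm_C0; nra|]. apply Z.ltb_ge in L.
    replace (Z.abs_nat j) with (Z.to_nat j) by lia. apply neumann_bound; auto. }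
  assert (Hb : forall N, rsum bb N <= M * (5 / 3 - 2 / 3 * (/ 4) ^ N)).
  { induction N; [unfold bb; simpl; lra|]. cbn [rsum]. unfold bb at 2 3.
    replace (Z.abs_nat (- Z.of_nat (S N))) with (S N) by lia. rewrite Zabs2Nat.id. cbn [pow]. set (y := (/ 4) ^ N) in *. lra. }
  assert (Hb' : forall N, rsum bb N <= 2 * M).
  { intros N. eapply Rle_trans; [apply Hb|]. assert (0 < (/ 4) ^ N) by (apply pow_lt; lra). nra. }
  assert (Sb : summable bb).
  { split; [|exists (2 * M); auto]. intros j. unfold bb. apply Rmult_le_pos; [lra|]. apply pow_le; lra. }
  set (v := fun t => zsum (fun j => f j t)).
  assert (Pv : Pc v) by (apply (zsum_Pc f bb); auto).
  exists v. split; auto. split; [intros t; apply zsum_bound with bb; auto|].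
  set (p := fun N t => symsum (fun j => f j t) N).
  assert (Pp : forall N, Pc (p N)) by (intros; apply symsum_Pc; auto).
  assert (Hp : forall N t, (p N t + K0 (p N) t)%Cx = (u t - neumann_term u (S N) t)%Cx).
  { induction N; intros t.
    - assert (E0 : forall x, p 0%nat x = u x) by reflexivity. rewrite (K0_ext _ _ E0), E0. simpl. ring.
    - assert (Ep : forall x, p (S N) x = (p N x + neumann_term u (S N) x)%Cx).
      { intros x. unfold p. cbn [symsum].
        assert (F1 : f (Z.of_nat (S N)) x = neumann_term u (S N) x).
        { unfold f. rewrite (proj2 (Z.ltb_ge _ _)) by lia. rewrite Nat2Z.id. reflexivity. }
        assert (F2 : f (- Z.of_nat (S N))%Z x = C0).
        { unfold f. rewrite (proj2 (Z.ltb_lt _ _)) by lia. reflexivity. }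
        rewrite F1, F2. ring. }
      rewrite (K0_ext _ _ Ep), (K0_add (p N)), Ep by auto using neumann_Pc.
      transitivity ((p N t + K0 (p N) t) + neumann_term u (S N) t + K0 (neumann_term u (S N)) t)%Cx; [ring|].
      rewrite IHN. change (neumann_term u (S (S N)) t) with (- K0 (neumann_term u (S N)) t)%Cx. ring. }
  (* Three errors at one rank: the remainder of [v], its image under [K0], and the last Neumann
     term, which is the exact residue of the partial sum. *)
  intros t. apply Csub_eq0, Csmall_eq0. intros eps He.
  destruct (zsum_uniform bb Sb (eps / 4) ltac:(lra)) as [N1 A1].
  destruct (pow_lt_1_zero (/ 4)) with (y := eps / (4 * M)) as [N2 A2].
  { rewrite Rabs_pos_eq; lra. } { apply Rdiv_lt_0_compat; lra. }
  set (N := (N1 + N2)%nat). specialize (A2 (S N) ltac:(unfold N; lia)).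
  rewrite Rabs_pos_eq in A2 by (apply pow_le; lra).
  assert (B1 : forall x, Cnorm (v x - p N x)%Cx <= eps / 4) by (intros; apply A1; auto; unfold N; lia).
  set (e := fun x => (v x + CofR (-1) * p N x)%Cx).
  assert (Pe : Pc e) by (apply Pc_add; auto; apply Pc_scal; auto).
  assert (Be : forall x, Cnorm (e x) <= eps / 4)
    by (intros x; replace (e x) with (v x - p N x)%Cx by (unfold e; cx); auto).
  pose proof (K0_bound e (eps / 4) Pe ltac:(lra) Be t) as B2.
  assert (EK : K0 e t = (K0 v t - K0 (p N) t)%Cx).
  { unfold e. rewrite (K0_add v) by (auto using Pc_scal). rewrite K0_real by auto. cx. }
  rewrite EK in B2.
  pose proof (neumann_bound u M (S N) H HM Hu t) as B3.
  apply (Rmult_lt_compat_l M) in A2; auto. replace (M * (eps / (4 * M))) with (eps / 4) in A2 by (field; lra).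
  replace (v t + K0 v t - u t)%Cx
    with ((v t - p N t) + (K0 v t - K0 (p N) t) + ((p N t + K0 (p N) t) - u t))%Cx by ring.
  rewrite Hp. replace (u t - neumann_term u (S N) t - u t)%Cx with (- neumann_term u (S N) t)%Cx by ring.
  eapply Rle_trans; [apply Cnorm_add|]. rewrite Cnorm_opp.
  pose proof (Cnorm_add (v t - p N t) (K0 v t - K0 (p N) t)). specialize (B1 t). lra.
Qed.

(** * The resolvent on the tail *)

Definition wt' (j : Z) : R := if tl j then / (be * Rabs (IZR j)) else 0.

Lemma wt'_eq j : wt' j = / (2 * K * be) * wt j.
Proof.
  unfold wt', wt. destruct (tl j) eqn:T; [|ring]. apply tl_abs in T. pose proof INR_N0. field; lra.
Qed.

Lemma tl_s_neq tau j : tl j = true -> (CofR tau - s j)%Cx <> C0.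
Proof.
  intros T H. apply (f_equal Cim) in H. simpl in H. pose proof (s_large j T). apply tl_abs in T. pose proof INR_N0.
  assert (Cim (s j) = 0) by lra. rewrite H2, Rabs_R0 in H0. nra.
Qed.

Lemma tl_s_norm tau j : tl j = true -> Cnorm (/ (CofR tau - s j))%Cx <= wt' j.
Proof.
  intros T. rewrite Cnorm_inv by (apply tl_s_neq; auto). unfold wt'. rewrite T.
  pose proof (s_large j T). apply tl_abs in T. pose proof INR_N0. apply Rinv_le_contravar.
  - apply Rmult_lt_0_compat; lra.
  - eapply Rle_trans; [exact H|]. pose proof (Cim_le_norm (CofR tau - s j)) as B. simpl in B.
    replace (Rabs (0 + - Cim (s j))) with (Rabs (Cim (s j))) in B; auto.
    rewrite Rplus_0_l, Rabs_Ropp; auto.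
Qed.

(** With summable coefficients the encoding is literal: [v + K0 v] is the sum of the tail
    eigenfunctions. *)
Lemma tail_sum al bd : summable bd -> (forall j, Cnorm (al j) <= bd j) -> (forall j, tl j = false -> al j = C0) ->
  let v := fun t => zsum (fun j => al j * en j t)%Cx in
  Pc v /\ (forall j, F v j = al j) /\
  (forall t, (v t + K0 v t)%Cx = zsum (fun j => if tl j then E (phi j) (psi j) (al j) t else C0)).
Proof.
  intros Sb Hal Hlow v. assert (Pv : Pc v) by (eapply trig_Pc; eauto).
  assert (Fv : forall j, F v j = al j) by (intros; eapply trig_F; eauto).
  split; auto. split; auto. intros t. unfold K0, v at 1.
  rewrite <- (zsum_add (fun j => al j * en j t)%Cx (fun j => Kt (F v) j t) bd (fun j => Cnorm (F v j) * wt j)); auto.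
  - apply zsum_ext. intros j. unfold Kt. rewrite Fv. destruct (tl j) eqn:T; [unfold E; ring|]. rewrite Hlow by auto. ring.
  - apply Kt_summable; auto.
  - intros j. rewrite Cnorm_mul, Cnorm_en, Rmult_1_r; auto.
  - intros; apply Kt_le.
Qed.

Lemma tail_E_le j z t : tl j = true -> Cnorm (E (phi j) (psi j) z t) <= (1 + 2 * K) * Cnorm z.
Proof.
  intros T. unfold E. eapply Rle_trans; [apply Cnorm_add|]. rewrite Cnorm_conj, !Cnorm_mul.
  pose proof (phi_near j t T) as P1. pose proof (psi_small j t T) as P2. apply tl_abs in T. pose proof INR_N0.
  assert (K / Rabs (IZR j) <= K).
  { apply Rmult_le_reg_l with (Rabs (IZR j)); [lra|]. replace (Rabs (IZR j) * (K / Rabs (IZR j))) with K by (field; lra). nra. }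
  pose proof (Cnorm_add (phi j t - en j t) (en j t)) as P3. rewrite Cnorm_en in P3.
  replace (phi j t - en j t + en j t)%Cx with (phi j t) in P3 by ring. pose proof (Cnorm_ge0 z). nra.
Qed.

(** Dividing by [tau - s j], of size at least [be |j|], makes the l2 coefficients of [v] absolutely
    summable. The eigenfunction series of [v'] then converges uniformly and the weak equation can be
    checked term by term. *)
Lemma tail_resolvent tau v : Pc v -> (forall j, tl j = false -> F v j = C0) ->
  exists v', Pc v' /\ (forall j, tl j = false -> F v' j = C0) /\
    (forall j, tl j = true -> F v' j = (F v j / (CofR tau - s j))%Cx) /\
    weak a b nu c tau (fun t => v' t + K0 v' t)%Cx (fun t => v t + K0 v t)%Cx.
Proof.
  intros Pv Hlow. set (al := fun j => if tl j then (F v j / (CofR tau - s j))%Cx else C0).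
  set (bd := fun j => Cnorm (F v j) * wt' j).
  assert (Sb : summable bd).
  { assert (0 < / (2 * K * be)) by (apply Rinv_0_lt_compat; repeat apply Rmult_lt_0_compat; lra).
    apply summable_le with (fun j => / (2 * K * be) * (Cnorm (F v j) * wt j)).
    - intros j. unfold bd. rewrite wt'_eq. pose proof (wt_ge0 j). pose proof (Cnorm_ge0 (F v j)). split; [|right; ring].
      repeat apply Rmult_le_pos; lra.
    - apply summable_scal; [lra|]. apply Kt_summable; auto. }
  assert (Hal : forall j, Cnorm (al j) <= bd j).
  { intros j. unfold al, bd. destruct (tl j) eqn:T.
    - unfold Cdiv. rewrite Cnorm_mul. apply Rmult_le_compat_l; [apply Cnorm_ge0|]. apply tl_s_norm; auto.
    - rewrite Cnorm_C0. unfold wt'. rewrite T. lra. }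
  assert (Hal0 : forall j, tl j = false -> al j = C0) by (intros j T; unfold al; rewrite T; auto).
  destruct (tail_sum al bd Sb Hal Hal0) as [Pv' [Fv' Ev']].
  set (v' := fun t => zsum (fun j => al j * en j t)%Cx) in *.
  exists v'. split; auto. split; [intros; rewrite Fv'; auto|].
  split; [intros j T; rewrite Fv'; unfold al; rewrite T; auto|].
  set (G := fun j t => if tl j then E (phi j) (psi j) (al j) t else C0).
  set (H := fun j t => if tl j then E (phi j) (psi j) (F v j) t else C0).
  assert (PG : forall j, Pc (G j)).
  { intros j. unfold G. destruct (tl j); [eapply eig_Pc; apply phi_eig|apply Pc_const]. }
  set (bG := fun j => (1 + 2 * K) * bd j).
  assert (SG : summable bG) by (apply summable_scal; auto; lra).
  assert (HG : forall j t, Cnorm (G j t) <= bG j).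
  { intros j t. unfold G, bG. destruct (tl j) eqn:T.
    - eapply Rle_trans; [apply tail_E_le; auto|]. apply Rmult_le_compat_l; [lra|auto].
    - rewrite Cnorm_C0. apply Rmult_le_pos; [lra|]. apply Sb. }
  apply weak_ext with (u := fun t => zsum (fun j => G j t)) (f := fun t => (v t + K0 v t)%Cx);
    [intros; symmetry; apply Ev'|auto|].
  intros n. set (X := (CofR tau - mkC a b * CofR (IZR n + nu))%Cx).
  destruct (Pc_bounded c c_Pc) as [Mc [HMc Bc]].
  set (G' := fun j t => (Ci * (c t * Cconj (G j t)))%Cx).
  assert (HG' : forall j t, Cnorm (G' j t) <= Mc * bG j).
  { intros j t. unfold G'. rewrite !Cnorm_mul, Cnorm_Ci, Cnorm_conj, Rmult_1_l.
    apply Rmult_le_compat; auto; apply Cnorm_ge0. }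
  assert (SG' : summable (fun j => Mc * bG j)) by (apply summable_scal; auto; lra).
  assert (PG' : forall j, Pc (G' j)) by (intros; apply Pc_cu; auto).
  assert (EG' : forall t, zsum (fun j => G' j t) = (Ci * (c t * Cconj (zsum (fun j => G j t))))%Cx).
  { intros t. apply zsum_eq with (fun j => Mc * bG j); auto.
    apply ccv_ext with (fun N => Ci * (c t * Cconj (symsum (fun j => G j t) N)))%Cx.
    - intros N. rewrite <- symsum_conj, <- !symsum_mul. reflexivity.
    - apply ccv_mul, ccv_mul, ccv_conj. apply symsum_ccv_zsum with bG; auto. }
  pose proof (zsum_F_ccv G bG PG SG HG n) as L1.
  pose proof (zsum_F_ccv G' _ PG' SG' HG' n) as L2. rewrite (F_ext _ _ n EG') in L2.
  pose proof (zsum_F_ccv (Kt (F v)) _ (Kt_Pc (F v)) (Kt_summable v Pv) (fun j t => Kt_le _ j t) n) as L3.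
  fold (K0 v) in L3.
  assert (Term : forall j, (X * F (G j) n + (- C1) * F (G' j) n)%Cx = F (H j) n).
  { intros j. unfold G', H, G. destruct (tl j) eqn:T.
    - pose proof (weak_E a b nu c a_pos c_Pc (s j) (phi j) (psi j) tau (al j) (phi_eig j) n) as W.
      replace ((CofR tau - s j) * al j)%Cx with (F v j) in W
        by (unfold al; rewrite T; field; apply tl_s_neq; auto).
      etransitivity; [|exact W]. fold X.
      change (F (fun t : R => E (phi j) (psi j) (al j) t) n) with (F (E (phi j) (psi j) (al j)) n). ring.
    - rewrite (F_ext (fun t => Ci * (c t * Cconj C0))%Cx (fun _ => C0)) by (intros; cx). rewrite F_zero. ring. }
  (* The series of the [H j] need not converge pointwise, but its [n]-th coefficients do: [H j] is
     [Kt (F v) j] plus [F v j * en j], and the latter counts only for [j = n]. *)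
  assert (Term2 : forall j, F (H j) n = (F (Kt (F v) j) n + (if Z.eq_dec j n then F v n else C0))%Cx).
  { intros j. unfold H, Kt. destruct (tl j) eqn:T.
    - rewrite (F_ext _ (fun t => (F v j * (phi j t - en j t) + Cconj (F v j * psi j t)) + F v j * en j t)%Cx)
        by (intros; unfold E; ring).
      destruct (phi_eig j) as [A [B _]].
      rewrite F_add, (F_scal _ (en j)), F_en; auto using Pc_en, Pc_scal.
      + destruct (Z.eq_dec j n); subst; ring.
      + apply Pc_add; [apply Pc_scal, Pc_sub; auto using Pc_en|].
        apply (Pc_conj (fun t => F v j * psi j t)%Cx). apply Pc_scal; auto.
    - rewrite F_zero. destruct (Z.eq_dec j n); subst; [rewrite (Hlow n T)|]; ring. }
  rewrite F_add by auto using K0_Pc.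
  eapply ccv_unique with (s := fun N => (X * symsum (fun j => F (G j) n) N + (- C1) * symsum (fun j => F (G' j) n) N)%Cx).
  - replace (X * F (fun t => zsum (fun j => G j t)) n - F (fun t => Ci * (c t * Cconj (zsum (fun j => G j t)))) n)%Cx
      with (X * F (fun t => zsum (fun j => G j t)) n + (- C1) * F (fun t => Ci * (c t * Cconj (zsum (fun j => G j t)))) n)%Cx by ring.
    apply ccv_add; apply ccv_mul; auto.
  - apply ccv_ext with (fun N => symsum (fun j => if Z.eq_dec j n then F v n else C0) N + symsum (fun j => F (Kt (F v) j) n) N)%Cx.
    + intros N. rewrite <- !symsum_mul, <- !symsum_add. apply symsum_ext. intros j _.
      rewrite Term, Term2. ring.
    + apply ccv_add; auto. intros eps He. exists (Z.abs_nat n). intros N HN.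
      rewrite (symsum_single _ n); [|intros j Hj; destruct (Z.eq_dec j n); congruence|lia].
      destruct (Z.eq_dec n n); [|congruence]. replace (F v n - F v n)%Cx with C0 by ring. rewrite Cnorm_C0; auto.
Qed.

(** * Relations between the basic functions *)

Variable tau : R.
Hypothesis tau_kernel : forall u, Pc u -> weak a b nu c tau u (fun _ => C0) -> forall t, u t = C0.
Hypothesis indep : forall j, R_independent (w (j, true)) (w (j, false)).

Local Notation Ei i := (E (ph i) (ps i)).

Lemma Ei_Pc i z : Pc (Ei i z).
Proof. eapply eig_Pc, items_eig. Qed.

Lemma Ei_weak i z : weak a b nu c tau (Ei i z) (Ei i ((CofR tau - sg i) * z)%Cx).
Proof. apply weak_E; auto. apply items_eig. Qed.

(** Otherwise the nonzero function [E (ph i) (ps i) 1] would lie in the kernel of [tau - Q]. *)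
Lemma tau_neq i : (CofR tau - sg i)%Cx <> C0.
Proof.
  intros H. assert (1 = 0); [|lra]. apply (item_E_real_inj 1 (items i)).
  apply tau_kernel; [apply Ei_Pc|]. eapply weak_ext; [reflexivity| |apply (Ei_weak i (CofR 1))].
  intros t. rewrite H. replace (C0 * CofR 1)%Cx with C0 by ring. apply E_0.
Qed.

Lemma tl_idx i : tl (fst i) = false <-> In i (idx N0).
Proof. destruct i as [j p]. rewrite in_idx. unfold tl; simpl. rewrite Z.ltb_ge. tauto. Qed.

Lemma clsum_Pc (f : Z * bool -> R -> Cx) l : (forall i, Pc (f i)) -> Pc (fun t => clsum (fun i => f i t) l).
Proof. intros H; induction l; simpl; [apply Pc_const|apply Pc_add; auto]. Qed.

Lemma clsum_F (f : Z * bool -> R -> Cx) l n : (forall i, Pc (f i)) ->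
  F (fun t => clsum (fun i => f i t) l) n = clsum (fun i => F (f i) n) l.
Proof.
  intros H; induction l; simpl; [apply F_zero|]. rewrite F_add by auto using clsum_Pc.
  f_equal. apply IHl.
Qed.

Lemma clsum_weak (f g : Z * bool -> R -> Cx) l : (forall i, Pc (f i)) -> (forall i, Pc (g i)) ->
  (forall i, weak a b nu c tau (f i) (g i)) ->
  weak a b nu c tau (fun t => clsum (fun i => f i t) l) (fun t => clsum (fun i => g i t) l).
Proof.
  intros Hf Hg H; induction l; simpl; [apply weak_zero|]. apply weak_add; auto using clsum_Pc.
Qed.

(* A relation [sum_(low i) E_i (z_i) + sum_(tail j) E_j (F v j) = 0]; the second sum, which in
   general converges in L2 only, is [v + K0 v]. *)
Definition rel (z : Z * bool -> Cx) (v : R -> Cx) : Prop :=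
  Pc v /\ (forall j, tl j = false -> F v j = C0) /\
  forall t, (clsum (fun i => Ei i (z i) t) (idx N0) + (v t + K0 v t))%Cx = C0.

Lemma rel_lin z v z' v' x : rel z v -> rel z' v' ->
  rel (fun i => z i + CofR x * z' i)%Cx (fun t => v t + CofR x * v' t)%Cx.
Proof.
  intros [P [L H]] [P' [L' H']]. split; [apply Pc_add; auto; apply Pc_scal; auto|]. split.
  - intros j T. rewrite F_add, F_scal, L, L' by (auto using Pc_scal). ring.
  - intros t. rewrite K0_add, K0_real by (auto using Pc_scal).
    rewrite (clsum_ext _ (fun i => Ei i (z i) t + CofR x * Ei i (z' i) t)%Cx)
      by (intros; rewrite E_add, E_real; auto).
    rewrite clsum_add, clsum_mul.
    transitivity ((clsum (fun i => Ei i (z i) t) (idx N0) + (v t + K0 v t))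
      + CofR x * (clsum (fun i => Ei i (z' i) t) (idx N0) + (v' t + K0 v' t)))%Cx; [ring|].
    rewrite H, H'. ring.
Qed.

(** The divided combination is sent to zero by [tau - Q], hence is zero. Division leaves the reals,
    which is why relations carry complex coefficients. *)
Lemma rel_resolvent z v : rel z v -> exists v', rel (fun i => z i / (CofR tau - sg i))%Cx v' /\
  forall j, tl j = true -> F v' j = (F v j / (CofR tau - s j))%Cx.
Proof.
  intros [P [L H]]. destruct (tail_resolvent tau v P L) as [v' [P' [L' [Ft W]]]].
  exists v'. split; auto. split; auto. split; auto.
  apply (tau_kernel (fun t => clsum (fun i => Ei i (z i / (CofR tau - sg i))%Cx t) (idx N0) + (v' t + K0 v' t))%Cx).
  - apply Pc_add; [apply clsum_Pc; intros; apply Ei_Pc|]. apply Pc_add; auto using K0_Pc.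
  - apply weak_ext with (u := fun t => (clsum (fun i => Ei i (z i / (CofR tau - sg i))%Cx t) (idx N0) + (v' t + K0 v' t))%Cx)
      (f := fun t => (clsum (fun i => Ei i (z i) t) (idx N0) + (v t + K0 v t))%Cx); auto.
    apply weak_add; auto.
    + apply clsum_Pc; intros; apply Ei_Pc.
    + apply Pc_add; auto using K0_Pc.
    + apply clsum_Pc; intros; apply Ei_Pc.
    + apply Pc_add; auto using K0_Pc.
    + apply clsum_weak; intros; try apply Ei_Pc.
      eapply weak_ext; [reflexivity| |apply Ei_weak]. intros t. f_equal. field. apply tau_neq.
Qed.

(* The real polynomial [(X - s0) (X - conj s0)], divided by [(tau - X)^2] to make it bounded. *)
Definition gq (s0 z : Cx) : Cx := ((s0 - z) * (Cconj s0 - z) / ((CofR tau - z) * (CofR tau - z)))%Cx.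
Definition gpl (L : list Cx) (z : Cx) : Cx := fold_right (fun s0 acc => gq s0 z * acc)%Cx C1 L.

(** With [mu = tau - s0], [gq s0 z = 1 - 2 Re mu / (tau - z) + |mu|^2 / (tau - z)^2]: a combination
    of two resolvents with real coefficients, as R-linearity demands. *)
Lemma rel_gq s0 z v : rel z v -> exists v', rel (fun i => gq s0 (sg i) * z i)%Cx v' /\
  forall j, tl j = true -> F v' j = (gq s0 (s j) * F v j)%Cx.
Proof.
  intros H. destruct (rel_resolvent z v H) as [v1 [H1 F1]]. destruct (rel_resolvent _ v1 H1) as [v2 [H2 F2]].
  set (mu := (CofR tau - s0)%Cx).
  pose proof (rel_lin _ _ _ _ (Cnorm mu ^ 2) (rel_lin _ _ _ _ (-2 * Cre mu) H H1) H2) as HR.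
  eexists. split.
  - destruct HR as [P [L HR]]. split; [exact P|]. split; [exact L|]. intros t. rewrite <- (HR t). f_equal.
    apply clsum_ext. intros i _. f_equal. unfold gq.
    replace (CofR (-2 * Cre mu)) with (- (mu + Cconj mu))%Cx by cx.
    replace (CofR (Cnorm mu ^ 2)) with (mu * Cconj mu)%Cx by (rewrite Cnorm_sqr; cx).
    unfold mu. rewrite Cconj_sub, Cconj_CofR. field. apply tau_neq.
  - intros j T. destruct H as [P _]. destruct H1 as [P1 _]. destruct H2 as [P2 _].
    rewrite !F_add, !F_scal, F2, F1 by (auto using Pc_scal, Pc_add).
    unfold gq. replace (CofR (-2 * Cre mu)) with (- (mu + Cconj mu))%Cx by cx.
    replace (CofR (Cnorm mu ^ 2)) with (mu * Cconj mu)%Cx by (rewrite Cnorm_sqr; cx).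
    unfold mu. rewrite Cconj_sub, Cconj_CofR. field. apply tau_neq.
Qed.

Lemma rel_gpl L z v : rel z v -> exists v', rel (fun i => gpl L (sg i) * z i)%Cx v' /\
  forall j, tl j = true -> F v' j = (gpl L (s j) * F v j)%Cx.
Proof.
  intros H. induction L as [|s0 L [v1 [H1 F1]]]; simpl.
  - exists v. split; [|intros; ring]. destruct H as [P [Lw H]]. split; auto. split; auto.
    intros t. rewrite <- (H t). f_equal. apply clsum_ext. intros. f_equal. ring.
  - destruct (rel_gq s0 _ v1 H1) as [v2 [H2 F2]]. exists v2. split.
    + destruct H2 as [P [Lw H2]]. split; auto. split; auto.
      intros t. rewrite <- (H2 t). f_equal. apply clsum_ext. intros. f_equal. ring.
    + intros j T. rewrite F2, F1 by auto. ring.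
Qed.

Lemma gpl_zero L z : In z L -> gpl L z = C0.
Proof.
  induction L; simpl; [tauto|]. intros [->|H]; [|rewrite IHL by auto; ring]. unfold gq, Cdiv. ring.
Qed.

Lemma gpl_neq0 L i : (forall s0, In s0 L -> s0 <> sg i /\ Cconj s0 <> sg i) -> gpl L (sg i) <> C0.
Proof.
  induction L as [|s0 L IH]; simpl; intros H.
  - intros E0. apply (f_equal Cre) in E0. simpl in E0. lra.
  - intros E0. apply Cmul_eq0 in E0. destruct E0 as [E0|E0]; [|revert E0; apply IH; auto].
    destruct (H s0 (or_introl eq_refl)) as [N1 N2]. unfold gq in E0.
    apply (f_equal (fun x => x * ((CofR tau - sg i) * (CofR tau - sg i))))%Cx in E0.
    replace ((s0 - sg i) * (Cconj s0 - sg i) / ((CofR tau - sg i) * (CofR tau - sg i)) * ((CofR tau - sg i) * (CofR tau - sg i)))%Cx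
      with ((s0 - sg i) * (Cconj s0 - sg i))%Cx in E0 by (field; apply tau_neq).
    replace (C0 * ((CofR tau - sg i) * (CofR tau - sg i)))%Cx with C0 in E0 by ring.
    apply Cmul_eq0 in E0. destruct E0 as [E0|E0]; apply Csub_eq0 in E0; auto.
Qed.

Lemma gpl_real L z : Cim z = 0 -> Cim (gpl L z) = 0.
Proof.
  intros Hz. assert (Ez : Cconj z = z) by (apply Cx_ext; simpl; lra).
  assert (H : Cconj (gpl L z) = gpl L z).
  { induction L as [|s0 L IH]; simpl; [cx|]. rewrite Cconj_mul, IH. f_equal. unfold gq, Cdiv.
    rewrite !Cconj_mul, Cconj_inv, !Cconj_mul, !Cconj_sub, Cconj_conj, Cconj_CofR, Ez. ring. }
  apply (f_equal Cim) in H. simpl in H. lra.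
Qed.

Lemma tl_nonreal j : tl j = true -> Cim (s j) <> 0.
Proof.
  intros T H. pose proof (s_large j T) as B. rewrite H, Rabs_R0 in B. apply tl_abs in T. pose proof INR_N0. nra.
Qed.

(** Equal or conjugate exponents would force equal winding numbers, while a tail index exceeds every
    low one in absolute value. *)
Lemma tail_low_class j i : tl j = true -> In i (idx N0) -> sg i <> s j /\ Cconj (sg i) <> s j.
Proof.
  intros T Hi. apply tl_idx in Hi.
  assert (G : ~ (sg i = s j \/ sg i = Cconj (s j))).
  { intros H. destruct (item_class_nonreal a_pos (items (j, true)) (items i) (tl_nonreal j T) H)
      as [E0 _]. simpl in E0. rewrite E0 in Hi. congruence. }
  split; intros H; apply G; [left; auto|right]. rewrite <- H, Cconj_conj; auto.
Qed.

(** A multiplier vanishing at all low exponents leaves [v' + K0 v' = 0], so [v' = 0]; it is nonzero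
    at each tail exponent, so the coefficients of [v] vanish too. *)
Lemma rel_tail_zero z v : rel z v -> forall t, v t = C0.
Proof.
  intros H. set (L := map sg (idx N0)). destruct (rel_gpl L z v H) as [v' [[P' [L' H']] F']].
  assert (Z' : forall t, v' t = C0).
  { apply K0_inj; auto. intros t. rewrite <- (H' t), clsum_0; [ring|].
    intros i Hi. rewrite gpl_zero by (apply in_map; auto). replace (C0 * z i)%Cx with C0 by ring. apply E_0. }
  apply F_eq0; [apply H|]. intros j. destruct (tl j) eqn:T; [|apply H; auto].
  specialize (F' j T). rewrite (F_ext v' (fun _ => C0) j Z'), F_zero in F'. symmetry in F'.
  apply Cmul_eq0 in F'. destruct F' as [F'|F']; auto. exfalso. revert F'. apply gpl_neq0.
  intros s0 Hs0. unfold L in Hs0. apply in_map_iff in Hs0. destruct Hs0 as [i [<- Hi]].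
  apply tail_low_class; auto.
Qed.

Definition Cx_dec (z z' : Cx) : {z = z'} + {z <> z'} := excluded_middle_informative (z = z').
Definition ot (i : Z * bool) : Z * bool := (fst i, negb (snd i)).

(* Multiplying by a real polynomial that vanishes at all exponents but [sg i0] and its conjugate. *)
Lemma rel_isolate z v i0 : rel z v -> In i0 (idx N0) ->
  exists g0, g0 <> C0 /\ (Cim (sg i0) = 0 -> Cim g0 = 0) /\
    forall t, (Ei i0 (g0 * z i0)%Cx t +
      (if Cx_dec (sg (ot i0)) (sg i0) then Ei (ot i0) (g0 * z (ot i0))%Cx t else C0))%Cx = C0.
Proof.
  intros H Hi0.
  set (cls := fun i => sg i = sg i0 \/ sg i = Cconj (sg i0)).
  (* Exponents in one class belong to one winding number, so beside [i0] only its partner [ot i0]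
     can survive. *)
  assert (Hcls : forall i, cls i -> fst i = fst i0 /\ sg i = sg i0).
  { intros i Hi. destruct (Req_dec (Cim (sg i0)) 0) as [R0|R0].
    - assert (E0 : Cconj (sg i0) = sg i0) by (apply Cx_ext; simpl; lra).
      assert (E1 : sg i = sg i0) by (destruct Hi; congruence). split; auto.
      pose proof (items i) as I. rewrite E1 in I.
      exact (item_class_real a_pos (items i0) I R0).
    - destruct (item_class_nonreal a_pos (items i0) (items i) R0 Hi) as [E0 [E1 _]]; auto. }
  set (off := fun i => if excluded_middle_informative (cls i) then false else true).
  set (L := map sg (filter off (idx N0))). destruct (rel_gpl L z v H) as [v' [H' _]].
  pose proof (rel_tail_zero _ _ H') as Z'. destruct H' as [P' [_ H']].
  exists (gpl L (sg i0)). split; [|split; [apply gpl_real|]].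
  - apply gpl_neq0. intros s0 Hs0. unfold L in Hs0. apply in_map_iff in Hs0. destruct Hs0 as [i [<- Hi]].
    apply filter_In in Hi. destruct Hi as [_ Hi]. unfold off in Hi.
    destruct (excluded_middle_informative (cls i)) as [|N]; [discriminate|].
    split; intros E0; apply N; [left; auto|right]. rewrite <- E0, Cconj_conj; auto.
  - intros t. specialize (H' t). rewrite (K0_ext _ _ Z'), Z' in H'.
    rewrite K0_zero in H'. replace (C0 + C0)%Cx with C0 in H' by ring.
    set (f := fun i => Ei i (gpl L (sg i) * z i)%Cx t) in *.
    assert (Hf : forall i, In i (idx N0) -> ~ cls i -> f i = C0).
    { intros i Hi Hc. unfold f. rewrite gpl_zero.
      - replace (C0 * z i)%Cx with C0 by ring. apply E_0.
      - apply in_map. apply filter_In. split; auto. unfold off.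
        destruct (excluded_middle_informative (cls i)); tauto. }
    destruct i0 as [j0 p0]. simpl in Hcls.
    assert (Hj : (Z.abs j0 <= Z.of_nat N0)%Z) by (apply in_idx in Hi0; auto).
    rewrite (clsum_ext _ (fun i => if Z.eq_dec (fst i) j0 then f i else C0)) in H'.
    + rewrite (clsum_pair _ N0 j0) in H'; auto.
      * simpl in H'. destruct (Z.eq_dec j0 j0); [|congruence].
        assert (Eo : forall p, f (j0, p) = if Cx_dec (sg (j0, p)) (sg (j0, p0)) then Ei (j0, p) (gpl L (sg (j0, p0)) * z (j0, p))%Cx t else C0).
        { intros p. destruct (Cx_dec (sg (j0, p)) (sg (j0, p0))) as [E0|E0].
          - unfold f. rewrite E0. reflexivity.
          - apply Hf; [apply in_idx; auto|]. intros Hc. apply E0. apply Hcls; auto. }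
        rewrite !Eo in H'. unfold ot; simpl. destruct p0; simpl.
        -- destruct (Cx_dec (sg (j0, true)) (sg (j0, true))); [|congruence]. etransitivity; [|exact H']. ring.
        -- destruct (Cx_dec (sg (j0, false)) (sg (j0, false))); [|congruence]. etransitivity; [|exact H']. ring.
      * intros i Hi. destruct (Z.eq_dec (fst i) j0); [congruence|auto].
    + intros i Hi. destruct (Z.eq_dec (fst i) j0); auto. apply Hf; auto. intros Hc. apply n, Hcls; auto.
Qed.

Lemma indep_ot i : R_independent (w i) (w (ot i)).
Proof.
  destruct i as [j [|]]; [apply (indep j)|]. intros x y H. unfold ot in H; simpl in H.
  destruct (indep j y x) as [A B]; auto. intros r t Hr. rewrite <- (H r t Hr). ring.
Qed.

Lemma items_w i r t : 0 < r -> w i r t = Ei i (Cpow r (sg i)) t.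
Proof. apply (item_w (items i)). Qed.

(** A real ratio would be an R-linear dependence between [w_j^+] and [w_j^-]. *)
Lemma nonreal_ratio i : Cim (sg i) <> 0 -> sg (ot i) = sg i ->
  exists k, Cim k <> 0 /\ forall t, ph (ot i) t = (k * ph i t)%Cx /\ ps (ot i) t = (k * ps i t)%Cx.
Proof.
  intros Hs E0. destruct (item_class_nonreal a_pos (items i) (items (ot i)) Hs (or_introl E0))
    as [_ [_ [k [Nk Hk]]]].
  exists k. split; auto. intros Ik. destruct (indep_ot i (Cre k) (-1)) as [_ B]; [|lra].
  intros r t Hr. rewrite !items_w by auto. rewrite E0. unfold E. destruct (Hk t) as [-> ->].
  apply Cx_ext; simpl; rewrite Ik; ring.
Qed.

Lemma ratio_E i k : (forall t, ph (ot i) t = (k * ph i t)%Cx /\ ps (ot i) t = (k * ps i t)%Cx) ->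
  forall z t, Ei (ot i) z t = Ei i (k * z)%Cx t.
Proof. intros H z t. unfold E. destruct (H t) as [-> ->]. f_equal; [ring|f_equal; ring]. Qed.

(** After isolation, an exponent not shared by the partner is settled by injectivity of [E]. A
    shared real one yields a dependence between [w_j^+] and [w_j^-]; a shared nonreal one yields
    [x + k x' = 0] with [x], [x'] real and [Im k <> 0]. *)
Lemma rel_indep x v : rel (fun i => CofR (x i)) v -> forall i, In i (idx N0) -> x i = 0.
Proof.
  intros H i Hi. destruct (rel_isolate _ _ i H Hi) as [g0 [Ng [Rg Hg]]].
  destruct (Req_dec (Cim (sg i)) 0) as [R0|R0].
  - assert (Eg : g0 = CofR (Cre g0)) by (apply Cx_ext; simpl; auto). rewrite Eg in Hg, Ng.
    assert (Ng' : Cre g0 <> 0) by (intros E0; apply Ng; rewrite E0; reflexivity).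
    destruct (Cx_dec (sg (ot i)) (sg i)) as [E0|E0].
    + assert (X0 : Cre g0 * x i = 0).
      { apply (indep_ot i (Cre g0 * x i) (Cre g0 * x (ot i))).
        intros r t Hr. rewrite !items_w by auto. rewrite E0, Cpow_real by auto.
        specialize (Hg t). rewrite <- !CofR_mul in Hg. rewrite <- !E_real.
        set (y := Rpower r (Cre (sg i))).
        replace (CofR (Cre g0 * x i) * CofR y)%Cx with (CofR y * CofR (Cre g0 * x i))%Cx by ring.
        replace (CofR (Cre g0 * x (ot i)) * CofR y)%Cx with (CofR y * CofR (Cre g0 * x (ot i)))%Cx by ring.
        rewrite !E_real.
        transitivity (CofR y * (Ei i (CofR (Cre g0 * x i)) t + Ei (ot i) (CofR (Cre g0 * x (ot i))) t))%Cx; [ring|].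
        rewrite Hg. ring. }
      apply Rmult_integral in X0. tauto.
    + assert (X0 : Cre g0 * x i = 0).
      { apply (item_E_real_inj _ (items i)). intros t. rewrite CofR_mul, <- (Hg t). ring. }
      apply Rmult_integral in X0. tauto.
  - destruct (Cx_dec (sg (ot i)) (sg i)) as [E0|E0].
    + destruct (nonreal_ratio i R0 E0) as [k [Ik Hk]].
      assert (Z0 : (g0 * (CofR (x i) + k * CofR (x (ot i))))%Cx = C0).
      { apply (item_E_inj (items i) R0). intros t. rewrite <- (Hg t).
        rewrite (ratio_E i k Hk), <- E_add. f_equal. ring. }
      apply Cmul_eq0 in Z0. destruct Z0 as [Z0|Z0]; [tauto|].
      apply (f_equal Cim) in Z0 as Z1. apply (f_equal Cre) in Z0. simpl in Z0, Z1.
      assert (Cim k * x (ot i) = 0) by lra. apply Rmult_integral in H0. destruct H0 as [|X0]; [tauto|].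
      rewrite X0 in Z0. lra.
    + assert (Z0 : (g0 * CofR (x i))%Cx = C0).
      { apply (item_E_inj (items i) R0). intros t. rewrite <- (Hg t). ring. }
      apply Cmul_eq0 in Z0. destruct Z0 as [Z0|Z0]; [tauto|]. apply (f_equal Cre) in Z0. exact Z0.
Qed.

(** * The expansion of a continuous function *)

Hypothesis tail_false : forall j, tl j = true -> sg (j, false) = s j /\
  forall t, ph (j, false) t = (Ci * phi j t)%Cx /\ ps (j, false) t = (Ci * psi j t)%Cx.

(** Surjectivity produces a preimage with this bound, and injectivity identifies it with [v]. *)
Lemma one_plus_K0_bound v M : Pc v -> 0 < M -> (forall t, Cnorm (v t + K0 v t)%Cx <= M) ->
  forall t, Cnorm (v t) <= 2 * M.
Proof.
  intros P HM H. destruct (one_plus_K0_surj (fun t => v t + K0 v t)%Cx M) as [v' [P' [B' E']]]; auto.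
  { apply Pc_add; auto using K0_Pc. }
  intros t. replace (v t) with (v' t); auto. apply Csub_eq0.
  transitivity (v' t + CofR (-1) * v t)%Cx; [cx|].
  apply (K0_inj (fun t => v' t + CofR (-1) * v t)%Cx); [apply Pc_add; auto using Pc_scal|].
  intros x. rewrite K0_add, K0_real by (auto using Pc_scal).
  transitivity ((v' x + K0 v' x) + CofR (-1) * (v x + K0 v x))%Cx; [ring|]. rewrite E'. cx.
Qed.

Lemma clsum_bound (e : Z * bool -> R -> Cx) l : (forall i, Pc (e i)) -> exists B, 0 <= B /\
  forall (x : Z * bool -> R) X, 0 <= X -> (forall i, In i l -> Rabs (x i) <= X) ->
  forall t, Cnorm (clsum (fun i => CofR (x i) * e i t)%Cx l) <= X * B.
Proof.
  intros He. induction l as [|i l [B [HB IH]]].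
  - exists 0. split; [lra|]. intros. simpl. rewrite Cnorm_C0. lra.
  - destruct (Pc_bounded (e i) (He i)) as [M [HM Be]]. exists (M + B). split; [lra|].
    intros x X HX Hx t. simpl. eapply Rle_trans; [apply Cnorm_add|].
    rewrite Cnorm_mul, Cnorm_CofR, Rmult_plus_distr_l. apply Rplus_le_compat.
    + apply Rmult_le_compat; auto; [apply Rabs_pos|apply Cnorm_ge0|apply Hx; left; auto].
    + apply IH; auto. intros; apply Hx; right; auto.
Qed.

(** [X] lists the real coordinates of [u] in the family at radius [1]. In the tail [w_j^-] has the
    pair [(i phi_j, i psi_j)], so the two real coordinates form the single complex coefficient
    [F v j]. *)
Definition Dec (u : R -> Cx) (X : Z * bool -> R) : Prop :=
  exists v, Pc v /\ (forall j, tl j = false -> F v j = C0) /\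
    (forall j, tl j = true -> F v j = mkC (X (j, true)) (X (j, false))) /\
    forall t, u t = (clsum (fun i => CofR (X i) * Ei i C1 t) (idx N0) + (v t + K0 v t))%Cx.

Lemma Dec_ext u u' X : (forall t, u t = u' t) -> Dec u X -> Dec u' X.
Proof.
  intros H [v [P [L [T E0]]]]. exists v. repeat split; auto; try apply P. intros t. rewrite <- H; auto.
Qed.

Lemma Dec_lin u X u' X' x : Dec u X -> Dec u' X' ->
  Dec (fun t => u t + CofR x * u' t)%Cx (fun i => X i + x * X' i).
Proof.
  intros [v [P [L [T E0]]]] [v' [P' [L' [T' E0']]]]. exists (fun t => v t + CofR x * v' t)%Cx.
  split; [apply Pc_add; auto using Pc_scal|]. split; [|split].
  - intros j H. rewrite F_add, F_scal, L, L' by (auto using Pc_scal). ring.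
  - intros j H. rewrite F_add, F_scal, T, T' by (auto using Pc_scal). cx.
  - intros t. rewrite K0_add, K0_real by (auto using Pc_scal). rewrite E0, E0'.
    rewrite (clsum_ext (fun i => CofR (X i + x * X' i) * Ei i C1 t)%Cx
      (fun i => CofR (X i) * Ei i C1 t + CofR x * (CofR (X' i) * Ei i C1 t))%Cx)
      by (intros; rewrite CofR_add, CofR_mul; ring).
    rewrite clsum_add, clsum_mul. ring.
Qed.

Lemma Ei_CofR i x t : Ei i (CofR x) t = (CofR x * Ei i C1 t)%Cx.
Proof. rewrite <- E_real. f_equal. ring. Qed.

Lemma Dec_zero X : Dec (fun _ => C0) X -> forall i, X i = 0.
Proof.
  intros [v [P [L [T E0]]]].
  assert (H : rel (fun i => CofR (X i)) v).
  { split; auto. split; auto. intros t. rewrite (E0 t). f_equal. apply clsum_ext. intros; apply Ei_CofR. }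
  intros i. destruct (tl (fst i)) eqn:Ti.
  - specialize (T _ Ti). rewrite (F_ext v (fun _ => C0) _ (rel_tail_zero _ _ H)), F_zero in T.
    destruct i as [j [|]]; simpl in *; [apply (f_equal Cre) in T|apply (f_equal Cim) in T]; simpl in T; auto.
  - apply tl_idx in Ti. eapply rel_indep; eauto.
Qed.

Lemma Dec_unique u X X' : Dec u X -> Dec u X' -> forall i, X i = X' i.
Proof.
  intros H H' i. pose proof (Dec_lin _ _ _ _ (-1) H H') as D.
  apply Dec_ext with (u' := fun _ => C0) in D; [|intros; cx]. pose proof (Dec_zero _ D i). simpl in H0. lra.
Qed.

Lemma K0_clsum (V : Z * bool -> R -> Cx) (x : Z * bool -> R) l : (forall i, Pc (V i)) ->
  forall t, K0 (fun t => clsum (fun i => CofR (x i) * V i t)%Cx l) t = clsum (fun i => CofR (x i) * K0 (V i) t)%Cx l.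
Proof.
  intros PV. induction l as [|i l IH]; intros t; simpl; [apply K0_zero|].
  rewrite (K0_add (fun t => CofR (x i) * V i t)%Cx (fun t => clsum (fun i => CofR (x i) * V i t)%Cx l)).
  - rewrite K0_real, IH by auto. reflexivity.
  - apply Pc_scal; auto.
  - apply (clsum_Pc (fun i t => CofR (x i) * V i t)%Cx). intros; apply Pc_scal; auto.
Qed.

Definition co (v : R -> Cx) (k : Z * bool) : R := if snd k then Cre (F v (fst k)) else Cim (F v (fst k)).

Lemma co_le v k : Rabs (co v k) <= Cnorm (F v (fst k)).
Proof. unfold co. destruct (snd k); [apply Cre_le_norm|apply Cim_le_norm]. Qed.

Lemma clsum_re (f : Z * bool -> Cx) l : Cre (clsum f l) = lsum (fun i => Cre (f i)) l.
Proof. induction l; simpl; auto. rewrite <- IHl. auto. Qed.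
Lemma clsum_im (f : Z * bool -> Cx) l : Cim (clsum f l) = lsum (fun i => Cim (f i)) l.
Proof. induction l; simpl; auto. rewrite <- IHl. auto. Qed.

(** Pulled back by [1 + K0], each low eigenfunction is some [V i], and [u] is some [v0]. The low
    Fourier coefficients of [v0] must be matched by those of a real combination of the [V i]: a
    square system, injective because a kernel vector would be a relation. *)
Lemma Dec_exists : exists C, 0 < C /\ forall u M, Pc u -> 0 < M -> (forall t, Cnorm (u t) <= M) ->
  exists X, Dec u X /\ forall i, Rabs (X i) <= C * M.
Proof.
  assert (HV : forall i, exists V, Pc V /\ forall t, (V t + K0 V t)%Cx = Ei i C1 t).
  { intros i. destruct (Pc_bounded _ (Ei_Pc i C1)) as [M [HM B]].
    destruct (one_plus_K0_surj (Ei i C1) M (Ei_Pc i C1) HM B) as [V [P [_ E0]]]. exists V; auto. }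
  apply choice_fun in HV. destruct HV as [V HV].
  assert (PV : forall i, Pc (V i)) by (intros; apply HV).
  set (VV := fun (x : Z * bool -> R) t => clsum (fun i => CofR (x i) * V i t)%Cx (idx N0)).
  assert (PVV : forall x, Pc (VV x)).
  { intros x. apply (clsum_Pc (fun i t => CofR (x i) * V i t)%Cx). intros; apply Pc_scal; auto. }
  assert (KVV : forall x t, (VV x t + K0 (VV x) t)%Cx = clsum (fun i => CofR (x i) * Ei i C1 t)%Cx (idx N0)).
  { intros x t. unfold VV. rewrite K0_clsum, <- clsum_add by auto. apply clsum_ext. intros i _.
    rewrite <- (proj2 (HV i) t). ring. }
  assert (FVV : forall x k, co (VV x) k = lsum (fun i => x i * co (V i) k) (idx N0)).
  { intros x k. unfold co, VV. rewrite (clsum_F (fun i t => CofR (x i) * V i t)%Cx) by (intros; apply Pc_scal; auto).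
    rewrite (clsum_ext _ (fun i => CofR (x i) * F (V i) (fst k))%Cx) by (intros; rewrite F_scal; auto).
    destruct (snd k); [rewrite clsum_re|rewrite clsum_im]; apply lsum_ext; intros; simpl; ring. }
  destruct (linear_solve pair_dec (idx N0) (idx N0) (fun i k => co (V i) k) (NoDup_idx N0) eq_refl) as [C1' [HC1 Sol]].
  { intros x Hx i Hi.
    assert (H : rel (fun i => CofR (- x i)) (VV x)).
    { split; auto. split.
      - intros j T. assert (Hk : forall p, co (VV x) (j, p) = 0).
        { intros p. rewrite FVV. apply Hx. apply tl_idx. auto. }
        apply Cx_ext; [apply (Hk true)|apply (Hk false)].
      - intros t. rewrite KVV, <- clsum_add. apply clsum_0. intros. rewrite Ei_CofR. cx. }
    pose proof (rel_indep _ _ H i Hi). simpl in H0. lra. }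
  destruct (clsum_bound (fun i => Ei i C1) (idx N0)) as [B [HB Bd]]; [intros; apply Ei_Pc|].
  (* The low part is at most [C1' * 2 M * B]; subtracting it from [u] and inverting [1 + K0], at the
     price of a factor 2, bounds [v] by [C2 * M]. *)
  set (C2 := 2 * (1 + C1' * 2 * B)).
  assert (HCB : 0 <= C1' * 2 * B) by (apply Rmult_le_pos; lra).
  exists (2 * C1' + C2 + 1). split; [unfold C2; lra|].
  intros u M Pu HM Bu. destruct (one_plus_K0_surj u M Pu HM Bu) as [v0 [P0 [B0 E0]]].
  destruct (Sol (co v0) (2 * M)) as [x [Ex Bx]]; [lra| |].
  { intros k _. eapply Rle_trans; [apply co_le|]. apply F_norm; auto. }
  set (v := fun t => (v0 t + CofR (-1) * VV x t)%Cx).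
  assert (Pv : Pc v) by (apply Pc_add; auto using Pc_scal).
  assert (Ev : forall t, (v t + K0 v t)%Cx = (u t - clsum (fun i => CofR (x i) * Ei i C1 t)%Cx (idx N0))%Cx).
  { intros t. unfold v. rewrite K0_add, K0_real by (auto using Pc_scal).
    transitivity ((v0 t + K0 v0 t) + CofR (-1) * (VV x t + K0 (VV x) t))%Cx; [ring|]. rewrite E0, KVV. cx. }
  assert (Bv : forall t, Cnorm (v t) <= C2 * M).
  { intros t. unfold C2. replace (2 * (1 + C1' * 2 * B) * M) with (2 * ((1 + C1' * 2 * B) * M)) by ring.
    apply one_plus_K0_bound; auto; [apply Rmult_lt_0_compat; lra|].
    intros y. rewrite Ev. eapply Rle_trans; [apply Cnorm_sub|].
    assert (H1 : Cnorm (clsum (fun i => CofR (x i) * Ei i C1 y)%Cx (idx N0)) <= C1' * (2 * M) * B).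
    { apply Bd; auto. apply Rmult_le_pos; lra. }
    pose proof (Bu y). lra. }
  assert (Lv : forall j, tl j = false -> F v j = C0).
  { intros j T. assert (Hk : forall p, co v0 (j, p) = co (VV x) (j, p)).
    { intros p. rewrite FVV. symmetry. apply Ex. apply tl_idx. auto. }
    unfold v. rewrite F_add, F_scal by (auto using Pc_scal).
    pose proof (Hk true) as H1. pose proof (Hk false) as H2. change (Cre (F v0 j) = Cre (F (VV x) j)) in H1. change (Cim (F v0 j) = Cim (F (VV x) j)) in H2.
    apply Cx_ext; cbn [Cre Cim Cadd Cmul CofR C0]; lra. }
  (* Low coordinates come from the linear system, tail ones from the Fourier coefficients of the
     corrected [v]. *)
  set (X := fun i : Z * bool => if tl (fst i) then co v i else x i).
  assert (HX : forall i, In i (idx N0) -> X i = x i).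
  { intros i Hi. apply tl_idx in Hi. unfold X. rewrite Hi. auto. }
  exists X. split.
  - exists v. split; auto. split; auto. split.
    + intros j T. unfold X, co; cbn [fst snd]. rewrite T. destruct (F v j); reflexivity.
    + intros t. rewrite Ev.
      rewrite (clsum_ext (fun i => CofR (X i) * Ei i C1 t)%Cx (fun i => CofR (x i) * Ei i C1 t)%Cx)
        by (intros; rewrite HX; auto). ring.
  - intros i. unfold X. destruct (tl (fst i)) eqn:T.
    + assert (H1 : Rabs (co v i) <= C2 * M).
      { eapply Rle_trans; [apply co_le|]. apply F_norm; auto. }
      assert (0 <= C1' * M) by (apply Rmult_le_pos; lra). lra.
    + apply tl_idx in T. specialize (Bx i T). assert (0 <= C2 * M) by (apply Rmult_le_pos; unfold C2; lra).
      lra.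
Qed.

Lemma Dec_bounded : exists C, 0 < C /\ forall u X M, Pc u -> Dec u X -> 0 < M -> (forall t, Cnorm (u t) <= M) ->
  forall i, Rabs (X i) <= C * M.
Proof.
  destruct Dec_exists as [C [HC H]]. exists C. split; auto. intros u X M Pu D HM Bu i.
  destruct (H u M Pu HM Bu) as [X' [D' B']]. rewrite (Dec_unique _ _ _ D D'). auto.
Qed.

(* Completeness leaves no room for a nonreal exponent attached to only one of [w_j^+], [w_j^-]. *)
Lemma sg_ot i : Cim (sg i) <> 0 -> sg (ot i) = sg i.
Proof.
  intros Hs. destruct (tl (fst i)) eqn:T.
  - destruct i as [j [|]]; simpl in T; destruct (tail_false j T) as [E0 _]; unfold ot; simpl; auto.
  - apply tl_idx in T. destruct Dec_exists as [C [HC H]].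
    destruct (Pc_bounded _ (Ei_Pc i Ci)) as [M [HM B]].
    destruct (H (Ei i Ci) M (Ei_Pc i Ci) HM B) as [X [[v [P [L [_ E0]]]] _]].
    (* Expanding [E (ph i) (ps i) Ci] by completeness gives a relation with coefficient [X i - i] at
       [i]. If the partner had another exponent this coefficient would vanish, although [X i] is
       real. *)
    set (z := fun k => (CofR (X k) + (if pair_dec k i then - Ci else C0))%Cx).
    assert (HR : rel z v).
    { split; auto. split; auto. intros t.
      rewrite (clsum_ext _ (fun k => CofR (X k) * Ei k C1 t + (if pair_dec k i then Ei k (- Ci)%Cx t else C0))%Cx).
      - rewrite clsum_add, (clsum_single pair_dec (fun k => Ei k (- Ci)%Cx t)) by (auto using NoDup_idx).
        pose proof (E0 t) as Et.
        transitivity ((clsum (fun k => CofR (X k) * Ei k C1 t) (idx N0) + (v t + K0 v t)) + Ei i (- Ci)%Cx t)%Cx; [ring|].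
        rewrite <- Et, <- E_add. replace (Ci + - Ci)%Cx with C0 by ring. apply E_0.
      - intros k _. unfold z. rewrite E_add, Ei_CofR. destruct (pair_dec k i); [auto|rewrite E_0; auto]. }
    destruct (rel_isolate _ _ i HR T) as [g0 [Ng [_ Hg]]].
    destruct (Cx_dec (sg (ot i)) (sg i)) as [|Ne]; auto. exfalso.
    assert (Z0 : (g0 * z i)%Cx = C0).
    { apply (item_E_inj (items i) Hs). intros t. rewrite <- (Hg t). ring. }
    apply Cmul_eq0 in Z0. destruct Z0 as [Z0|Z0]; [tauto|]. unfold z in Z0. destruct (pair_dec i i); [|congruence].
    apply (f_equal Cim) in Z0. simpl in Z0. lra.
Qed.

(* In the nonreal case [kap] is the ratio [phi_j^- / phi_j^+]; it is [i] in the tail. *)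
Definition block (j : Z) (kap : Cx) : Prop :=
  (Cim (sg (j, true)) = 0 /\ Cim (sg (j, false)) = 0) \/
  (Cim (sg (j, true)) <> 0 /\ Cim kap <> 0 /\ sg (j, false) = s j /\
   forall z t, Ei (j, false) z t = Ei (j, true) (kap * z)%Cx t).

Lemma block_exists : exists kap : Z -> Cx, (forall j, tl j = true -> kap j = Ci) /\ forall j, block j (kap j).
Proof.
  assert (H : forall j, exists k, (tl j = true -> k = Ci) /\ block j k).
  { intros j. destruct (tl j) eqn:T.
    - exists Ci. split; auto. right. destruct (tail_false j T) as [E0 H]. split; [apply tl_nonreal; auto|].
      split; [simpl; lra|]. split; auto. apply (ratio_E (j, true) Ci). exact H.
    - destruct (Req_dec (Cim (s j)) 0) as [R0|R0].
      + exists Ci. split; [discriminate|]. left. split; auto.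
        destruct (Req_dec (Cim (sg (j, false))) 0) as [|R1]; auto. apply sg_ot in R1 as R2. unfold ot in R2; simpl in R2.
        rewrite R2 in R0. auto.
      + pose proof (sg_ot _ R0) as E0. destruct (nonreal_ratio (j, true) R0 E0) as [k [Ik Hk]].
        exists k. split; [discriminate|]. right. split; auto. split; auto. split; [exact E0|].
        apply (ratio_E (j, true) k Hk). }
  apply choice_fun in H. destruct H as [kap H]. exists kap. split; intros; apply H; auto.
Qed.

(** * Evolution of the coefficients along a solution *)

Variable kap : Z -> Cx.
Hypothesis kap_tail : forall j, tl j = true -> kap j = Ci.
Hypothesis kap_block : forall j, block j (kap j).

Definition isreal (j : Z) : {Cim (s j) = 0} + {Cim (s j) <> 0} := Req_EM_T (Cim (s j)) 0.

(* The coordinate on which the evolution acts as multiplication by [r^(sg i)]. *)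
Definition Zc (X : Z * bool -> R) (i : Z * bool) : Cx :=
  if isreal (fst i) then CofR (X i) else (CofR (X (fst i, true)) + kap (fst i) * CofR (X (fst i, false)))%Cx.

(** For a nonreal exponent [Zc] stores the same complex number under both signs, so only the entry
    [true] is counted. *)
Definition Bf (ze : Z * bool -> Cx) (j : Z) (t : R) : Cx :=
  (Ei (j, true) (ze (j, true)) t + (if isreal j then Ei (j, false) (ze (j, false)) t else C0))%Cx.

Lemma Zc_lin X X' x i : Zc (fun i => X i + x * X' i) i = (Zc X i + CofR x * Zc X' i)%Cx.
Proof. unfold Zc. destruct (isreal (fst i)); rewrite ?CofR_add, ?CofR_mul; ring. Qed.

(** The two conditions describe the range of [Zc]; in the nonreal case [1] and [kap j] form a real
    basis of the complex numbers. *)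
Lemma Zc_surj (ze : Z * bool -> Cx) :
  (forall i, Cim (s (fst i)) = 0 -> Cim (ze i) = 0) ->
  (forall j, Cim (s j) <> 0 -> ze (j, true) = ze (j, false)) ->
  exists X, forall i, Zc X i = ze i.
Proof.
  intros H1 H2.
  exists (fun i : Z * bool => let j := fst i in if isreal j then Cre (ze i) else
     let y := Cim (ze (j, true)) / Cim (kap j) in
     if snd i then Cre (ze (j, true)) - Cre (kap j) * y else y).
  intros [j p]. unfold Zc; simpl. destruct (isreal j) as [R0|R0].
  - apply Cx_ext; simpl; auto. symmetry. apply (H1 (j, p)); auto.
  - destruct (kap_block j) as [[B _]|[_ [Ik _]]]; [contradiction|].
    transitivity (ze (j, true)); [|destruct p; auto].
    apply Cx_ext; simpl; field; auto.
Qed.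

Lemma block_sum X j t :
  (CofR (X (j, true)) * Ei (j, true) C1 t + CofR (X (j, false)) * Ei (j, false) C1 t)%Cx = Bf (Zc X) j t.
Proof.
  unfold Bf, Zc; simpl. destruct (isreal j) as [R0|R0].
  - rewrite !Ei_CofR. reflexivity.
  - destruct (kap_block j) as [[B _]|[_ [_ [_ Hk]]]]; [contradiction|].
    rewrite E_add, Ei_CofR. replace (kap j * CofR (X (j, false)))%Cx with (CofR (X (j, false)) * (kap j * C1))%Cx by ring.
    rewrite E_real, <- Hk. ring.
Qed.

Lemma block_w A j r t : 0 < r ->
  (CofR (A (j, true)) * w (j, true) r t + CofR (A (j, false)) * w (j, false) r t)%Cx
  = Bf (fun i => Cpow r (sg i) * Zc A i)%Cx j t.
Proof.
  intros Hr. unfold Bf, Zc; simpl. rewrite !items_w by auto. destruct (isreal j) as [R0|R0].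
  - rewrite <- !E_real. f_equal; f_equal; ring.
  - destruct (kap_block j) as [[B _]|[_ [_ [E0 Hk]]]]; [contradiction|]. rewrite E0, Hk.
    replace (Cpow r (s j) * (CofR (A (j, true)) + kap j * CofR (A (j, false))))%Cx
      with (CofR (A (j, true)) * Cpow r (s j) + CofR (A (j, false)) * (kap j * Cpow r (s j)))%Cx by ring.
    rewrite E_add, !E_real. ring.
Qed.

Lemma Bf_ext ze ze' j t : (forall p, ze (j, p) = ze' (j, p)) -> Bf ze j t = Bf ze' j t.
Proof. intros H. unfold Bf. rewrite !H. reflexivity. Qed.

Lemma Bf_Pc ze j : Pc (Bf ze j).
Proof. unfold Bf. apply Pc_add; [apply Ei_Pc|]. destruct (isreal j); [apply Ei_Pc|apply Pc_const]. Qed.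

Lemma Bf_weak ze j :
  weak a b nu c tau (Bf (fun i => ze i / (CofR tau - sg i))%Cx j) (Bf ze j).
Proof.
  assert (H : forall i, weak a b nu c tau (Ei i (ze i / (CofR tau - sg i))%Cx) (Ei i (ze i))).
  { intros i. eapply weak_ext; [reflexivity| |apply Ei_weak]. intros t. f_equal. field. apply tau_neq. }
  unfold Bf. apply weak_add; auto; try apply Ei_Pc; destruct (isreal j); try apply Ei_Pc; try apply Pc_const; auto.
  apply weak_zero.
Qed.

Lemma symsum_weak (f g : Z -> R -> Cx) N : (forall j, Pc (f j)) -> (forall j, Pc (g j)) ->
  (forall j, weak a b nu c tau (f j) (g j)) ->
  weak a b nu c tau (fun t => symsum (fun j => f j t) N) (fun t => symsum (fun j => g j t) N).
Proof.
  intros Hf Hg H; induction N; cbn [symsum]; auto.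
  apply weak_add; auto; [apply Pc_add; auto; apply symsum_Pc; auto|apply Pc_add; auto; apply symsum_Pc; auto|].
  apply weak_add; auto; apply symsum_Pc; auto.
Qed.

Lemma low_sum X t : clsum (fun i => CofR (X i) * Ei i C1 t)%Cx (idx N0) = symsum (fun j => Bf (Zc X) j t) N0.
Proof. rewrite clsum_symsum. apply symsum_ext. intros; apply block_sum. Qed.

Lemma Zc_tail X j p : tl j = true -> Zc X (j, p) = mkC (X (j, true)) (X (j, false)).
Proof.
  intros T. unfold Zc; simpl. destruct (isreal j) as [R0|_]; [exfalso; apply (tl_nonreal j T R0)|].
  rewrite kap_tail by auto. cx.
Qed.

Lemma sg_false j : Cim (s j) <> 0 -> sg (j, false) = s j.
Proof. intros H. destruct (kap_block j) as [[B _]|[_ [_ [E0 _]]]]; [contradiction|auto]. Qed.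

Lemma sg_false_real j : Cim (s j) = 0 -> Cim (sg (j, false)) = 0.
Proof. intros H. destruct (kap_block j) as [[_ B]|[B _]]; [auto|contradiction]. Qed.

Lemma sg_real i : Cim (s (fst i)) = 0 -> Cim (sg i) = 0.
Proof. destruct i as [j [|]]; simpl; auto. apply sg_false_real. Qed.

Lemma Zc_real X i : Cim (s (fst i)) = 0 -> Zc X i = CofR (X i).
Proof. intros H. unfold Zc. destruct (isreal (fst i)); [auto|contradiction]. Qed.

Lemma Zc_nonreal X j : Cim (s j) <> 0 -> Zc X (j, true) = Zc X (j, false).
Proof. intros H. unfold Zc; simpl. destruct (isreal j); [contradiction|auto]. Qed.

(** [tau - Q] is diagonal in the coordinates [Zc]. Dividing those of [f] yields a function [u'] with
    the same image as [u]; injectivity gives [u = u'], and uniqueness of the expansion identifies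
    the coordinates. *)
Lemma coefficients_weak u f X Y : Pc u -> Pc f -> weak a b nu c tau u f -> Dec u X -> Dec f Y ->
  forall i, ((CofR tau - sg i) * Zc X i)%Cx = Zc Y i.
Proof.
  intros Pu Pf W DX [vY [PY [LY [TY EY]]]].
  destruct (Zc_surj (fun i => Zc Y i / (CofR tau - sg i))%Cx) as [X' HX'].
  { intros i R0. rewrite Zc_real by auto. apply sg_real in R0. unfold Cdiv, Cinv; simpl. rewrite R0. unfold Rdiv; ring. }
  { intros j R0. rewrite <- Zc_nonreal, sg_false by auto. auto. }
  destruct (tail_resolvent tau vY PY LY) as [v' [P' [L' [Ft W']]]].
  set (u' := fun t => (symsum (fun j => Bf (Zc X') j t) N0 + (v' t + K0 v' t))%Cx).
  assert (Pu' : Pc u').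
  { apply Pc_add; [apply symsum_Pc; intros; apply Bf_Pc|]. apply Pc_add; auto using K0_Pc. }
  assert (Du' : Dec u' X').
  { exists v'. split; auto. split; auto. split.
    - intros j T. rewrite Ft, TY, <- (Zc_tail Y j true), <- (Zc_tail X' j true), HX' by auto. reflexivity.
    - intros t. unfold u'. rewrite low_sum. reflexivity. }
  assert (Wu' : weak a b nu c tau u' f).
  { apply weak_ext with (u := u') (f := fun t => (symsum (fun j => Bf (Zc Y) j t) N0 + (vY t + K0 vY t))%Cx); auto.
    - intros t. rewrite EY, low_sum. reflexivity.
    - unfold u'. apply weak_add; auto.
      + apply symsum_Pc; intros; apply Bf_Pc.
      + apply Pc_add; auto using K0_Pc.
      + apply symsum_Pc; intros; apply Bf_Pc.
      + apply Pc_add; auto using K0_Pc.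
      + apply symsum_weak; intros; try apply Bf_Pc.
        eapply weak_ext; [|reflexivity|apply Bf_weak]. intros t. apply Bf_ext. intros. symmetry. apply HX'. }
  assert (Eu : forall t, u t = u' t).
  { intros t. apply Csub_eq0. transitivity (u t + CofR (-1) * u' t)%Cx; [cx|].
    apply (tau_kernel (fun t => u t + CofR (-1) * u' t)%Cx); [apply Pc_add; auto using Pc_scal|].
    eapply weak_ext; [reflexivity| |apply (weak_add a b nu c c_Pc tau u (fun t => CofR (-1) * u' t)%Cx f (fun t => CofR (-1) * f t)%Cx);
      auto using Pc_scal; apply weak_real; auto]. intros; cx. }
  assert (EX : forall i, X i = X' i).
  { apply Dec_unique with u; auto. apply Dec_ext with u'; auto. }
  intros i. replace (Zc X i) with (Zc X' i) by (unfold Zc; rewrite !EX; auto). rewrite HX'. field. apply tau_neq.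
Qed.

Lemma finite_max (f : Z -> R) N : exists C, 0 < C /\ forall j, (Z.abs j <= Z.of_nat N)%Z -> f j <= C.
Proof.
  exists (rsum (fun j => Rabs (f j)) N + 1). split.
  - pose proof (rsum_ge0 (fun j => Rabs (f j)) N (fun j => Rabs_pos (f j))). lra.
  - intros j Hj. apply Rle_trans with (Rabs (f j)); [apply Rle_abs|].
    assert (Rabs (f j) <= rsum (fun j => Rabs (f j)) N); [|lra].
    induction N; cbn [rsum].
    + replace j with 0%Z by lia. lra.
    + pose proof (rsum_ge0 (fun j => Rabs (f j)) N (fun j => Rabs_pos (f j))).
      pose proof (Rabs_pos (f (Z.of_nat (S N)))). pose proof (Rabs_pos (f (- Z.of_nat (S N))%Z)).
      destruct (Z.eq_dec j (Z.of_nat (S N))) as [->|]; [lra|].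
      destruct (Z.eq_dec j (- Z.of_nat (S N))) as [->|]; [lra|].
      assert (Rabs (f j) <= rsum (fun j => Rabs (f j)) N) by (apply IHN; lia). lra.
Qed.

(** Real and complex coordinates are comparable uniformly in [j], because [kap j = i] in the tail
    and only finitely many other ratios occur. *)
Lemma Zc_bounds : exists C, 0 < C /\
  (forall X i, Rabs (X i) <= C * Cnorm (Zc X i)) /\
  (forall X M i, (forall k, Rabs (X k) <= M) -> Cnorm (Zc X i) <= C * M).
Proof.
  set (f := fun j => 1 + (1 + Cnorm (kap j)) / Rabs (Cim (kap j)) + Cnorm (kap j)).
  (* The added 4 is the value of [f] in the tail, where [kap j = i]. *)
  destruct (finite_max f N0) as [C0' [HC0 Hf]]. exists (C0' + 4). split; [lra|].
  assert (Fj : forall j, f j <= C0' + 4).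
  { intros j. destruct (tl j) eqn:T.
    - unfold f. rewrite kap_tail, Cnorm_Ci by auto. simpl Cim. rewrite Rabs_R1. lra.
    - assert (f j <= C0') by (apply Hf; unfold tl in T; apply Z.ltb_ge; auto). lra. }
  assert (Hq : forall j, Cim (s j) <> 0 -> 0 < Rabs (Cim (kap j))).
  { intros j R0. destruct (kap_block j) as [[B _]|[_ [Ik _]]]; [contradiction|]. apply Rabs_pos_lt; auto. }
  split.
  - intros X [j p]. pose proof (Fj j) as HF. pose proof (Cnorm_ge0 (Zc X (j, p))) as Hz. unfold f in HF.
    unfold Zc in *. simpl in *. destruct (isreal j) as [R0|R0].
    + rewrite Cnorm_CofR in *. pose proof (Rabs_pos (X (j, p))). nra.
    + specialize (Hq j R0). set (z := (CofR (X (j, true)) + kap j * CofR (X (j, false)))%Cx) in *.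
      set (q := Rabs (Cim (kap j))) in *. set (n := Cnorm z) in *.
      assert (B1 : Rabs (X (j, false)) <= n / q).
      { apply Rmult_le_reg_l with q; auto. replace (q * (n / q)) with n by (field; lra). unfold q.
        rewrite <- Rabs_mult. replace (Cim (kap j) * X (j, false)) with (Cim z) by (unfold z; simpl; ring). apply Cim_le_norm. }
      pose proof (Cnorm_ge0 (kap j)) as Hk.
      assert (B2 : Rabs (X (j, true)) <= n + Cnorm (kap j) * (n / q)).
      { replace (X (j, true)) with (Cre z + - (Cre (kap j) * X (j, false))) by (unfold z; simpl; ring).
        eapply Rle_trans; [apply Rabs_triang|]. rewrite Rabs_Ropp, Rabs_mult. apply Rplus_le_compat; [apply Cre_le_norm|].
        apply Rmult_le_compat; auto; try apply Rabs_pos. apply Cre_le_norm. }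
      assert (0 <= n / q) by (apply Rmult_le_pos; [auto|left; apply Rinv_0_lt_compat; auto]).
      assert (H1 : n * (1 + (1 + Cnorm (kap j)) / q + Cnorm (kap j)) <= (C0' + 4) * n) by nra.
      replace (n * (1 + (1 + Cnorm (kap j)) / q + Cnorm (kap j)))
        with (n + n / q + Cnorm (kap j) * (n / q) + n * Cnorm (kap j)) in H1 by (field; lra).
      assert (0 <= n * Cnorm (kap j)) by (apply Rmult_le_pos; auto).
      assert (0 <= Cnorm (kap j) * (n / q)) by (apply Rmult_le_pos; auto).
      destruct p; lra.
  - intros X M [j p] HX. pose proof (Fj j) as HF. unfold f in HF. pose proof (Rle_trans _ _ _ (Rabs_pos _) (HX (j, true))) as HM.
    unfold Zc. simpl. destruct (isreal j) as [R0|R0].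
    + rewrite Cnorm_CofR. pose proof (HX (j, p)). nra.
    + specialize (Hq j R0). pose proof (Cnorm_ge0 (kap j)) as Hk.
      assert (0 <= (1 + Cnorm (kap j)) / Rabs (Cim (kap j))) by (apply Rmult_le_pos; [lra|left; apply Rinv_0_lt_compat; auto]).
      eapply Rle_trans; [apply Cnorm_add|]. rewrite Cnorm_mul, !Cnorm_CofR.
      pose proof (HX (j, true)). pose proof (HX (j, false)).
      assert (Cnorm (kap j) * Rabs (X (j, false)) <= Cnorm (kap j) * M) by (apply Rmult_le_compat_l; auto). nra.
Qed.

Variable ga : R.
Hypothesis ga_pos : 0 < ga.
Hypothesis re_large : forall j, tl j = true ->
  ((0 < j)%Z -> ga * IZR j <= Cre (s j)) /\ ((j < 0)%Z -> Cre (s j) <= ga * IZR j).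

(** Limit of [Dec_bounded], so that the bound [M = 0] is allowed. *)
Lemma Dec_bounded0 : exists C, 0 < C /\ forall u X M, Pc u -> Dec u X -> (forall t, Cnorm (u t) <= M) ->
  forall i, Rabs (X i) <= C * M.
Proof.
  destruct Dec_bounded as [C [HC H]]. exists C. split; auto. intros u X M Pu D Bu i.
  pose proof (Rle_trans _ _ _ (Cnorm_ge0 _) (Bu 0)) as HM. apply le_epsilon. intros eps He.
  pose proof (H u X (M + eps / C) Pu D) as B. assert (0 < eps / C) by (apply Rdiv_lt_0_compat; auto).
  specialize (B ltac:(lra) ltac:(intros t; specialize (Bu t); lra) i).
  replace (C * (M + eps / C)) with (C * M + eps) in B by (field; lra). auto.
Qed.

Lemma is_deriv_Zc (X X' : R -> Z * bool -> R) r i : (forall k, derivable_pt_lim (fun x => X x k) r (X' r k)) ->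
  is_deriv_C (fun x => Zc (X x) i) r (Zc (X' r) i).
Proof.
  intros H. assert (HC : forall k, is_deriv_C (fun x => CofR (X x k)) r (CofR (X' r k))).
  { intros k. split; simpl; [apply H|apply derivable_pt_lim_const]. }
  unfold Zc. destruct (isreal (fst i)); auto. apply is_deriv_add; auto. apply is_deriv_scal; auto.
Qed.

(** * Solutions in an annulus *)

Section Solution.
Variables (delta : R) (Rmax : option R) (u : R -> R -> Cx).
Hypothesis delta_ge0 : 0 <= delta.
Hypothesis delta_lt : below_max delta Rmax.
Hypothesis u_sol : L_solution (mkC a b) nu c (in_range delta Rmax) u.
Local Notation dom := (in_range delta Rmax).

Lemma dom_pos r : dom r -> 0 < r.
Proof. intros [H _]. lra. Qed.

Lemma sol_Pc r : dom r -> Pc (u r).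
Proof.
  intros Hr. destruct u_sol as [P [ur [ut [D [Cu _]]]]]. split; [|intros t; apply P; auto].
  apply Ccont_eps. intros t eps He. destruct (Cu r t Hr eps He) as [d [Hd H]]. exists d. split; auto.
  intros t' Ht'. apply H; auto. rewrite Rminus_diag, Rabs_R0; auto.
Qed.

(** At a fixed radius the equation is [Q u = r u_r], that is [(tau - Q) u = tau u - r u_r]. *)
Lemma sol_deriv : exists ur : R -> R -> Cx,
  (forall r t, dom r -> is_deriv_C (fun x => u x t) r (ur r t)) /\ cont2_on dom ur /\
  (forall r, dom r -> Pc (ur r)) /\
  (forall r, dom r -> weak a b nu c tau (u r) (fun t => CofR tau * u r t + CofR (- r) * ur r t)%Cx).
Proof.
  destruct u_sol as [P [ur [ut [D [Cu [Cur [_ HL]]]]]]]. exists ur.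
  assert (Dr : forall r t, dom r -> is_deriv_C (fun x => u x t) r (ur r t)) by (intros; apply D; auto).
  assert (Pur : forall r, dom r -> Pc (ur r)).
  { intros r Hr. split.
    - apply Ccont_eps. intros t eps He. destruct (Cur r t Hr eps He) as [d [Hd H]]. exists d. split; auto.
      intros t' Ht'. apply H; auto. rewrite Rminus_diag, Rabs_R0; auto.
    - intros t. destruct (in_range_open _ _ _ Hr) as [d [Hd Ho]].
      eapply is_deriv_unique; [apply (Dr r (t + 2 * PI) Hr)|].
      apply is_deriv_ext_loc with (f := fun x => u x t) (d := d); auto. intros x Hx. symmetry. apply P. auto. }
  split; auto. split; auto. split; auto.
  intros r Hr. pose proof (sol_Pc r Hr) as Pu. pose proof (lam_neq0 a b a_pos) as N1.
  set (lam := mkC a b) in *.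
  assert (Eut : forall t, ut r t = ((Ci * CofR r * ur r t - Ci * lam * CofR nu * u r t + c t * Cconj (u r t)) / lam)%Cx).
  { intros t. pose proof (HL r t Hr) as L1. unfold L_expr in L1. apply Csub_eq0.
    transitivity ((lam * ut r t - Ci * (CofR r * ur r t) + Ci * (lam * (CofR nu * u r t)) - c t * Cconj (u r t)) / lam)%Cx;
      [field; auto|]. rewrite L1. field; auto. }
  apply weak_classical with (du := ut r); auto.
  - eapply Pc_ext; [intros; symmetry; apply Eut|]. unfold Cdiv. apply Pc_mul; [|apply Pc_const].
    apply Pc_add; [|apply Pc_mul; auto; apply Pc_conj; auto]. apply Pc_sub; apply Pc_scal; auto.
  - intros t. apply D; auto.
  - intros t. fold lam. rewrite Eut.
    replace (Ci * lam * ((Ci * CofR r * ur r t - Ci * lam * CofR nu * u r t + c t * Cconj (u r t)) / lam))%Cx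
      with (Ci * (Ci * (CofR r * ur r t - lam * CofR nu * u r t)) + Ci * (c t * Cconj (u r t)))%Cx by (field; auto).
    replace (Ci * (Ci * (CofR r * ur r t - lam * CofR nu * u r t)))%Cx with (- (CofR r * ur r t - lam * CofR nu * u r t))%Cx by cx.
    rewrite CofR_opp. ring.
Qed.

(** Expanding both [u(r, .)] and [u_r(r, .)], [coefficients_weak] shows that the coordinates of
    [u_r] are those of [u] times [sg i / r]. Boundedness of the coefficient functionals shows that
    they are also the derivatives in [r]. *)
Lemma sol_coefficients : exists X : R -> Z * bool -> R, (forall r, dom r -> Dec (u r) (X r)) /\
  forall r i, dom r -> is_deriv_C (fun x => Zc (X x) i) r (sg i * Zc (X r) i / CofR r)%Cx.
Proof.
  destruct sol_deriv as [ur [Dr [Cur [Pur W]]]]. destruct Dec_exists as [C [HC DE]].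
  assert (HX : forall f : R -> R -> Cx, (forall r, dom r -> Pc (f r)) ->
    exists X : R -> Z * bool -> R, forall r, dom r -> Dec (f r) (X r)).
  { intros f Pf. apply (choice_fun (fun r X => dom r -> Dec (f r) X)). intros r.
    destruct (classic (dom r)) as [Hr|Hr]; [|exists (fun _ => 0); tauto].
    destruct (Pc_bounded _ (Pf r Hr)) as [M [HM B]]. destruct (DE _ M (Pf r Hr) HM B) as [X [HX _]]. exists X; auto. }
  destruct (HX u sol_Pc) as [X DX]. destruct (HX ur Pur) as [X' DX']. exists X. split; auto.
  intros r i Hr. pose proof (dom_pos r Hr) as Hpos.
  assert (E0 : Zc (X' r) i = (sg i * Zc (X r) i / CofR r)%Cx).
  { assert (Nr : CofR r <> C0) by (apply CofR_neq0; lra).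
    assert (DY : Dec (fun t => CofR tau * u r t + CofR (- r) * ur r t)%Cx (fun k => tau * X r k + - r * X' r k)).
    (* [tau u] is written as [u + (tau - 1) u] to reuse [Dec_lin]. *)
    { apply Dec_lin; auto. pose proof (Dec_lin _ _ _ _ (tau - 1) (DX r Hr) (DX r Hr)) as D0.
      destruct D0 as [v [P [L [T E0]]]].
      exists v. split; auto. split; auto. split.
      - intros j Hj. rewrite T by auto. cx.
      - intros t. transitivity (u r t + CofR (tau - 1) * u r t)%Cx; [rewrite CofR_sub; change (CofR 1) with C1; ring|].
        rewrite E0. f_equal. apply clsum_ext. intros k _. f_equal. f_equal. ring. }
    pose proof (coefficients_weak _ _ _ _ (sol_Pc r Hr) (Pc_add _ _ (Pc_scal (CofR tau) _ (sol_Pc r Hr)) (Pc_scal (CofR (- r)) _ (Pur r Hr)))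
      (W r Hr) (DX r Hr) DY i) as E1.
    rewrite (Zc_lin (fun k => tau * X r k)) in E1.
    replace (Zc (fun k => tau * X r k) i) with (CofR tau * Zc (X r) i)%Cx in E1
      by (unfold Zc; destruct (isreal (fst i)); rewrite ?CofR_mul; ring).
    apply Csub_eq0. transitivity (((CofR tau - sg i) * Zc (X r) i - (CofR tau * Zc (X r) i + CofR (- r) * Zc (X' r) i)) / CofR r)%Cx.
    - rewrite CofR_opp. field; auto.
    - rewrite E1. field; auto. }
  rewrite <- E0. apply is_deriv_Zc. intros k.
  destruct Dec_bounded as [C' [HC' DB]]. intros eps He.
  destruct (diff_quotient_uniform dom u ur r Dr Cur Hr (in_range_open _ _ _ Hr) (fun r' Hr' => proj2 (Pur r' Hr'))
    (eps / (2 * C'))) as [d [Hd H]].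
  { apply Rdiv_lt_0_compat; lra. }
  exists (mkposreal d Hd). intros h Hh Hhd. simpl in Hhd. destruct (H h Hh Hhd) as [Hrh B].
  (* The coordinates of [u_r] minus the difference quotient are bounded by its sup norm, which tends
     to zero with [h]. *)
  assert (D1 : Dec (fun t => u (r + h)%R t + CofR (-1) * u r t)%Cx (fun k => X (r + h) k + -1 * X r k))
    by (apply Dec_lin; auto).
  pose proof (Dec_lin _ _ _ _ (- / h) (DX' r Hr) D1) as D2.
  assert (P2 : Pc (fun t => ur r t + CofR (- / h) * (u (r + h)%R t + CofR (-1) * u r t))%Cx).
  { apply Pc_add; [apply Pur; auto|]. apply Pc_scal. apply Pc_add; [apply sol_Pc; auto|]. apply Pc_scal, sol_Pc; auto. }
  pose proof (DB _ _ (eps / (2 * C')) P2 D2) as B2.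
  assert (0 < eps / (2 * C')) by (apply Rdiv_lt_0_compat; lra).
  specialize (B2 ltac:(auto)). assert (B3 : Rabs (X' r k + - / h * (X (r + h) k + -1 * X r k)) <= C' * (eps / (2 * C'))).
  { apply B2. intros t. eapply Rle_trans; [|apply (B t)]. right.
    rewrite <- (Cnorm_opp (CofR (/ h) * (u (r + h)%R t - u r t) - ur r t)%Cx). f_equal. cx. }
  replace (C' * (eps / (2 * C'))) with (eps / 2) in B3 by (field; lra).
  replace ((X (r + h) k - X r k) / h - X' r k) with (- (X' r k + - / h * (X (r + h) k + -1 * X r k))) by (field; auto).
  rewrite Rabs_Ropp. lra.
Qed.

(** Multiplying by [r^(- sg i)] makes each coordinate constant on the interval of radii. *)
Lemma sol_constants : exists (X : R -> Z * bool -> R) (A : Z * bool -> R), (forall r, dom r -> Dec (u r) (X r)) /\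
  forall r i, dom r -> Zc (X r) i = (Cpow r (sg i) * Zc A i)%Cx.
Proof.
  destruct sol_coefficients as [X [DX D]]. destruct (in_range_nonempty _ _ delta_lt) as [rb Hb].
  set (G := fun i r => (Cpow r (- sg i) * Zc (X r) i)%Cx).
  assert (DG : forall i r, dom r -> is_deriv_C (G i) r C0).
  { intros i r Hr. pose proof (dom_pos r Hr) as Hp.
    pose proof (is_deriv_mul _ _ r _ _ (is_deriv_Cpow (- sg i)%Cx r Hp) (D r i Hr)) as H.
    cbv beta in H. match type of H with is_deriv_C _ _ ?l => assert (El : l = C0) end.
    - field. apply CofR_neq0. lra.
    - rewrite El in H. exact H. }
  assert (Const : forall i r r', dom r -> dom r' -> r < r' -> G i r = G i r').
  { intros i r r' Hr Hr' L.
    assert (Hin : forall x, r <= x <= r' -> dom x) by (intros; apply (in_range_convex _ _ r r'); auto).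
    apply Cx_ext.
    - destruct (MVT_cor2 (fun x => Cre (G i x)) (fun _ => 0) r r' L) as [x [E0 _]]; [|lra].
      intros x Hx. apply (DG i x (Hin x Hx)).
    - destruct (MVT_cor2 (fun x => Cim (G i x)) (fun _ => 0) r r' L) as [x [E0 _]]; [|lra].
      intros x Hx. apply (DG i x (Hin x Hx)). }
  (* The constants are coordinates of real coefficients [A]: a real power keeps a real coordinate
     real, and for a nonreal exponent both signs give the same value. *)
  destruct (Zc_surj (fun i => G i rb)) as [A HA].
  { intros i R0. unfold G. rewrite Zc_real by auto. apply sg_real in R0.
    rewrite Cpow_real by (simpl; lra). simpl. ring. }
  { intros j R0. unfold G. rewrite <- Zc_nonreal, sg_false by auto. auto. }
  exists X, A. split; auto. intros r i Hr. rewrite HA.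
  replace (G i rb) with (G i r).
  - unfold G. transitivity ((Cpow r (sg i) * Cpow r (- sg i)) * Zc (X r) i)%Cx; [rewrite Cpow_opp; ring|ring].
  - destruct (Rtotal_order r rb) as [L|[->|L]]; auto. symmetry; auto.
Qed.

(** For [j > 0] the coordinate at [r] is compared with the one at a larger radius, for [j < 0] with
    the one at a smaller radius. As [Re (sg j)] grows linearly with the sign of [j], both
    comparisons gain [q ^ |j|]. *)
Lemma sol_converges X A r t : (forall r, dom r -> Dec (u r) (X r)) ->
  (forall r i, dom r -> Zc (X r) i = (Cpow r (sg i) * Zc A i)%Cx) -> dom r ->
  ccv (symsum (fun j => CofR (A (j, true)) * w (j, true) r t + CofR (A (j, false)) * w (j, false) r t)%Cx) (u r t).
Proof.
  intros DX HA Hr. pose proof (dom_pos r Hr) as Hp.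
  destruct (in_range_open _ _ _ Hr) as [d [Hd Ho]].
  assert (H1 : dom (r - d / 2)) by (apply Ho; apply Rabs_def1; lra).
  assert (H2 : dom (r + d / 2)) by (apply Ho; apply Rabs_def1; lra).
  set (r1 := r - d / 2) in *. set (r2 := r + d / 2) in *.
  pose proof (dom_pos _ H1) as Hp1. pose proof (dom_pos _ H2) as Hp2.
  assert (L1 : ln r1 < ln r) by (apply ln_increasing; unfold r1 in *; lra).
  assert (L2 : ln r < ln r2) by (apply ln_increasing; unfold r2 in *; lra).
  (* Logarithmic distance from [r] to the nearer comparison radius; [q = exp (- ga * ell)] is the
     resulting ratio. *)
  set (ell := Rmin (ln r - ln r1) (ln r2 - ln r)).
  assert (Hl : 0 < ell) by (apply Rmin_pos; lra).
  assert (Hl1 : ell <= ln r - ln r1) by apply Rmin_l. assert (Hl2 : ell <= ln r2 - ln r) by apply Rmin_r.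
  destruct Dec_bounded0 as [C [HC DB]]. destruct Zc_bounds as [Cb [HCb [_ ZB]]].
  assert (BX : exists D, 0 < D /\ forall i, Cnorm (Zc (X r1) i) <= D /\ Cnorm (Zc (X r2) i) <= D).
  { destruct (Pc_bounded _ (sol_Pc _ H1)) as [M1 [HM1 B1]]. destruct (Pc_bounded _ (sol_Pc _ H2)) as [M2 [HM2 B2]].
    exists (Cb * (C * (M1 + M2))). split; [repeat apply Rmult_lt_0_compat; lra|].
    intros i. split; apply ZB; intros k.
    - apply (DB (u r1)); auto using sol_Pc. intros x; specialize (B1 x); lra.
    - apply (DB (u r2)); auto using sol_Pc. intros x; specialize (B2 x); lra. }
  destruct BX as [D [HD BX]].
  set (q := exp (- (ga * ell))).
  assert (Hq : 0 <= q < 1).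
  { unfold q. split; [left; apply exp_pos|]. rewrite <- exp_0. apply exp_increasing.
    assert (0 < ga * ell) by (apply Rmult_lt_0_compat; auto). lra. }
  assert (Rel : forall r' i, dom r' -> Cnorm (Zc (X r) i) = Cnorm (Zc (X r') i) * exp (Cre (sg i) * (ln r - ln r'))).
  { intros r' i Hr'. rewrite !HA, !Cnorm_mul, !Cnorm_Cpow by auto. unfold Rpower.
    transitivity (Cnorm (Zc A i) * (exp (Cre (sg i) * ln r') * exp (Cre (sg i) * (ln r - ln r')))); [|ring].
    rewrite <- exp_plus. rewrite Rmult_comm. f_equal. f_equal. ring. }
  set (bd := fun j : Z => D * q ^ Z.abs_nat j).
  assert (Sb : summable bd) by (apply summable_scal; [lra|apply summable_geometric; auto]).
  assert (Tail : forall j, tl j = true -> Cnorm (Zc (X r) (j, true)) <= bd j).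
  { intros j T. destruct (re_large j T) as [G1 G2]. unfold bd, q. rewrite <- exp_mul_INR.
    assert (EJ : INR (Z.abs_nat j) = Rabs (IZR j)) by (rewrite INR_IZR_INZ, Zabs2Nat.id_abs, Rabs_Zabs; auto).
    rewrite EJ.
    assert (Ex : forall x y, x <= y -> exp x <= exp y)
      by (intros x y [Hxy| ->]; [left; apply exp_increasing; auto|right; auto]).
    assert (Nj : j <> 0%Z).
    { intros ->. apply tl_abs in T. rewrite Rabs_R0 in T. pose proof INR_N0. lra. }
    destruct (Z_lt_le_dec 0 j) as [L|L].
    - rewrite (Rel r2 (j, true) H2). apply Rmult_le_compat; [apply Cnorm_ge0|left; apply exp_pos|apply BX|].
      apply Ex. specialize (G1 L). apply (IZR_lt 0) in L. rewrite Rabs_pos_eq by lra.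
      assert (0 < ga * IZR j) by (apply Rmult_lt_0_compat; lra). nra.
    - assert (L' : (j < 0)%Z) by lia. rewrite (Rel r1 (j, true) H1).
      apply Rmult_le_compat; [apply Cnorm_ge0|left; apply exp_pos|apply BX|].
      apply Ex. specialize (G2 L'). apply (IZR_lt j 0) in L'. rewrite Rabs_left by lra.
      assert (0 < ga * - IZR j) by (apply Rmult_lt_0_compat; lra). nra. }
  destruct (DX r Hr) as [v [Pv [Lv [Tv Ev]]]].
  assert (Bv : forall j, Cnorm (F v j) <= bd j).
  { intros j. destruct (tl j) eqn:T; [rewrite Tv, <- (Zc_tail _ j true) by auto; auto|].
    rewrite Lv, Cnorm_C0 by auto. apply Sb. }
  (* The coefficients are now summable, so [v] is its own Fourier series and [v + K0 v] an actual
     sum of tail terms. *)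
  destruct (tail_sum (F v) bd Sb Bv Lv) as [_ [_ Es]].
  assert (Einv : forall t, v t = zsum (fun j => F v j * en j t)%Cx) by (apply fourier_inversion with bd; auto).
  set (ze := fun i => Zc (X r) i).
  assert (Eu : u r t = (symsum (fun j => Bf ze j t) N0 + zsum (fun j => if tl j then Bf ze j t else C0))%Cx).
  { rewrite Ev, low_sum. f_equal. rewrite (K0_ext _ _ Einv), Einv, Es. apply zsum_ext. intros j.
    destruct (tl j) eqn:T; auto. unfold Bf. destruct (isreal j) as [R0|_]; [exfalso; apply (tl_nonreal j T R0)|].
    unfold ze. rewrite Zc_tail, <- Tv by auto. ring. }
  rewrite Eu.
  (* The low part of the partial sums is constant from rank [N0] on; the tail part has a geometric
     majorant. *)
  apply ccv_ext with (fun N => symsum (fun j => if tl j then C0 else Bf ze j t) N + symsum (fun j => if tl j then Bf ze j t else C0) N)%Cx.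
  - intros N. rewrite <- symsum_add. apply symsum_ext. intros j _.
    transitivity (Bf ze j t); [destruct (tl j); ring|]. rewrite block_w by auto. apply Bf_ext. intros. apply HA; auto.
  - apply ccv_add.
    + intros eps He. exists N0. intros n Hn.
      rewrite (symsum_finite _ N0) by (auto; intros j Hj; unfold tl; rewrite (proj2 (Z.ltb_lt _ _)) by auto; auto).
      rewrite (symsum_ext _ (fun j => Bf ze j t)) by (intros j Hj; unfold tl; rewrite (proj2 (Z.ltb_ge _ _)) by auto; auto).
      replace (symsum (fun j => Bf ze j t) N0 - symsum (fun j => Bf ze j t) N0)%Cx with C0 by ring. rewrite Cnorm_C0; auto.
    + apply symsum_ccv_zsum with (fun j => (1 + 2 * K) * bd j); [apply summable_scal; auto; lra|].
      intros j. destruct (tl j) eqn:T.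
      * unfold Bf. destruct (isreal j) as [R0|_]; [exfalso; apply (tl_nonreal j T R0)|].
        replace (Ei (j, true) (ze (j, true)) t + C0)%Cx with (Ei (j, true) (ze (j, true)) t) by ring.
        eapply Rle_trans; [apply tail_E_le; auto|]. apply Rmult_le_compat_l; [lra|]. apply Tail; auto.
      * rewrite Cnorm_C0. apply Rmult_le_pos; [lra|apply Sb].
Qed.
End Solution.

(** The estimate is [|A i| <= Cb |Zc A i|] with [|Zc A i| = R0^(- Re (sg i)) |Zc (X R0) i|], the
    last factor being controlled by [M]. *)
Lemma laurent_expansion : exists Cst, 0 < Cst /\ forall delta Rmax u, 0 <= delta -> below_max delta Rmax ->
  L_solution (mkC a b) nu c (in_range delta Rmax) u ->
  exists A : Z * bool -> R,
    (forall r t, in_range delta Rmax r ->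
      ccv (symsum (fun j => CofR (A (j, true)) * w (j, true) r t + CofR (A (j, false)) * w (j, false) r t)%Cx) (u r t)) /\
    (forall R0, in_range delta Rmax R0 -> forall M, (forall th, Cnorm (u R0 th) <= M) ->
      forall i, Rabs (A i) <= Cst / Rpower R0 (Cre (sg i)) * M).
Proof.
  destruct Dec_bounded0 as [C [HC DB]]. destruct Zc_bounds as [Cb [HCb [ZA ZB]]].
  exists (Cb * (Cb * C)). split; [repeat apply Rmult_lt_0_compat; auto|].
  intros delta Rmax u Hd Hb Hu. destruct (sol_constants delta Rmax u Hd Hb Hu) as [X [A [DX HA]]].
  exists A. split; [intros; eapply sol_converges; eauto|].
  intros R0 HR M HM i. eapply Rle_trans; [apply ZA|].
  assert (B1 : Cnorm (Zc (X R0) i) <= Cb * (C * M)).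
  { apply ZB. intros k. apply (DB (u R0)); auto. eapply sol_Pc; eauto. }
  rewrite HA, Cnorm_mul, Cnorm_Cpow in B1 by auto. set (p := Rpower R0 (Cre (sg i))) in *.
  assert (Hp : 0 < p) by apply exp_pos.
  apply Rmult_le_reg_l with p; auto.
  replace (p * (Cb * (Cb * C) / p * M)) with (Cb * (Cb * (C * M))) by (field; lra).
  replace (p * (Cb * Cnorm (Zc A i))) with (Cb * (p * Cnorm (Zc A i))) by ring.
  apply Rmult_le_compat_l; lra.
Qed.
End Tail.

(** * From the asymptotics of the family to the tail hypotheses *)

Lemma C_k_Ccont k c : (2 <= k)%nat -> C_k k c -> Ccont c.
Proof.
  intros Hk [D [D0 [DD _]]]. apply Ccont_ext with (D 0%nat); auto.
  apply is_deriv_Ccont with (D 1%nat). intros t. apply DD. lia.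
Qed.

(** The last two inequalities let half of [|b| |j|] and half of [a |j|] absorb the lower-order terms
    of the exponent. *)
Lemma tail_rank a b g K (J : Z) : 0 < a -> b <> 0 -> 0 < K ->
  exists N0 : nat, (1 <= N0)%nat /\ (J <= Z.of_nat N0)%Z /\ 768 * K ^ 2 <= INR N0 /\
    2 * (Rabs b + K) <= Rabs b * INR N0 /\ 2 * (a + Rabs g + K) <= a * INR N0.
Proof.
  intros Ha Hb HK. assert (Hb' : 0 < Rabs b) by (apply Rabs_pos_lt; auto). pose proof (Rabs_pos g) as Hg.
  set (x1 := 768 * K ^ 2). set (x2 := 2 * (Rabs b + K) / Rabs b). set (x3 := 2 * (a + Rabs g + K) / a).
  assert (0 <= x1) by (unfold x1; pose proof (pow2_ge_0 K); lra).
  assert (0 <= x2) by (left; apply Rdiv_lt_0_compat; lra).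
  assert (0 <= x3) by (left; apply Rdiv_lt_0_compat; lra).
  set (x := Rabs (IZR J) + x1 + x2 + x3 + 1). pose proof (Rle_abs (IZR J)). pose proof (Rabs_pos (IZR J)).
  destruct (archimed x) as [A _]. exists (Z.to_nat (up x)).
  assert (P : (0 < up x)%Z) by (apply lt_IZR; unfold x in *; lra).
  assert (EN : INR (Z.to_nat (up x)) = IZR (up x)) by (rewrite INR_IZR_INZ, Z2Nat.id by lia; auto).
  rewrite EN. rewrite Z2Nat.id by lia. split; [lia|]. split; [apply le_IZR; unfold x in *; lra|].
  split; [unfold x in *; lra|]. split.
  - apply Rle_trans with (Rabs b * x2); [unfold x2; right; field; lra|]. apply Rmult_le_compat_l; unfold x in *; lra.
  - apply Rle_trans with (a * x3); [unfold x3; right; field; lra|]. apply Rmult_le_compat_l; unfold x in *; lra.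
Qed.

(** The shift [nu] costs at most [|b|] or [a], the term [gamma / j] at most [|gamma|], the remainder
    at most [K]. The size of the imaginary part feeds the resolvent, the sign of the real part the
    geometric convergence. *)
Lemma exponent_bounds a b nu g K s j : 0 < a -> b <> 0 -> 0 <= nu < 1 -> 0 < K -> 1 <= Rabs (IZR j) ->
  Cnorm (s - (mkC a b * CofR (IZR j + nu) + CofR (g / IZR j)))%Cx <= K / IZR j ^ 2 ->
  2 * (Rabs b + K) <= Rabs b * Rabs (IZR j) -> 2 * (a + Rabs g + K) <= a * Rabs (IZR j) ->
  Rabs b / 2 * Rabs (IZR j) <= Rabs (Cim s) /\
  ((0 < j)%Z -> a / 2 * IZR j <= Cre s) /\ ((j < 0)%Z -> Cre s <= a / 2 * IZR j).
Proof.
  intros Ha Hb Hnu HK Hj Hs H1 H2. set (e := (s - (mkC a b * CofR (IZR j + nu) + CofR (g / IZR j)))%Cx) in *.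
  assert (HKj : K / IZR j ^ 2 <= K).
  { rewrite <- pow2_abs. assert (1 <= Rabs (IZR j) ^ 2) by nra.
    apply Rmult_le_reg_l with (Rabs (IZR j) ^ 2); [lra|].
    replace (Rabs (IZR j) ^ 2 * (K / Rabs (IZR j) ^ 2)) with K by (field; lra). nra. }
  pose proof (Rle_trans _ _ _ (Cre_le_norm e) (Rle_trans _ _ _ Hs HKj)) as Er.
  pose proof (Rle_trans _ _ _ (Cim_le_norm e) (Rle_trans _ _ _ Hs HKj)) as Ei.
  assert (Es : Cre s = a * (IZR j + nu) + g / IZR j + Cre e) by (unfold e; simpl; ring).
  assert (Et : Cim s = b * (IZR j + nu) + Cim e) by (unfold e; simpl; ring).
  assert (Eg : Rabs (g / IZR j) <= Rabs g).
  { unfold Rdiv. rewrite Rabs_mult, Rabs_inv. pose proof (Rabs_pos g).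
    assert (/ Rabs (IZR j) <= 1) by (rewrite <- Rinv_1; apply Rinv_le_contravar; lra). nra. }
  apply Rabs_le_between in Er. apply Rabs_le_between in Eg.
  split; [|split].
  - rewrite Et. pose proof (Rabs_triang_inv (b * (IZR j + nu)) (- Cim e)) as T.
    rewrite Rabs_Ropp, Rabs_mult in T. unfold Rminus in T. rewrite Ropp_involutive in T.
    pose proof (Rabs_triang_inv (IZR j) (- nu)) as T2. rewrite Rabs_Ropp, (Rabs_pos_eq nu) in T2 by lra.
    unfold Rminus in T2. rewrite Ropp_involutive in T2. assert (0 < Rabs b) by (apply Rabs_pos_lt; auto). nra.
  - intros Lj. apply (IZR_lt 0) in Lj. rewrite (Rabs_pos_eq (IZR j)) in H2 by lra.
    assert (0 <= a * nu) by (apply Rmult_le_pos; lra). lra.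
  - intros Lj. apply (IZR_lt j 0) in Lj. rewrite (Rabs_left (IZR j)) in H2 by lra.
    assert (a * nu <= a * 1) by (apply Rmult_le_compat_l; lra). lra.
Qed.

Theorem theorem6p2 :
  forall (a b nu : R) (k : nat) (c : R -> Cx),
    0 < a -> b <> 0 -> 0 <= nu < 1 -> (2 <= k)%nat ->
    periodic2pi c -> C_k k c ->
  forall gamma : R,
    (forall pr : Riemann_integrable (fun t => Cnorm (c t) ^ 2) 0 (2 * PI),
        gamma = RiemannInt pr / (4 * a * PI)) ->
  forall (w : Z -> bool -> R -> R -> Cx) (sig : Z -> bool -> Cx),
    fixed_family (mkC a b) nu c gamma w sig ->
  exists Cst : R, 0 < Cst /\
    forall (delta : R) (Rmax : option R) (u : R -> R -> Cx),
      0 <= delta -> below_max delta Rmax ->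
      L_solution (mkC a b) nu c (in_range delta Rmax) u ->
      exists coef : Z -> bool -> R,
        (forall r t, in_range delta Rmax r ->
           Cseq_cv
             (symsum (fun j => Cadd (Cmul (CofR (coef j true)) (w j true r t))
                                    (Cmul (CofR (coef j false)) (w j false r t))))
             (u r t)) /\
        (forall R0 : R, in_range delta Rmax R0 ->
           forall M : R, (forall th, Cnorm (u R0 th) <= M) ->
           forall (j : Z) (pm : bool),
             Rabs (coef j pm) <= Cst / Rpower R0 (Cre (sig j pm)) * M).
Proof.
  intros a b nu k c Ha Hb Hnu Hk Pc0 Hck gamma _ w sig [Hfam [J [K [HJ [HK Htail]]]]].
  assert (c_Pc : Pc c) by (split; [eapply C_k_Ccont; eauto|auto]).
  destruct (weak_kernel a b nu c Ha Hb Hnu c_Pc) as [tau Hker].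
  set (ww := fun i : Z * bool => w (fst i) (snd i)). set (sg := fun i : Z * bool => sig (fst i) (snd i)).
  assert (Hit : forall i : Z * bool, exists P : (R -> Cx) * (R -> Cx),
            item a b nu c (ww i) (sg i) (fst i) (fst P) (snd P)).
  { intros [j p]. destruct (basic_item a b nu c Ha (w j p) (sig j p) j) as [phi [psi I]].
    - destruct (Hfam j) as [B1 [B2 _]]. destruct p; auto.
    - exists (phi, psi). exact I. }
  apply choice_fun in Hit. destruct Hit as [P items].
  set (ph := fun i => fst (P i)). set (ps := fun i => snd (P i)).
  destruct (tail_rank a b gamma K J Ha Hb HK) as [N0 [N1 [NJ [N2 [N3 N4]]]]].
  assert (Tj : forall j, tl N0 j = true -> INR N0 <= Rabs (IZR j) /\ (J <= Z.abs j)%Z).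
  { intros j T. pose proof (tl_abs N0 N1 j T). unfold tl in T. apply Z.ltb_lt in T. split; [lra|lia]. }
  assert (HN1 : 1 <= INR N0) by (apply (le_INR 1); auto).
  assert (Hexp : forall j, tl N0 j = true -> Rabs b / 2 * Rabs (IZR j) <= Rabs (Cim (sg (j, true))) /\
     ((0 < j)%Z -> a / 2 * IZR j <= Cre (sg (j, true))) /\ ((j < 0)%Z -> Cre (sg (j, true)) <= a / 2 * IZR j)).
  { intros j T. destruct (Tj j T) as [T1 T2]. destruct (Htail j T2) as [s [phi [psi [E1 [_ [_ [_ [Hs _]]]]]]]].
    unfold sg; simpl. rewrite E1. assert (0 < Rabs b) by (apply Rabs_pos_lt; auto).
    apply (exponent_bounds a b nu gamma K s j); auto; try lra; nra. }
  assert (Hbe : 0 < Rabs b / 2) by (assert (0 < Rabs b) by (apply Rabs_pos_lt; auto); lra).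
  assert (Hnr : forall j, tl N0 j = true -> Cim (sg (j, true)) <> 0).
  { intros j T E0. destruct (Tj j T) as [T1 _]. destruct (Hexp j T) as [B _]. rewrite E0, Rabs_R0 in B. nra. }
  assert (Hrep : forall j, tl N0 j = true -> sg (j, false) = sg (j, true) /\
     (forall t, Cnorm (ph (j, true) t - en j t)%Cx <= K / Rabs (IZR j)) /\
     (forall t, Cnorm (ps (j, true) t) <= K / Rabs (IZR j)) /\
     (forall t, ph (j, false) t = (Ci * ph (j, true) t)%Cx /\ ps (j, false) t = (Ci * ps (j, true) t)%Cx)).
  (* The pairs chosen for the items are identified with the asymptotic ones; for the sign [-],
     [i (r^s phi - conj (r^s psi))] equals [r^s (i phi) + conj (r^s (i psi))]. *)
  { intros j T. destruct (Tj j T) as [_ T2]. pose proof (Hnr j T) as Him.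
    destruct (Htail j T2) as [s [phi [psi [E1 [E2 [_ [_ [_ [Bp [Bq [W1 W2]]]]]]]]]]].
    assert (Es : s = sg (j, true)) by (unfold sg; simpl; auto). rewrite Es in W1, W2.
    assert (Ef : sg (j, false) = sg (j, true)) by (unfold sg; simpl; congruence).
    assert (A1 : forall t, ph (j, true) t = phi t /\ ps (j, true) t = psi t).
    { apply (E_Cpow_inj (sg (j, true))); auto. intros r t Hr.
      etransitivity; [symmetry; apply (item_w (items (j, true)) r t Hr)|apply W1; auto]. }
    assert (A2 : forall t, ph (j, false) t = (Ci * phi t)%Cx /\ ps (j, false) t = (Ci * psi t)%Cx).
    { apply (E_Cpow_inj (sg (j, true)) (ph (j, false)) (ps (j, false)) (fun t => Ci * phi t)%Cx (fun t => Ci * psi t)%Cx); auto.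
      intros r t Hr. transitivity (w j false r t); [|rewrite W2 by auto; unfold E; cx].
      rewrite <- Ef. symmetry. apply (item_w (items (j, false)) r t Hr). }
    split; auto. split; [|split].
    - intros t. destruct (A1 t) as [-> _]. specialize (Bp t).
      replace (Cexp (mkC 0 (- (IZR j * t)))) with (en (- j) t) in Bp
        by (unfold en; f_equal; f_equal; rewrite opp_IZR; ring).
      (* The hypothesis bounds [phi e^(-ijt) - 1]; multiplying by the unimodular [e^(ijt)] keeps the
         norm. *)
      replace (phi t - en j t)%Cx with ((phi t * en (- j) t - C1) * en j t)%Cx.
      + rewrite Cnorm_mul, Cnorm_en. lra.
      + assert (E0 : (en (- j) t * en j t)%Cx = C1) by (rewrite en_add, Z.add_opp_diag_l; apply en_0).
        transitivity (phi t * (en (- j) t * en j t) - en j t)%Cx; [ring|]. rewrite E0. ring.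
    - intros t. destruct (A1 t) as [_ ->]. apply Bq.
    - intros t. destruct (A1 t) as [-> ->]. apply A2. }
  assert (Hind : forall j, R_independent (ww (j, true)) (ww (j, false))) by (intros j; apply (Hfam j)).
  assert (Hpn : forall j t, tl N0 j = true -> Cnorm (ph (j, true) t - en j t)%Cx <= K / Rabs (IZR j))
    by (intros j t T; apply (Hrep j T)).
  assert (Hps : forall j t, tl N0 j = true -> Cnorm (ps (j, true) t) <= K / Rabs (IZR j))
    by (intros j t T; apply (Hrep j T)).
  assert (Hsl : forall j, tl N0 j = true -> Rabs b / 2 * Rabs (IZR j) <= Rabs (Cim (sg (j, true))))
    by (intros j T; apply (Hexp j T)).
  destruct (block_exists a b nu c Ha c_Pc ww sg ph ps N0 K (Rabs b / 2) items N1 HK Hbe N2 Hpn Hps Hsl tau Hker Hind)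
    as [kap [Ktail Kblock]].
  { intros j T. split; apply (Hrep j T). }
  destruct (laurent_expansion a b nu c Ha c_Pc ww sg ph ps N0 K (Rabs b / 2) items N1 HK Hbe N2 Hpn Hps Hsl tau Hker Hind
    kap Ktail Kblock (a / 2) ltac:(lra)) as [Cst [HC HL]].
  { intros j T. apply (Hexp j T). }
  exists Cst. split; auto. intros delta Rmax u Hd Hbm Hu.
  destruct (HL delta Rmax u Hd Hbm Hu) as [A [Hcv Hbd]]. exists (fun j p => A (j, p)). split.
  - intros r t Hr. apply ccv_Cseq_cv. exact (Hcv r t Hr).
  - intros R0 HR M HM j pm. exact (Hbd R0 HR M HM (j, pm)).
Qed.
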